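(* Let $a>0$ and $\beta\in\mathbb{R}$ with $3\beta^2\neq 2a$, and let $\tau_0=\frac{\beta+\sqrt{\beta^2+2a}}{a}$. Let $\ell\ge 2$ be an integer and, for each $j=2,\dots,\ell$, let $w_j\in W_j$, where $W_j$ is the space of degree-$j$ normal form terms for the triple-zero nilpotency defined in the context. Let $B=\begin{pmatrix}0&1&0\\0&0&1\\0&0&0\end{pmatrix}$. Then there exist polynomial functions $F,G:\mathbb{R}^2\to\mathbb{R}$, vanishing at the origin together with their first order partial derivatives, such that the Faria–Magalhães center manifold and normal form reduction up to order $\ell$ (as defined in the context, relative to the complements $W_j$) of the delay-differential system $$\dot x(t)=y(t),$$ $$\dot y(t)=-a\,(x(t)-x(t-\tau_0))+a\tau_0\,y(t)-\beta\,(y(t)-y(t-\tau_0))+F(x(t),y(t))+G(x(t-\tau_0),y(t-\tau_0))$$ at the equilibrium $0$ is $$\dot u=Bu+\sum_{j=2}^{\ell}w_j(u),\qquad u\in\mathbb{R}^3.$$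
   Context: **Normal form spaces.** For $j\ge 2$ let $H^j$ be the space of homogeneous polynomial mappings of degree $j$ from $\mathbb{R}^3$ to $\mathbb{R}^3$, and let $L_B:H^j\to H^j$ be the homological operator $(L_Bh)(u)=Dh(u)\,Bu-B\,h(u)$. Let $W_j\subset H^j$ be the subspace spanned by the mappings $$(0,0,u_1^{j-i}u_2^i)^T,\quad i=0,\dots,j,$$ together with $$(0,0,u_1^{j-1-i}u_3^{i+1})^T,\quad i=0,\dots,\tfrac12(j-2)\ \text{if } j \text{ is even},\qquad i=0,\dots,\tfrac12(j-1)\ \text{if } j\text{ is odd}.$$ One has the (known) splitting $H^j=L_B(H^j)\oplus W_j$. **Functional analytic setting.** Let $C=C([-\tau_0,0],\mathbb{R}^2)$ with the supremum norm, $z=(x,y)^T$, $z_t(\theta)=z(t+\theta)$ for $-\tau_0\le\theta\le0$. The system is $\dot z(t)=\mathcal{L}z_t+\mathcal{F}(z_t)$, where $$\mathcal{L}\phi=\int_{-\tau_0}^0[d\eta(\theta)]\phi(\theta)=\begin{pmatrix}0&1\\ -a&a\tau_0-\beta\end{pmatrix}\phi(0)+\begin{pmatrix}0&0\\ {a}&\beta\end{pmatrix}\phi(-\tau_0),\qquad \mathcal{F}(\phi)=\begin{pmatrix}0\\ {F}(\phi(0))+G(\phi(-\tau_0))\end{pmatrix}.$$ Let $A$ be the infinitesimal generator of the flow of $\dot z=\mathcal{L}z_t$. For these parameter values, $0$ is an eigenvalue of $A$ of algebraic multiplicity three and geometric multiplicity one, and $A$ has no other eigenvalue on the imaginary axis.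 Its generalized eigenspace $P\subset C$ for the eigenvalue $0$ has as basis the columns of $$\Phi(\theta)=\begin{pmatrix}1&\theta&\tfrac12\theta^2\\0&1&\theta\end{pmatrix},\qquad \dot\Phi=\Phi B.$$ Let $C^*$ be the space of continuous functions on $[0,\tau_0]$ with values in row vectors of length $2$, with the bilinear form $$(\psi,\phi)=\psi(0)\phi(0)-\int_{-\tau_0}^0\int_0^\theta\psi(\zeta-\theta)\,[d\eta(\theta)]\,\phi(\zeta)\,d\zeta .$$ Let $\Psi$ be the $3\times2$ matrix function on $[0,\tau_0]$ whose rows form a basis of the generalized eigenspace, for the eigenvalue $0$, of the transposed (formal adjoint) system, satisfying $\dot\Psi=-B\Psi$ and normalized by $(\Psi,\Phi)=I$. Let $C=P\oplus Q$ with $Q=\{\varphi\in C:(\Psi,\varphi)=0\}$, and let $Q^1=Q\cap C^1$, where $C^1$ is the set of continuously differentiable elements of $C$. Let $BC$ be the Banach space of functions $[-\tau_0,0]\to\mathbb{R}^2$ that are uniformly continuous on $[-\tau_0,0)$ with a possible jump at $0$. Let $X_0(\theta)=0$ for $\theta<0$ and $X_0(0)=I_2$. Elements of $BC$ are written $\varphi+X_0\lambda$ with $\varphi\in C$, $\lambda\in\mathbb{R}^2$. Define the projection $\pi:BC\to P$ by $\pi(\varphi+X_0\lambda)=\Phi[(\Psi,\varphi)+\Psi(0)\lambda]$, and $A_{Q^1}:Q^1\to\ker\pi$ by $A_{Q^1}\varphi=\dot\varphi+X_0[\mathcal{L}\varphi-\dot\varphi(0)]$. Writing $z_t=\Phi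 u+v$ with $u\in\mathbb{R}^3$, $v\in Q^1$, the system becomes $$\dot u=Bu+\Psi(0)\mathcal{F}(\Phi u+v),\qquad \frac{d}{dt}v=A_{Q^1}v+(I-\pi)X_0\mathcal{F}(\Phi u+v).\qquad( * )$$ **Faria–Magalhães center manifold and normal form reduction up to order $\ell$.** Successively for $j=2,\dots,\ell$, one applies to $( * )$ (with its nonlinear terms Taylor expanded at the origin) near-identity changes of variables $(u,v)=(\hat u,\hat v)+(U_j^1(\hat u),U_j^2(\hat u))$, where $U_j^1$ and $U_j^2$ are homogeneous polynomials of degree $j$ in $\hat u$ with coefficients in $\mathbb{R}^3$ and $Q^1$ respectively, so that (dropping hats) the transformed system has the form $$\dot u=Bu+\sum_{j\ge2}g_j^1(u,v),\qquad \frac{d}{dt}v=A_{Q^1}v+\sum_{j\ge2}g_j^2(u,v),$$ where $g_j^1,g_j^2$ are the terms homogeneous of degree $j$ in $(u,v)$, and, for $2\le j\le\ell$, $g_j^2(u,0)=0$ and $g_j^1(\cdot,0)\in W_j$. The resulting reduction up to order $\ell$ is the vector field $\dot u=Bu+\sum_{j=2}^{\ell}g_j^1(u,0)$ on $\mathbb{R}^3$, which represents the flow on the local center manifold (locally $v=0$) up to terms of order $\ell+1$. *)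

(* Defs.v *)
From HB Require Import structures.
From mathcomp Require Import all_boot all_order all_algebra.
From mathcomp Require Import all_classical all_reals all_analysis.

Set Implicit Arguments.
Unset Strict Implicit.
Unset Printing Implicit Defensive.

Import Order.TTheory GRing.Theory Num.Theory.
Import numFieldNormedType.Exports.

Local Open Scope classical_set_scope.
Local Open Scope ring_scope.

Section Calculus.
Context {R : realType}.

(* Derivative of [f] at [x] relative to the set [I]; at an endpoint of a closed
   interval it is the one-sided derivative. *)
Definition derive_in (I : set R) (V : normedModType R) (f : R -> V) (x : R) : V :=
  lim ((fun y => (y - x)^-1 *: (f y - f x)) @ within I x^').

Definition derivable_in (I : set R) (V : normedModType R) (f : R -> V) (x : R) :=
  cvg ((fun y => (y - x)^-1 *: (f y - f x)) @ within I x^').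

Definition C1_in (I : set R) (V : normedModType R) (f : R -> V) :=
  (forall x, I x -> derivable_in I f x) /\
  {within I, continuous (derive_in I f)}.

Definition oint (x y : R) (f : R -> R) : R :=
  if x <= y then Rintegral lebesgue_measure `[x, y] f
  else - Rintegral lebesgue_measure `[y, x] f.

Definition jacobian_mx (h : 'cV[R]_3 -> 'cV[R]_3) (u : 'cV[R]_3) : 'M[R]_3 :=
  \matrix_(i, j) 'D_(delta_mx j 0) (fun x => h x i 0) u.

Definition taylor_coef (V : normedModType R) (j : nat) (f : R -> V) : V :=
  (j`!%:R)^-1 *: derive1n j f 0.

Definition polynomial2 (F : R -> R -> R) :=
  exists p : {poly {poly R}}, forall x y, F x y = p.[x%:P].[y].

Definition vanishes_to_first_order (F : R -> R -> R) :=
  [/\ F 0 0 = 0, derive1 (fun x => F x 0) 0 = 0 & derive1 (fun y => F 0 y) 0 = 0].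

Definition homogeneous_map (V : lmodType R) (S : set V) (j : nat)
    (h : 'cV[R]_3 -> V) :=
  exists2 c : nat -> nat -> V, (forall p q, S (c p q)) &
    forall u, h u = \sum_(p < j.+1) \sum_(q < (j - p).+1)
      (u 0 0 ^+ p * u 1 0 ^+ q * u 2%:R 0 ^+ (j - p - q)) *: c p q.

End Calculus.

Section NormalFormSpaces.
Context {R : realType}.

Definition mx_of_rows m n (rows : seq (seq R)) : 'M[R]_(m, n) :=
  \matrix_(i, j) (nth [::] rows i)`_j.

Definition Bmx : 'M[R]_3 := mx_of_rows 3 3
  [:: [:: 0; 1; 0];
      [:: 0; 0; 1];
      [:: 0; 0; 0]].

Definition W_extra (j : nat) : nat := if odd j then (j - 1)./2 else (j - 2)./2.

Definition W_space (j : nat) (w : 'cV[R]_3 -> 'cV[R]_3) :=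
  exists c d : nat -> R, forall u, w u =
    (\sum_(0 <= i < j.+1) c i * (u 0 0 ^+ (j - i) * u 1 0 ^+ i) +
     \sum_(0 <= i < (W_extra j).+1) d i * (u 0 0 ^+ (j - 1 - i) * u 2%:R 0 ^+ i.+1))
    *: delta_mx 2%:R 0.

End NormalFormSpaces.

Section DelayEquation.
Context {R : realType}.
Variables (a beta : R).

Definition tau0 : R := (beta + Num.sqrt (beta ^+ 2 + 2 * a)) / a.

(* A function on [-tau0, 0] (resp. [0, tau0]) is represented by a function on R
   whose values off the interval are irrelevant: all conditions below are tested
   on the interval only. *)
Definition Idelay : set R := `[- tau0, 0].
Definition Iadj : set R := `[0, tau0].

(* [eta] is a pure jump function: d eta is the sum of the matrix-valued point
   masses [p.2] at the points [p.1], so that the integral of [k theta (d eta)]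
   is the sum of the [k p.1 p.2]. *)
Definition eta_atoms : seq (R * 'M[R]_2) :=
  [:: (0, mx_of_rows 2 2 [:: [:: 0; 1]; [:: - a; a * tau0 - beta]]);
      (- tau0, mx_of_rows 2 2 [:: [:: 0; 0]; [:: a; beta]])].

Definition eta_int (V : nmodType) (k : R -> 'M[R]_2 -> V) : V :=
  \sum_(p <- eta_atoms) k p.1 p.2.

Definition Lop (phi : R -> 'cV[R]_2) : 'cV[R]_2 :=
  eta_int (fun theta deta => deta *m phi theta).

Definition Nop (F G : R -> R -> R) (phi : R -> 'cV[R]_2) : 'cV[R]_2 :=
  (F (phi 0 0 0) (phi 0 1 0) + G (phi (- tau0) 0 0) (phi (- tau0) 1 0))
  *: delta_mx 1 0.

Definition Phi (theta : R) : 'M[R]_(2, 3) := mx_of_rows 2 3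
  [:: [:: 1; theta; theta ^+ 2 / 2];
      [:: 0; 1; theta]].

Definition bilin (psi : R -> 'rV[R]_2) (phi : R -> 'cV[R]_2) : R :=
  (psi 0 *m phi 0) 0 0 -
  eta_int (fun theta deta =>
    oint 0 theta (fun zeta => (psi (zeta - theta) *m deta *m phi zeta) 0 0)).

Definition bilin_mx m n (Psi : R -> 'M[R]_(m, 2)) (phi : R -> 'M[R]_(2, n)) :
    'M[R]_(m, n) :=
  \matrix_(i, j) bilin (fun s => row i (Psi s)) (fun s => col j (phi s)).

(* The formal adjoint is psi |-> - psi', on the C^1 functions psi satisfying
   - psi'(0) = int psi(- theta) d eta(theta). *)
Definition adjoint_dom (psi : R -> 'rV[R]_2) :=
  C1_in Iadj psi /\
  - derive_in Iadj psi 0 = eta_int (fun theta deta => psi (- theta) *m deta).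

Definition adjoint_gen_eigenspace0 (psi : R -> 'rV[R]_2) :=
  exists (n : nat) (s : nat -> R -> 'rV[R]_2),
    [/\ {in Iadj, s 0%N =1 psi},
        forall k, (k < n)%N -> adjoint_dom (s k) /\
          {in Iadj, forall x, s k.+1 x = - derive_in Iadj (s k) x}
      & {in Iadj, forall x, s n x = 0}].

Definition adjoint_basis (Psi : R -> 'M[R]_(3, 2)) :=
  [/\ forall i, adjoint_gen_eigenspace0 (fun s => row i (Psi s)),
      forall c : 'rV[R]_3, {in Iadj, forall s, c *m Psi s = 0} -> c = 0,
      forall psi, adjoint_gen_eigenspace0 psi ->
        exists c : 'rV[R]_3, {in Iadj, forall s, psi s = c *m Psi s},
      forall s, Iadj s -> derivable_in Iadj Psi s /\
        derive_in Iadj Psi s = - (Bmx *m Psi s)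
    & bilin_mx Psi Phi = 1%:M].

Section Reduction.
Variable Psi : R -> 'M[R]_(3, 2).

Definition Q1 : set (R -> 'cV[R]_2) :=
  [set v | C1_in Idelay v /\ bilin_mx Psi v = 0].

(* The pair (phi, lambda) stands for the element phi + X_0 lambda of BC. *)
Definition BC : Type := ((R -> 'cV[R]_2) * 'cV[R]_2)%type.

Definition BC_eq (f g : BC) := {in Idelay, f.1 =1 g.1} /\ f.2 = g.2.

Definition X0 (lambda : 'cV[R]_2) : BC := (0, lambda).

Definition proj_P (f : BC) : BC :=
  (fun theta => Phi theta *m (bilin_mx Psi f.1 + Psi 0 *m f.2), 0).

Definition A_Q1 (v : R -> 'cV[R]_2) : BC :=
  (derive_in Idelay v, Lop v - derive_in Idelay v 0).

(* Right-hand sides of du/dt = f.1 u v, dv/dt = f.2 u v, with v in Q1. *)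
Definition system : Type :=
  (('cV[R]_3 -> (R -> 'cV[R]_2) -> 'cV[R]_3) *
   ('cV[R]_3 -> (R -> 'cV[R]_2) -> BC))%type.

Definition decomposed_system (F G : R -> R -> R) : system :=
  (fun u v => Bmx *m u + Psi 0 *m Nop F G (fun theta => Phi theta *m u + v theta),
   fun u v =>
     let N := X0 (Nop F G (fun theta => Phi theta *m u + v theta)) in
     A_Q1 v + (N - proj_P N)).

(* The system in the variables (u^, v^), where (u, v) = (u^, v^) + (U1 u^, U2 u^):
     (I + D U1(u^)) du^/dt = f.1 (u, v),
     dv^/dt = f.2 (u, v) - D U2(u^) du^/dt.
   The matrix I + D U1(u^) is invertible for u^ near 0, which is the only place
   where the resulting system is used. *)
Definition change_variables (U1 : 'cV[R]_3 -> 'cV[R]_3)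
    (U2 : 'cV[R]_3 -> R -> 'cV[R]_2) (f : system) : system :=
  let g1 u v := invmx (1%:M + jacobian_mx U1 u) *m f.1 (u + U1 u) (v + U2 u) in
  (g1,
   fun u v => f.2 (u + U1 u) (v + U2 u) -
     ((fun theta => 'D_(g1 u v) (fun x => U2 x theta) u), 0)).

(* Terms homogeneous of degree j in (u, v) of the Taylor expansion at the origin;
   for BC-valued maps the coefficients are taken at each theta. *)
Definition term1 (f : system) j u v : 'cV[R]_3 :=
  taylor_coef j (fun t : R => f.1 (t *: u) (t *: v)).

Definition term2 (f : system) j u v : BC :=
  (fun theta => taylor_coef j (fun t : R => (f.2 (t *: u) (t *: v)).1 theta),
   taylor_coef j (fun t : R => (f.2 (t *: u) (t *: v)).2)).

Definition in_normal_form (l : nat) (f : system) :=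
  [/\ forall u v, Q1 v -> term1 f 0 u v = 0 /\ BC_eq (term2 f 0 u v) 0,
      forall u v, Q1 v ->
        term1 f 1 u v = Bmx *m u /\ BC_eq (term2 f 1 u v) (A_Q1 v)
    & forall j, (2 <= j <= l)%N ->
        (forall u, BC_eq (term2 f j u 0) 0) /\ W_space j (fun u => term1 f j u 0)].

(* [X] is a center manifold and normal form reduction up to order [l]. The normal
   form depends on the choice of the [U1 j] modulo the kernel of the homological
   operator, whence a relation rather than a function. *)
Definition FM_reduction (F G : R -> R -> R) (l : nat) (X : 'cV[R]_3 -> 'cV[R]_3) :=
  exists (U1 : nat -> 'cV[R]_3 -> 'cV[R]_3) (U2 : nat -> 'cV[R]_3 -> R -> 'cV[R]_2),
    (forall j, (2 <= j <= l)%N ->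
       homogeneous_map setT j (U1 j) /\ homogeneous_map Q1 j (U2 j)) /\
    let f := foldl (fun g j => change_variables (U1 j) (U2 j) g)
                   (decomposed_system F G) (iota 2 l.-1) in
    in_normal_form l f /\
    forall u, X u = Bmx *m u + \sum_(2 <= j < l.+1) term1 f j u 0.

End Reduction.
End DelayEquation.

(* Main.v *)
(** The reduction is run backwards. Fix the reduced field X = (u_2, u_3, w) with
    w = w_2 + ... + w_l and let D be the derivation of R[u_1, u_2, u_3] along X.
    A history invariant under the delay equation and carrying the flow of X has
    the form theta |-> exp (theta D) (k, D k) with k = u_1 + O(2), and the delay
    equation becomes, up to order l + 1, one scalar equation
      Lambda(D) k = F (k, D k) + G (exp (- tau_0 D) k, exp (- tau_0 D) D k),
    where Lambda is the characteristic function, whose expansion at 0 starts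
    with a nonzero multiple of s^3 because 3 beta^2 <> 2 a.
    It is solved for (k, F, G) degree by degree. The linearized equation in
    degree j asks every form of degree j to be a sum of an element of the image
    of D_B^3, a form in (u_1, u_2) and a form in
    (u_1 - tau_0 u_2 + tau_0^2 u_3 / 2, u_2 - tau_0 u_3). Transporting the
    powers (u_1 + y u_2)^j along the nilpotent flow shows that this sum contains
    (u_1 + x u_2 + z u_3)^j for infinitely many z for each x, hence, by
    Vandermonde, all forms.
    Projecting the invariant history to P and Q^1 gives a polynomial map
    u |-> (phi u, h u), which is factored modulo degree l + 1 into near-identity
    maps with homogeneous corrections. Composing these changes of variables
    pulls the system back along (phi, h), so that by invariance the
    Taylor expansion of the reduced field is X. *)

From HB Require Import structures.
Require Import Defs.
From mathcomp Require Import all_boot all_order all_algebra.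
From mathcomp Require Import all_classical all_reals all_analysis.
From mathcomp Require Import ring lra zify.
From mathcomp Require Import -(notations) mpoly.

Set Implicit Arguments.
Unset Strict Implicit.
Unset Printing Implicit Defensive.

Import Order.TTheory GRing.Theory Num.Theory.
Import numFieldNormedType.Exports.

Local Open Scope classical_set_scope.
Local Open Scope ring_scope.

(** * Multivariate polynomials and derivations *)

(** In Lambda the constant and linear coefficients cancel identically and the value of [tau0]
    cancels that of s^2, so Lambda(D) is D^3 times an operator that a finite Neumann series inverts
    wherever D is nilpotent. The full D is nilpotent only up to high order, whence truncated
    exponentials and identities modulo degree l + 1; the reduction up to order l sees nothing beyond
    that. Among the nonlinear terms, only the delayed argument brings in u_3 at leading order, which
    is why G is needed beside F. The state v ranges over an infinite-dimensional space, but all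
    corrections take values in the span of finitely many projected monomial histories, so composing
    the changes of variables is algebra over polynomials in u. A general v matters only for the
    terms of degree 0 and 1; the higher ones are taken at v = 0. Inverse Jacobians make the
    transformed system rational in u, so its Taylor coefficients are read along lines t |-> (t u, t
    v) from germs of rational functions. *)

Section Vandermonde.
Variables (K : fieldType) (V : lmodType K) (S : V -> Prop).
Hypotheses (SD : forall x y, S x -> S y -> S (x + y))
           (SZ : forall c x, S x -> S (c *: x)).

(** Distinct nodes make the Vandermonde matrix invertible, so each [v i] is a combination of n of
    the given sums. This extracts the coefficients of a polynomial family whose members lie in a
    subspace. *)
Lemma vandermonde_closed n (x : nat -> K) (v : nat -> V) :
  injective x -> (forall k, S (\sum_(i < n) x k ^+ i *: v i)) ->
  forall i, (i < n)%N -> S (v i).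
Proof.
move=> x_inj Sx i lt_in.
have S0 : S 0 by rewrite -(scale0r (\sum_(i < n) x 0%N ^+ i *: v i)); exact: SZ.
pose A : 'M[K]_n := Vandermonde n (\row_j x j).
have uA : A \in unitmx.
  rewrite unitmxE det_Vandermonde unitfE prodf_seq_neq0.
  apply/allP => p _ /=; rewrite prodf_seq_neq0; apply/allP => q _ /=.
  apply/implyP => lt_pq; rewrite !mxE subr_eq0; apply/eqP => /x_inj eq_pq.
  by move: lt_pq; rewrite eq_pq ltnn.
suff -> : v i = \sum_k invmx A k (Ordinal lt_in) *: \sum_(j < n) x k ^+ j *: v j.
  by apply: big_ind => [//|x1 x2|k _]; [exact: SD|exact: SZ].
under eq_bigr do rewrite scaler_sumr.
rewrite exchange_big /= -[LHS]scale1r.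
transitivity (\sum_(j < n) (A *m invmx A) j (Ordinal lt_in) *: v j); last first.
  apply: eq_bigr => j _; rewrite mxE scaler_suml; apply: eq_bigr => k _.
  by rewrite scalerA !mxE mulrC.
rewrite mulmxV // (bigD1 (Ordinal lt_in)) //= mxE eqxx big1 ?addr0 // => j.
by rewrite mxE => /negPf->; rewrite scale0r.
Qed.

End Vandermonde.

Section Mpoly.
Variables (n : nat) (R : comNzRingType).
Local Notation P := (mpoly n R).
Local Notation X i := (mpolyX R (mnm1 i)).

(** Constants and variables generate the algebra, so identities between morphisms and derivations
    need checking only there. *)
Lemma mpoly_alg_ind (Q : P -> Prop) :
  (forall c, Q (mpolyC n c)) -> (forall i, Q (X i)) ->
  (forall p q, Q p -> Q q -> Q (p + q)) ->
  (forall p q, Q p -> Q q -> Q (p * q)) -> forall p, Q p.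
Proof.
move=> QC QX QD QM p.
have Q0 : Q 0 by rewrite -(mpolyC0 n R).
have Q1 : Q 1 by rewrite -(mpolyC1 n R).
rewrite (mpolyE p); apply: big_ind => [//|p1 p2|m _]; first exact: QD.
rewrite -mul_mpolyC; apply: (QM) => //; rewrite mpolyXE_id.
apply: big_ind => [//|p1 p2|i _]; first exact: QM.
elim: (m i) => [|k IH]; first by rewrite expr0.
by rewrite exprS; exact: QM.
Qed.

Lemma mderivXU (i j : 'I_n) : mderiv i (X j) = (i == j)%:R.
Proof.
rewrite mderivX mnm1E eq_sym; case: eqP => [->|_]; last by rewrite scale0r.
suff -> : mnm_sub (mnm1 j) (mnm1 j) = mnm0 by rewrite scale1r mpolyX0.
by apply/mnmP => k; rewrite mnmBE mnm0E subnn.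
Qed.

Definition vder (v : 'I_n -> P) (p : P) : P := \sum_i v i * mderiv i p.

Lemma vder_is_linear v : linear (vder v).
Proof.
move=> c p q; rewrite /vder scaler_sumr -big_split; apply: eq_bigr => i _.
by rewrite linearP mulrDr scalerAr.
Qed.
HB.instance Definition _ v :=
  GRing.isLinear.Build R P P _ (vder v) (vder_is_linear v).

Lemma vderM v p q : vder v (p * q) = vder v p * q + p * vder v q.
Proof.
rewrite /vder mulr_suml mulr_sumr -big_split /=; apply: eq_bigr => i _.
by rewrite mderivM; ring.
Qed.

Lemma vderX v i : vder v (X i) = v i.
Proof.
rewrite /vder (bigD1 i) //= mderivXU eqxx mulr1 big1 ?addr0 // => j.
by rewrite mderivXU => /negPf->; rewrite mulr0.
Qed.

Lemma vderB v v' p : vder v p - vder v' p = vder (fun i => v i - v' i) p.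
Proof. by rewrite /vder -sumrB; apply: eq_bigr => i _; rewrite mulrBl. Qed.

Section WeightGe.
Variable mu : Measure.type n.

(* Order at least [N] for the monomial weight [mu]; with [mdeg] this is
   membership in the [N]-th power of the maximal ideal. *)
Definition wge N (p : P) := forall m, m \in msupp p -> (N <= mu m)%N.

Lemma wgeW M N p : (M <= N)%N -> wge N p -> wge M p.
Proof. by move=> le_MN pN m /pN; exact: leq_trans. Qed.
Lemma wge00 p : wge 0 p. Proof. by []. Qed.
Lemma wge0 N : wge N 0. Proof. by move=> m; rewrite msupp0. Qed.
Lemma wgeD N p q : wge N p -> wge N q -> wge N (p + q).
Proof. by move=> pN qN m /msuppD_le; rewrite mem_cat => /orP[/pN|/qN]. Qed.
Lemma wgeZ N c p : wge N p -> wge N (c *: p).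
Proof. by move=> pN m /msuppZ_le/pN. Qed.
Lemma wgeN N p : wge N p -> wge N (- p).
Proof. by move=> pN m; rewrite (perm_mem (msuppN p)) => /pN. Qed.
Lemma wgeB N p q : wge N p -> wge N q -> wge N (p - q).
Proof. by move=> pN qN; apply: wgeD => //; exact: wgeN. Qed.
Lemma wge_sum N (I : Type) (r : seq I) (C : pred I) (F : I -> P) :
  (forall i, C i -> wge N (F i)) -> wge N (\sum_(i <- r | C i) F i).
Proof. by move=> FN; apply: big_ind => //; [exact: wge0|exact: wgeD]. Qed.
Lemma wgeM M N p q : wge M p -> wge N q -> wge (M + N) (p * q).
Proof.
move=> pM qN m /msuppM_le/allpairsP[[m1 m2] /= [/pM h1 /qN h2 ->]].
by rewrite mfD leq_add.
Qed.
Lemma wgeXn N p k : wge N p -> wge (N * k) (p ^+ k).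
Proof.
move=> pN; elim: k => [|k IH]; first by rewrite muln0.
by rewrite exprS mulnS; exact: wgeM.
Qed.
Lemma wgeXU i : wge (mu (mnm1 i)) (X i).
Proof. by move=> m; rewrite msuppX inE => /eqP->. Qed.

(** Differentiation in one variable costs at most the weight of that variable, and the coefficient
    [v i] pays it back with surplus [c]. *)
Lemma wge_vder c v N p :
  (forall i, wge (mu (mnm1 i) + c) (v i)) -> wge N p -> wge (N + c) (vder v p).
Proof.
move=> vc pN; apply: wge_sum => i _.
apply: (@wgeW _ (mu (mnm1 i) + c + (N - mu (mnm1 i)))).
  by rewrite addnAC leq_add2r -leq_subLR.
apply: wgeM => // m; rewrite mcoeff_msupp mcoeff_deriv => nz.
have /pN : mnm_add m (mnm1 i) \in msupp p.
  by rewrite mcoeff_msupp; apply: contraNneq nz => ->; rewrite mul0rn.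
by rewrite mfD leq_subLR addnC.
Qed.

Lemma wge_iter_vder c v N p k :
  (forall i, wge (mu (mnm1 i) + c) (v i)) -> wge N p ->
  wge (N + c * k) (iter k (vder v) p).
Proof.
move=> vc pN; elim: k => [|k IH]; first by rewrite muln0 addn0.
by rewrite mulnS addnCA addnC iterS; exact: wge_vder.
Qed.

Lemma wge_dhomog d N p : p \is @ishomog1 _ _ d mu -> (N <= d)%N -> wge N p.
Proof. by move=> /dhomogP hp le_Nd m /hp->. Qed.

Lemma wgeP N p : wge N p <-> forall m, (mu m < N)%N -> mcoeff m p = 0.
Proof.
split=> [pN m lt_mN|pN m].
  by apply: memN_msupp_eq0; apply/negP => /pN; rewrite leqNgt lt_mN.
by rewrite mcoeff_msupp leqNgt; apply: contraNN => /pN->.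
Qed.

Lemma mcoeff_pihomog d (p : P) m :
  mcoeff m (pihomog mu d p) = if mu m == d then mcoeff m p else 0.
Proof.
elim/mpolyind: p => [|c m' p _ _ IH]; first by rewrite !raddf0 if_same.
rewrite pihomog_is_linear pihomogX !mcoeffD IH !mcoeffZ.
have -> : mcoeff m (if mu m' == d then mpolyX R m' else 0) =
    if mu m == d then mcoeff m (mpolyX R m') else 0.
  rewrite mcoeffX; case: (eqVneq m' m) => [->|m'm]; first by case: ifP; rewrite ?mcoeffX ?eqxx ?mcoeff0.
  by rewrite if_same; case: ifP; rewrite ?mcoeffX ?mcoeff0 // (negPf m'm).
by case: ifP; rewrite ?mulr0 ?addr0.
Qed.

Lemma wge_sub_pihomog d (p : P) : wge d p -> wge d.+1 (p - pihomog mu d p).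
Proof.
move=> pd; apply/wgeP => m; rewrite ltnS leq_eqVlt mcoeffB mcoeff_pihomog.
case: eqP => [_|_ /= lt_md]; first by rewrite subrr.
by move/wgeP: pd => /(_ _ lt_md)->; rewrite subrr.
Qed.

End WeightGe.

Lemma dhomog_vder (v : 'I_n -> P) d p :
  (forall i, v i \is @ishomog1 _ _ 1 mdeg) ->
  p \is @ishomog1 _ _ d mdeg -> vder v p \is @ishomog1 _ _ d mdeg.
Proof.
move=> v1 /dhomogP pd; apply: rpred_sum => i _.
have dd m : m \in msupp (mderiv i p) -> (mdeg m).+1 = d.
  rewrite mcoeff_msupp mcoeff_deriv => nz.
  have /pd : mnm_add m (mnm1 i) \in msupp p.
    by rewrite mcoeff_msupp; apply: contraNneq nz => ->; rewrite mul0rn.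
  by rewrite /= mdegD mdeg1 addn1.
case: d {pd} dd => [|d] dd.
  suff -> : mderiv i p = 0 by rewrite mulr0 rpred0.
  by apply: msuppnil0; case: msupp dd => // m s /(_ m (mem_head _ _)).
by rewrite -add1n; apply: dhomogM => //; apply/dhomogP => m /dd[].
Qed.

End Mpoly.

(** * Substitution and orders of vanishing *)

Section Substitution.
Variables (n k : nat) (R : comNzRingType).
Local Notation ge := (wge mdeg).

Definition msubst (q : 'I_n -> mpoly k R) : mpoly n R -> mpoly k R :=
  mmap (@mpolyC k R) q.
HB.instance Definition _ q := GRing.RMorphism.copy (msubst q) (mmap (@mpolyC k R) q).

Lemma msubstC q c : msubst q (mpolyC n c) = mpolyC k c.
Proof. exact: mmapC. Qed.
Lemma msubstXU q i : msubst q (mpolyX R (mnm1 i)) = q i.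
Proof. by rewrite /msubst mmapX mmap1U. Qed.
Lemma msubst_is_scalable q : scalable (msubst q).
Proof. by move=> c p; rewrite /msubst mmapZ mul_mpolyC. Qed.
HB.instance Definition _ q :=
  GRing.isScalable.Build R (mpoly n R) (mpoly k R) _ (msubst q)
    (msubst_is_scalable q).

Lemma mderiv_msubst q i p :
  mderiv i (msubst q p) = \sum_j msubst q (mderiv j p) * mderiv i (q j).
Proof.
elim/mpoly_alg_ind: p => [c|j|p1 p2 IH1 IH2|p1 p2 IH1 IH2].
- by rewrite msubstC mderivC big1 // => j _; rewrite mderivC raddf0 mul0r.
- rewrite msubstXU (bigD1 j) //= mderivXU eqxx rmorph1 mul1r big1 ?addr0 // => j'.
  by rewrite mderivXU => /negPf->; rewrite rmorph0 mul0r.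
- rewrite rmorphD raddfD /= IH1 IH2 -big_split /=; apply: eq_bigr => j _.
  by rewrite raddfD rmorphD mulrDl.
- rewrite rmorphM mderivM IH1 IH2 mulr_suml mulr_sumr -big_split /=.
  by apply: eq_bigr => j _; rewrite mderivM rmorphD !rmorphM /=; ring.
Qed.

(** A Leibniz estimate: in a monomial of degree at least N + 1, replacing one factor [q i] by [q' i]
    gains order [b], and the N or more remaining factors have order 1 each. *)
Lemma wge_msubst_sub N b q q' p : (0 < b)%N ->
  (forall i, ge 1 (q i)) -> (forall i, ge 1 (q' i)) ->
  (forall i, ge b (q i - q' i)) ->
  ge N.+1 p -> ge (N + b) (msubst q p - msubst q' p).
Proof.
move=> b0 q1 q'1 qq' pN; rewrite /msubst /mmap -sumrB big_seq.
apply: wge_sum => m /pN /= lt_Nm.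
rewrite -mulrBr mul_mpolyC; apply: wgeZ.
suff key d m' : mdeg m' = d.+1 -> ge (d + b) (mmap1 q m' - mmap1 q' m').
  apply: (wgeW _ (key (mdeg m).-1 m _)); last by rewrite prednK // (leq_trans _ lt_Nm).
  by rewrite leq_add2r -ltnS prednK // (leq_trans _ lt_Nm).
have mmap1M (h : 'I_n -> mpoly k R) m1 m2 : mmap1 h (mnm_add m1 m2) = mmap1 h m1 * mmap1 h m2.
  by apply: commr_mmap1_M => *; exact: mulrC.
have ge_mmap1 (h : 'I_n -> mpoly k R) m1 : (forall i, ge 1 (h i)) -> ge (mdeg m1) (mmap1 h m1).
  move=> h1; rewrite mdegE /mmap1; elim/big_rec2: _ => // i e p' _ p'd.
  by apply: wgeM => //; have := @wgeXn _ _ _ _ _ (m1 i) (h1 i); rewrite mul1n.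
elim: d m' => [|d IH] m' m'd.
  have /mdeg1P[i /eqP->] : mdeg m' == 1%N by rewrite m'd.
  by rewrite !mmap1U add0n.
have [i mi] : exists i, m' i != 0%N.
  apply/existsP; apply: contra_eqT m'd => /existsPn m0.
  by rewrite mdegE big1 // => i _; apply/eqP; rewrite -[_ == _]negbK; exact: m0.
have m'E : m' = mnm_add (mnm1 i) (mnm_sub m' (mnm1 i)).
  by rewrite addmC submK // lep1mP.
have dE : mdeg (mnm_sub m' (mnm1 i)) = d.+1.
  by move: m'd; rewrite {1}m'E mdegD mdeg1 => -[].
rewrite m'E !mmap1M !mmap1U.
set A := mmap1 q _; set B := mmap1 q' _.
have -> : q i * A - q' i * B = (q i - q' i) * A + q' i * (A - B) by ring.
apply: wgeD.
  by rewrite addnC; apply: wgeM => //; rewrite -dE; exact: ge_mmap1.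
by rewrite -add1n -addnA; apply: wgeM => //; exact: IH.
Qed.

End Substitution.

Lemma meval_msubst n k (R : comNzRingType) v (q : 'I_n -> mpoly k R) p :
  meval v (msubst q p) = meval (fun i => meval v (q i)) p.
Proof.
elim/mpoly_alg_ind: p => [c|j|p1 p2 IH1 IH2|p1 p2 IH1 IH2].
- by rewrite msubstC !mevalC.
- by rewrite msubstXU mevalXU.
- by rewrite !rmorphD /= IH1 IH2.
- by rewrite !rmorphM /= IH1 IH2.
Qed.

(** * The characteristic operator on nilpotent derivations *)

Section CharacteristicOperator.
Variables (n : nat) (K : numFieldType) (N : nat).
Local Notation P := (mpoly n K).
Variable D : {linear P -> P}.

(* [exp (t D)], truncated after [N] terms. *)
Definition expop (t : K) (h : P) : P :=
  \sum_(i < N) (t ^+ i / i`!%:R) *: iter i D h.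

Lemma iter_linear k c h h' :
  iter k D (c *: h + h') = c *: iter k D h + iter k D h'.
Proof. by elim: k => //= k ->; rewrite linearP. Qed.

Lemma expop_linear t : linear (expop t).
Proof.
move=> c h h'; rewrite /expop scaler_sumr -big_split /=; apply: eq_bigr => i _.
by rewrite iter_linear scalerDr !scalerA mulrC.
Qed.
HB.instance Definition _ t :=
  GRing.isLinear.Build K P P _ (expop t) (expop_linear t).

Variables a beta tau : K.

(* The characteristic function of the scalar delay equation evaluated at [D]. *)
Definition charop (h : P) : P :=
  D (D h) + a *: (h - expop (- tau) h) - (a * tau) *: D h
  + beta *: (D h - expop (- tau) (D h)).

Lemma charop_linear : linear charop.
Proof.
move=> c h h'; rewrite /charop !linearP /=.
by rewrite -!mul_mpolyC; ring.
Qed.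
HB.instance Definition _ :=
  GRing.isLinear.Build K P P _ charop charop_linear.

Hypothesis N_ge4 : (4 <= N)%N.
Hypothesis tau_root : a * tau ^+ 2 = 2 * beta * tau + 2.
Hypothesis nondeg : tau ^+ 2 * (a * tau - 3 * beta) != 0.

(** By [charopE] the operator is D^3 (delta + D M) with M a polynomial in D; delta + D M is inverted
    by a Neumann series, run as an induction on the nilpotency index of [g]. The stable subspace [H]
    allows the use on forms of a fixed degree. *)
Lemma charop_solve (H : P -> Prop) :
  (forall x y, H x -> H y -> H (x + y)) -> (forall c x, H x -> H (c *: x)) ->
  (forall x, H x -> H (D x)) -> (forall x, H x -> iter N D x = 0) ->
  forall g, H g -> exists2 h, H h & charop h = D (D (D g)).
Proof.
move=> HD HZ HDer Hnil.
pose e (i : nat) : K := (- tau) ^+ i / i`!%:R.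
have [N' NE] : exists N', N = N'.+4 by exists (N - 4)%N; rewrite -addn4 subnK.
pose E4 h := \sum_(i < N') e (i + 4)%N *: iter i D h.
have expopE h : expop (- tau) h =
    h - tau *: D h + e 2%N *: D (D h) + e 3%N *: D (D (D h)) + D (D (D (D (E4 h)))).
  rewrite /expop NE !big_ord_recl /=.
  rewrite expr0 divr1 scale1r expr1 divr1 scaleNr -!addrA.
  do 4 congr (_ + _); rewrite /E4 !raddf_sum; apply: eq_bigr => i _ /=.
  by rewrite !linearZ /= /bump /= !add1n addn4.
pose M h := - a *: E4 h - beta *: (e 3%N *: h + E4 (D h)).
(* This is the coefficient a tau^3 / 6 - beta tau^2 / 2 of s^3 in the characteristic function. *)
pose delta := tau ^+ 2 * (a * tau - 3 * beta) / 6%:R.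
have delta0 : delta != 0 by rewrite mulf_neq0 // invr_eq0 pnatr_eq0.
have e2 : e 2%N = tau ^+ 2 / 2%:R by rewrite /e sqrrN.
have e3 : e 3%N = - tau ^+ 3 / 6%:R by rewrite /e exprNn -signr_odd expr1 mulN1r.
have charopE h : charop h = delta *: D (D (D h)) + D (D (D (D (M h)))).
  have MD : D (D (D (D (M h)))) = - a *: D (D (D (D (E4 h))))
      - beta *: (e 3%N *: D (D (D (D h))) + D (D (D (D (E4 (D h)))))).
    by rewrite /M !(linearB, linearD, linearZ) /= !(linearB, linearD, linearZ).
  rewrite /charop !expopE MD.
  transitivity (delta *: D (D (D h)) + (- a *: D (D (D (D (E4 h))))
      - beta *: (e 3%N *: D (D (D (D h))) + D (D (D (D (E4 (D h)))))))
      + (1 - a * e 2%N + beta * tau) *: D (D h)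
      + (- a * e 3%N - beta * e 2%N - delta) *: D (D (D h))).
    by rewrite -!mul_mpolyC; ring.
  have -> : 1 - a * e 2%N + beta * tau = 0.
    rewrite e2 (_ : 1 - a * (tau ^+ 2 / 2%:R) + beta * tau =
      - (a * tau ^+ 2 - (2 * beta * tau + 2)) / 2%:R); last by field.
    by rewrite tau_root subrr oppr0 mul0r.
  have -> : - a * e 3%N - beta * e 2%N - delta = 0 by rewrite e2 e3 /delta; field.
  by rewrite !scale0r !addr0.
have HE4 h : H h -> H (E4 h).
  move=> Hh; rewrite /E4.
  have H0 : H 0 by rewrite -(scale0r h); exact: HZ.
  apply: big_ind => [//|x y|i _]; first exact: HD.
  by apply: (HZ); elim: (nat_of_ord i) => //= j; exact: HDer.
have HM h : H h -> H (D (M h)).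
  move=> Hh; apply: (HDer); apply: (HD); first by apply: (HZ); exact: HE4.
  rewrite -scaleNr; apply: (HZ); apply: (HD); first exact: HZ.
  by apply: HE4; exact: HDer.
suff key k g : H g -> iter k D g = 0 -> exists2 h, H h & charop h = D (D (D g)).
  by move=> g Hg; apply: (key N g Hg); exact: Hnil.
elim: k g => [|k IH] g Hg Dg.
  by exists 0; rewrite ?linear0; [rewrite -(scale0r g); exact: HZ|rewrite -[g]/(iter 0 D g) Dg !linear0].
(* Up to a factor, the trial solution delta^-1 g leaves the error D^3 (D (M g)); since M commutes
   with D, the element [D (M g)] is killed one step earlier than [g]. *)
have [||h Hh hE] := IH (D (M g)); first exact: HM.
  have E4D x : E4 (D x) = D (E4 x).
    by rewrite /E4 linear_sum; apply: eq_bigr => i _; rewrite linearZ /= -iterSr.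
  have MDD x : M (D x) = D (M x).
    by rewrite /M !(linearB, linearD, linearZ) /= !(linearB, linearD, linearZ) /= !E4D.
  have E40 : E4 0 = 0.
    rewrite /E4 big1 // => i _; apply/eqP; rewrite scaler_eq0; apply/orP; right.
    by apply/eqP; elim: (nat_of_ord i) => //= j ->; rewrite linear0.
  have M0 : M 0 = 0 by rewrite /M linear0 E40 !(scaler0, addr0, subr0).
  rewrite -iterSr; suff -> j : iter j D (M g) = M (iter j D g) by rewrite Dg.
  by elim: j => //= j ->; rewrite MDD.
exists (delta^-1 *: (g - h)); first by apply: (HZ); apply: (HD) => //; rewrite -scaleN1r; exact: HZ.
rewrite linearZ linearB /= charopE hE addrK scalerA mulVf // scale1r //.
Qed.

End CharacteristicOperator.

(** * Powers along the nilpotent flow *)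

Section PolynomialFlow.
Variables (n : nat) (K : numFieldType) (D : {linear mpoly n K -> mpoly n K}).
Local Notation P := (mpoly n K).
Hypothesis DM : forall p q, D (p * q) = D p * q + p * D q.

(* [q] is the series [exp ('X D) q`_0] of a transported element. *)
Definition flowing (q : {poly P}) := forall i, D q`_i = q`_i.+1 *+ i.+1.

(** On a flowing series, D acts as d/dt does. Both are derivations, so the property is
    multiplicative, as exp (t D) is. *)
Lemma flowingM p q : flowing p -> flowing q -> flowing (p * q).
Proof.
move=> pf qf i; rewrite -coef_deriv derivM coefD !coefM linear_sum /= -big_split /=.
by apply: eq_bigr => k _; rewrite DM pf qf !coef_deriv.
Qed.

Lemma flowing1 : flowing 1.
Proof.
have D1 : D 1 = 0.
  by apply: (addrI (D 1)); rewrite addr0 -{3}[1]mulr1 DM mulr1 mul1r.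
by move=> [|i]; rewrite !coef1 /= ?D1 ?linear0 mul0rn.
Qed.

Lemma flowingX q k : flowing q -> flowing (q ^+ k).
Proof.
move=> qf; elim: k => [|k IH]; first by rewrite expr0; exact: flowing1.
by rewrite exprS; exact: flowingM.
Qed.

(** The Taylor tail from order three on is D^3 of an element of [H]; it will be absorbed by the
    image of D_B^3. *)
Lemma flowing_taylor2 (H : P -> Prop) (q : {poly P}) (t : K) :
  (forall x y, H x -> H y -> H (x + y)) -> (forall c x, H x -> H (c *: x)) ->
  (forall x, H x -> H (D x)) -> H q`_0 -> flowing q ->
  exists2 h, H h & q.[mpolyC n t] =
    q`_0 + t *: D q`_0 + (t ^+ 2 / 2) *: D (D q`_0) + D (D (D h)).
Proof.
move=> HD HZ HDer Hq0 qf.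
have coefS i : q`_i.+1 = (i.+1%:R)^-1 *: D q`_i.
  by rewrite qf -(scaler_nat i.+1 q`_i.+1) scalerA mulVf ?scale1r // pnatr_eq0.
have Hq i : H q`_i.
  by elim: i => // i IH; rewrite coefS; apply: (HZ); exact: HDer.
(* D^3 multiplies the coefficient of index i + 3 by (i + 1)(i + 2)(i + 3) when applied to that of
   index i; these weights divide this product out. *)
pose c i : K := t ^+ i.+3 * ((i.+3)%:R^-1 * (i.+2)%:R^-1 * (i.+1)%:R^-1).
exists (\sum_(i < size q) c i *: q`_i).
  have H0 : H 0 by rewrite -(scale0r q`_0); exact: HZ.
  by apply: big_ind => [//|x y|i _]; [exact: HD|exact: HZ].
rewrite (@horner_coef_wide _ (size q).+3); last by rewrite -addn3 leq_addr.
rewrite !big_ord_recl /= expr0 mulr1 -!addrA; congr (_ + _).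
rewrite -!rmorphXn /= -!(mulrC (mpolyC n _)) !mul_mpolyC expr1.
rewrite /bump /= !add1n; congr (_ + _); first by rewrite coefS invr1 scale1r.
congr (_ + _).
  by rewrite !coefS invr1 scale1r scalerA.
rewrite !linear_sum; apply: eq_bigr => i _ /=.
rewrite -rmorphXn /= mulrC mul_mpolyC !coefS !linearZ /= !scalerA /c.
by rewrite mulrC.
Qed.

End PolynomialFlow.

(** * Spanning the forms by powers of linear forms *)

Section NilpotentField.
Variable K : realFieldType.
Local Notation P := (mpoly 3 K).
Local Notation X i := (mpolyX K (mnm1 (i : 'I_3))).
Local Notation homog j p := (p \is @ishomog1 _ _ j mdeg).

Definition vfield (w : P) (i : 'I_3) : P := [:: X 1; X 2%:R; w]`_i.

Local Notation D := (vder (vfield 0)).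

Lemma homog_X (i : 'I_3) : homog 1 (X i).
Proof. by rewrite dhomogX /= mdeg1. Qed.

Lemma homog_vfield0 i : homog 1 (vfield 0 i).
Proof.
by case: i => [[|[|[|]]] //= lt_i3]; rewrite /vfield /= ?homog_X ?rpred0.
Qed.

Lemma homog_D j p : homog j p -> homog j (D p).
Proof. by apply: dhomog_vder => i; exact: homog_vfield0. Qed.

Lemma vderX0 w : vder (vfield w) (X 0) = X 1. Proof. by rewrite vderX. Qed.
Lemma vderX1 w : vder (vfield w) (X 1) = X 2%:R. Proof. by rewrite vderX. Qed.
Lemma vderX2 w : vder (vfield w) (X 2%:R) = w. Proof. by rewrite vderX. Qed.

Lemma homog_lin j y z : homog j ((X 0 + y *: X 1 + z *: X 2%:R) ^+ j).
Proof.
have := @dhomogMn _ _ mdeg 1 (X 0 + y *: X 1 + z *: X 2%:R) j.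
by rewrite mul1n; apply; rewrite !rpredD ?rpredZ ?homog_X.
Qed.

(** The flow of u' = B u for time t sends u_1 + y u_2 to u_1 + (y + t) u_2 + (t y + t^2 / 2) u_3,
    and it commutes with powers. *)
Lemma flow_power j (y t : K) : exists2 h, homog j h &
  let g := (X 0 + y *: X 1) ^+ j in
  (X 0 + (y + t) *: X 1 + (t * y + t ^+ 2 / 2) *: X 2%:R) ^+ j =
  g + t *: D g + (t ^+ 2 / 2) *: D (D g) + D (D (D h)).
Proof.
pose q : {poly P} := \poly_(i < 3)
  [:: X 0 + y *: X 1; X 1 + y *: X 2%:R; 2^-1 *: X 2%:R]`_i.
have qf : flowing D q.
  move=> [|[|[|i]]]; rewrite !coef_poly /= ?linear0 ?mul0rn //.
  - by rewrite mulr1n linearD linearZ /= vderX0 vderX1.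
  - by rewrite linearD linearZ /= vderX1 vderX2 scaler0 addr0 -scaler_nat scalerA divff ?scale1r ?pnatr_eq0.
  - by rewrite linearZ /= vderX2 scaler0.
have DM p p' : D (p * p') = D p * p' + p * D p' by exact: vderM.
have q0 : (q ^+ j)`_0 = (X 0 + y *: X 1) ^+ j.
  by rewrite -!horner_coef0 horner_exp horner_coef0 coef_poly.
have q0h : homog j (q ^+ j)`_0.
  by rewrite q0; have := homog_lin j y 0; rewrite scale0r addr0.
have [h hh hE] := @flowing_taylor2 _ _ _ (fun p => homog j p) (q ^+ j) t
  (fun x y => @rpredD _ _ x y) (fun c x => @rpredZ _ _ _ c x)
  (@homog_D j) q0h (flowingX DM j qf).
exists h; first exact: hh.
cbv zeta; rewrite -q0 -hE horner_exp; congr (_ ^+ _).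
rewrite horner_poly !big_ord_recl big_ord0 /= expr0 mulr1 /bump /= !add1n addr0.
by rewrite -!mul_mpolyC expr1; ring.
Qed.

(** Modulo the image of D^3 the orbit of g = (u_1 - y u_2)^j is g + s D g + (s^2 / 2) D^2 g. Two
    nonzero times at which it meets S give D g and D^2 g, hence the whole orbit, and orbits for
    varying y supply enough linear forms. *)
Lemma power_span (S : P -> Prop) (tau : K) j :
  tau != 0 ->
  (forall x y, S x -> S y -> S (x + y)) -> (forall c x, S x -> S (c *: x)) ->
  (forall h, homog j h -> S (D (D (D h)))) ->
  (forall y, S ((X 0 + y *: X 1) ^+ j)) ->
  (forall y, S ((X 0 + (y - tau) *: X 1 + (tau ^+ 2 / 2 - tau * y) *: X 2%:R) ^+ j)) ->
  forall p, homog j p -> S p.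
Proof.
move=> tau0 SD SZ S3 SF SG p pj.
have SB x y : S x -> S y -> S (x - y).
  by move=> Sx Sy; apply: (SD) => //; rewrite -scaleN1r; exact: SZ.
have SK c x : c != 0 -> S (c *: x) -> S x.
  by move=> c0 /(SZ c^-1); rewrite scalerA mulVf // scale1r.
have SDK x y : S (x + y) -> S y -> S x.
  by move=> Sxy Sy; rewrite -(addrK y x); exact: SB.
have S_quad y t : y != 0 -> 2 * y + tau != 0 ->
    S ((X 0 + (t - y) *: X 1 + (t ^+ 2 / 2 - t * y) *: X 2%:R) ^+ j).
  move=> y0 yt0.
  have flow s := flow_power j (- y) s.
  set g := (X 0 + - y *: X 1) ^+ j in flow.
  have Sflow s : S ((X 0 + (- y + s) *: X 1 + (s * - y + s ^+ 2 / 2) *: X 2%:R) ^+ j) ->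
      s != 0 -> S (D g + (s / 2) *: D (D g)).
    have [h hh ->] := flow s => Ss s0; apply: (SK s) => //.
    rewrite scalerDr scalerA mulrA -expr2.
    apply: (SDK _ g); last exact: SF.
    by rewrite addrC addrA; apply: (SDK _ _ Ss); exact: S3.
  (* At time 2 y the u_3 coefficient is zero again and the orbit reaches (u_1 + y u_2)^j; at time -
     tau it reaches a delayed form. The two combinations have distinct slopes y and - tau / 2. *)
  have S1 : S (D g + (2 * y / 2) *: D (D g)).
    apply: Sflow; last by rewrite mulf_neq0 ?pnatr_eq0.
    have -> : - y + 2 * y = y by ring.
    have -> : 2 * y * - y + (2 * y) ^+ 2 / 2 = 0 by field.
    by rewrite scale0r addr0; exact: SF.
  have S2 : S (D g + (- tau / 2) *: D (D g)).
    apply: Sflow; last by rewrite oppr_eq0.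
    have -> : - tau * - y + (- tau) ^+ 2 / 2 = tau ^+ 2 / 2 - tau * - y by field.
    exact: SG.
  have SDD : S (D (D g)).
    apply: (SK ((2 * y + tau) / 2)); first by rewrite mulf_neq0 ?invr_eq0 ?pnatr_eq0.
    have -> : ((2 * y + tau) / 2) *: D (D g) =
        (D g + (2 * y / 2) *: D (D g)) - (D g + (- tau / 2) *: D (D g)).
      by rewrite opprD addrACA subrr add0r -scalerBl; congr (_ *: _); field.
    exact: SB.
  have SDg : S (D g) by apply: (SDK _ _ S2); exact: SZ.
  have [h hh hE] := flow t.
  have -> : t - y = - y + t by rewrite addrC.
  have -> : t ^+ 2 / 2 - t * y = t * - y + t ^+ 2 / 2 by ring.
  rewrite hE; apply: (SD); last exact: S3.
  by apply: (SD); [apply: (SD); [exact: SF|exact: SZ]|exact: SZ].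
have S_lin r x : (r <= j)%N -> S ((X 2%:R) ^+ r * (X 0 + x *: X 1) ^+ (j - r) *+ 'C(j, r)).
  move=> le_rj.
  (* For t = x + y the transported form has u_2 coefficient x and u_3 coefficient (x^2 - y^2) / 2.
     Taking every y above |tau| keeps y and 2 y + tau positive and makes these values distinct. *)
  pose c := `|tau| + 1; pose y k := c + k%:R.
  have c0 : 0 < c by rewrite ltr_wpDl.
  have y_gt k : `|tau| < y k by rewrite /y /c -addrA ltrDl ltr_wpDr.
  pose xi k := (x ^+ 2 - y k ^+ 2) / 2.
  have xi_inj : injective xi.
    move=> k k' /(congr1 ( *%R^~ 2)); rewrite !divfK ?pnatr_eq0 // => /addrI /oppr_inj /eqP.
    rewrite eqrXn2 // ?(le_trans _ (ltW (y_gt _))) //.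
    by move=> /eqP /addrI /eqP; rewrite eqr_nat => /eqP.
  pose v (i : nat) : P := X 2%:R ^+ i * (X 0 + x *: X 1) ^+ (j - i) *+ 'C(j, i).
  apply: (@vandermonde_closed _ _ S SD SZ j.+1 xi v xi_inj) => // k.
  have -> : \sum_(i < j.+1) xi k ^+ i *: v i = (X 0 + x *: X 1 + xi k *: X 2%:R) ^+ j.
    rewrite exprDn; apply: eq_bigr => i _; rewrite /v -scalerMnr; congr (_ *+ _).
    by rewrite [RHS]mulrC [in RHS]exprZn -scalerAl.
  have yk0 : 0 < y k by exact: le_lt_trans (y_gt k).
  have := @S_quad (y k) (x + y k).
  have -> : x + y k - y k = x by rewrite addrK.
  have -> : (x + y k) ^+ 2 / 2 - (x + y k) * y k = xi k by rewrite /xi; field.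
  apply; first by rewrite gt_eqF.
  have le_tau : - tau <= `|tau| by rewrite -normrN ler_norm.
  by rewrite gt_eqF //; move: (y_gt k) yk0 le_tau; lra.
(* A second Vandermonde argument, in x = 0, 1, 2, ..., separates the powers of u_1 and u_2. *)
have S_mon r i : (r + i <= j)%N -> S (X 2%:R ^+ r * X 1 ^+ i * X 0 ^+ (j - r - i)).
  move=> le_rij.
  have le_rj : (r <= j)%N by rewrite (leq_trans _ le_rij) ?leq_addr.
  have le_ijr : (i < (j - r).+1)%N by rewrite ltnS leq_subRL.
  pose v (i : nat) : P := X 2%:R ^+ r * (X 1 ^+ i * X 0 ^+ (j - r - i)) *+ 'C(j - r, i).
  have : S (v i).
    apply: (@vandermonde_closed _ _ S SD SZ (j - r).+1 (fun k => k%:R) v) => //.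
      by move=> k k' /eqP; rewrite eqr_nat => /eqP.
    move=> k; have := S_lin r k%:R le_rj.
    rewrite -scaler_nat => /SK; rewrite pnatr_eq0 -lt0n bin_gt0 => /(_ le_rj).
    rewrite exprDn mulr_sumr; congr S; apply: eq_bigr => m _.
    rewrite /v mulrnAr -scalerMnr; congr (_ *+ _).
    by rewrite exprZn -!scalerAr (mulrC (X 1 ^+ _)).
  rewrite /v -scaler_nat => /SK; rewrite pnatr_eq0 -lt0n bin_gt0 -ltnS => /(_ le_ijr).
  by rewrite mulrA.
rewrite (mpolyE p) big_seq.
have S0 : S 0 by rewrite -(scale0r (D (D (D 0)))); apply: (SZ); apply: S3; rewrite rpred0.
apply: big_ind => [//|x y|m mp]; first exact: SD.
apply: (SZ); move/dhomogP: pj => /(_ m mp) /= mj.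
rewrite mpolyXE_id !big_ord_recl big_ord0 mulr1.
move: mj; rewrite mdegE !big_ord_recl big_ord0 addn0 => mj.
have := @S_mon (m 2%:R) (m 1).
rewrite mulrC (mulrC (X 2%:R ^+ _)) -subnDA.
have e1 : lift ord0 ord0 = 1 :> 'I_3 by apply: val_inj.
have e2 : lift ord0 (lift ord0 ord0) = 2%:R :> 'I_3 by apply: val_inj.
have e0 : ord0 = 0 :> 'I_3 by apply: val_inj.
rewrite e1 e2 e0 in mj *.
have -> : (j - (m 2%:R%R + m 1%R) = m 0%R)%N by rewrite -mj (addnC (m 1%R)) addnK.
by apply; rewrite -mj addnC [(m 1%R + _)%N]addnC leq_addl.
Qed.

End NilpotentField.

(** * The formal center manifold equation *)

(* The weights 3, 4, 5 of the variables make every field [(u_2, u_3, w)] with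
   [w] of order 2 weight-increasing, hence nilpotent modulo high order. *)
Definition mnmwgt345 (m : multinom 3) : nat := (2 * mdeg m + mnmwgt m)%N.

Lemma mnmwgt345_0 : mnmwgt345 (@mnm0 3) = 0%N.
Proof. by rewrite /mnmwgt345 mdeg0 mnmwgt0. Qed.
Lemma mnmwgt345_D : {morph mnmwgt345 : m1 m2 / mnm_add m1 m2 >-> (m1 + m2)%N}.
Proof. by move=> m1 m2; rewrite /mnmwgt345 mdegD mnmwgtD mulnDr addnACA. Qed.
HB.instance Definition _ :=
  isMeasure.Build 3 mnmwgt345 mnmwgt345_0 mnmwgt345_D.

Lemma leq_mnmwgt345 m : (3 * mdeg m <= mnmwgt345 m <= 5 * mdeg m)%N.
Proof.
rewrite /mnmwgt345 (_ : 3 * _ = 2 * mdeg m + mdeg m)%N; last by lia.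
rewrite (_ : 5 * _ = 2 * mdeg m + 3 * mdeg m)%N; last by lia.
rewrite !leq_add2l /mnmwgt mdegE big_distrr /=.
by apply/andP; split; apply: leq_sum => i _; have := ltn_ord i; nia.
Qed.

Section FormalSolution.
Variable K : realFieldType.
Local Notation P := (mpoly 3 K).
Local Notation X i := (mpolyX K (mnm1 (i : 'I_3))).
Local Notation homog j p := (p \is @ishomog1 _ _ j mdeg).
Local Notation ge := (wge mdeg).

Definition pair2 n (p q : mpoly n K) (i : 'I_2) : mpoly n K := [:: p; q]`_i.

Section Field.
Variable w : P.
Hypothesis w2 : ge 2 w.
Local Notation Dw := (vder (vfield w)).
Local Notation D0 := (vder (vfield 0)).

Lemma wge_vfield345 i : wge mnmwgt345 (mnmwgt345 (mnm1 i) + 1) (vfield w i).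
Proof.
rewrite /mnmwgt345 mdeg1 mnmwgt1.
case: i => [[|[|[|]]] //= lt_i3] m; rewrite /vfield /=.
- by rewrite msuppX inE => /eqP ->; rewrite /mnmwgt345 mdeg1 mnmwgt1.
- by rewrite msuppX inE => /eqP ->; rewrite /mnmwgt345 mdeg1 mnmwgt1.
- by move=> /w2 /=; have /andP[] := leq_mnmwgt345 m; lia.
Qed.

Lemma wge_vfield i : ge (mdeg (mnm1 i) + 0) (vfield w i).
Proof.
rewrite addn0 mdeg1.
case: i => [[|[|[|]]] //= lt_i3]; rewrite /vfield /=.
- by have := @wgeXU 3 K mdeg 1; rewrite /= mdeg1.
- by have := @wgeXU 3 K mdeg 2%:R; rewrite /= mdeg1.
- exact: wgeW w2.
Qed.

Lemma wge_vder_vfield N p : ge N p -> ge N (Dw p).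
Proof. by move=> pN; rewrite -[N]addn0; exact: wge_vder wge_vfield _. Qed.

Lemma wge_iter_vfield N p i : ge N p -> ge N (iter i Dw p).
Proof. by move=> pN; elim: i => //= i; exact: wge_vder_vfield. Qed.

(** Each application raises the weight by one, while monomials of degree at most l have weight at
    most 5 l. This fixes the truncation order 5 l + 1 of the exponentials. *)
Lemma nilpotent_vfield l p : ge l.+1 (iter (5 * l).+1 Dw p).
Proof.
move=> m; have := @wge_iter_vder _ _ _ 1 (vfield w) 0 p (5 * l).+1 wge_vfield345 (@wge00 _ _ _ p).
by move=> /[apply] /=; have /andP[] := leq_mnmwgt345 m; lia.
Qed.

(** The two fields differ by (0, 0, w), and [w] has order 2, so their difference raises the degree:
    to leading order D acts as D_B. *)
Lemma wge_vder_sub M x y : ge M x -> ge M.+1 (x - y) ->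
  ge M.+1 (D0 (x - y)) -> ge M.+1 (Dw x - D0 y).
Proof.
move=> xM xyM DxyM; have -> : Dw x - D0 y = D0 (x - y) + (Dw x - D0 x).
  by rewrite linearB /=; ring.
apply: wgeD => //; rewrite vderB -(addn1 M); apply: wge_vder => // i.
case: i => [[|[|[|]]] //= lt_i3]; rewrite /vfield /= ?subrr ?subr0; try exact: wge0.
by rewrite mdeg1.
Qed.

End Field.

Lemma wge02 : ge 2 (0 : P). Proof. exact: wge0. Qed.

Section Field2.
Variable w : P.
Hypothesis w2 : ge 2 w.
Local Notation Dw := (vder (vfield w)).
Local Notation D0 := (vder (vfield 0)).

Lemma wge_iter_sub i M x y : ge M x -> ge M.+1 (x - y) ->
  ge M.+1 (iter i Dw x - iter i D0 y).
Proof.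
move=> xM xyM; elim: i => //= i IH; apply: wge_vder_sub => //.
  exact: wge_iter_vfield.
exact: (wge_vder_vfield wge02).
Qed.

Lemma wge_expop N t M x : ge M x -> ge M (expop N Dw t x).
Proof. by move=> xM; apply: wge_sum => i _; apply: wgeZ; exact: wge_iter_vfield. Qed.

Lemma wge_expop_sub N t M x y : ge M x -> ge M.+1 (x - y) ->
  ge M.+1 (expop N Dw t x - expop N D0 t y).
Proof.
move=> xM xyM; rewrite /expop -sumrB; apply: wge_sum => i _.
by rewrite -scalerBr; apply: wgeZ; exact: wge_iter_sub.
Qed.

Lemma wge_charop_sub N a beta tau M x : ge M x ->
  ge M.+1 (charop N Dw a beta tau x - charop N D0 a beta tau x).
Proof.
move=> xM.
have xx : ge M.+1 (x - x) by rewrite subrr; exact: wge0.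
have d1 : ge M.+1 (Dw x - D0 x) by exact: (@wge_iter_sub 1).
have d2 : ge M.+1 (Dw (Dw x) - D0 (D0 x)) by exact: (@wge_iter_sub 2).
have e1 := @wge_expop_sub N (- tau) _ _ _ xM xx.
have e2 := @wge_expop_sub N (- tau) _ _ _ (wge_vder_vfield w2 xM) d1.
have -> : charop N Dw a beta tau x - charop N D0 a beta tau x =
  (Dw (Dw x) - D0 (D0 x))
  + (- a) *: (expop N Dw (- tau) x - expop N D0 (- tau) x)
  + (beta - a * tau) *: (Dw x - D0 x)
  + (- beta) *: (expop N Dw (- tau) (Dw x) - expop N D0 (- tau) (D0 x)).
  by rewrite /charop -!mul_mpolyC; ring.
by do ![apply: wgeD => //; try exact: wgeZ].
Qed.

End Field2.

Variables (a beta tau : K) (l : nat).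
Hypothesis tau_root : a * tau ^+ 2 = 2 * beta * tau + 2.
Hypothesis nondeg : tau ^+ 2 * (a * tau - 3 * beta) != 0.
Hypothesis l_gt0 : (0 < l)%N.
Local Notation N := (5 * l).+1.
Local Notation D0 := (vder (vfield 0)).

Let tau_neq0 : tau != 0.
Proof. by apply: contraNneq nondeg => ->; rewrite expr0n mul0r. Qed.

Lemma D0X i : [/\ D0 (X 0) = X 1, D0 (X 1) = X 2%:R & D0 (X 2%:R) = 0] /\
  iter i.+3 D0 (X 0) = 0.
Proof.
split; first by rewrite vderX0 vderX1 vderX2.
elim: i => [|i IH]; first by rewrite /= vderX0 vderX1 vderX2.
by rewrite iterS IH linear0.
Qed.

Lemma expop_X0 t : expop N D0 t (X 0) = X 0 + t *: X 1 + (t ^+ 2 / 2) *: X 2%:R.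
Proof.
have [N' ->] : exists N', N = N'.+3 by exists (5 * l - 2)%N; lia.
rewrite /expop !big_ord_recl /= !vderX0 vderX1 big1 => [|i _]; last first.
  by have [_] := D0X i => /= ->; rewrite scaler0.
by rewrite expr0 divr1 scale1r expr1 divr1 addr0 addrA.
Qed.

Lemma expop_X1 t : expop N D0 t (X 1) = X 1 + t *: X 2%:R.
Proof.
have [N' ->] : exists N', N = N'.+2 by exists (5 * l - 1)%N; lia.
rewrite /expop !big_ord_recl /= !vderX1 big1 => [|i _]; last first.
  have [_] := D0X i; rewrite iterSr vderX0 => /= ->.
  by rewrite scaler0.
by rewrite expr0 divr1 scale1r expr1 divr1 addr0.
Qed.

(** [power_span] leaves three families to solve for: D_B^3 g is reached through [h] by
    [charop_solve], and the two kinds of powers by the powers (x + c y)^j in F or in G. *)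
Lemma homological_solve j r : (j <= l)%N -> homog j r ->
  exists (h : P) (F G : mpoly 2 K),
    [/\ homog j h, homog j F, homog j G &
     r = charop N D0 a beta tau h + msubst (pair2 (X 0) (X 1)) F
       + msubst (pair2 (expop N D0 (- tau) (X 0)) (expop N D0 (- tau) (X 1))) G].
Proof.
move=> le_jl; move: r.
pose Y i : mpoly 2 K := mpolyX K (mnm1 (i : 'I_2)).
have homogY y : homog j ((Y 0 + y *: Y 1) ^+ j).
  have := @dhomogMn _ _ mdeg 1 (Y 0 + y *: Y 1) j.
  by rewrite mul1n; apply; rewrite rpredD ?rpredZ // dhomogX /= mdeg1.
apply: (@power_span _ _ tau) => //.
- move=> x y [h [F [G [hj Fj Gj ->]]]] [h' [F' [G' [h'j F'j G'j ->]]]].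
  exists (h + h'), (F + F'), (G + G'); split; try exact: rpredD.
  by rewrite !raddfD /= addrACA [in LHS](addrACA (charop _ _ _ _ _ _)).
- move=> c x [h [F [G [hj Fj Gj ->]]]].
  exists (c *: h), (c *: F), (c *: G); split; try exact: rpredZ.
  by rewrite !linearZ /= !scalerDr.
- move=> g gj.
  have [|||||h hj hE] := @charop_solve _ _ N D0 a beta tau _ tau_root nondeg (fun p => homog j p) _ _ _ _ g gj.
  + lia.
  + by move=> x y; exact: rpredD.
  + by move=> c x; exact: rpredZ.
  + by move=> x; exact: homog_D.
  + move=> x xj.
    (* The iterate is homogeneous of degree j <= l and has order l + 1, so it is zero. *)
    have itj : homog j (iter N D0 x) by elim: N => //= i; exact: homog_D.
    apply: msuppnil0; case E : msupp => [//|m s]; have mp : m \in msupp (iter N D0 x) by rewrite E mem_head.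
    have := nilpotent_vfield wge02 mp; move/dhomogP: itj => /(_ m mp) /= ->.
    by rewrite ltnNge le_jl.
  by exists h, 0, 0; rewrite !raddf0 !addr0; split; rewrite ?rpred0.
- move=> y; exists 0, ((Y 0 + y *: Y 1) ^+ j), 0; split; rewrite ?rpred0 //.
  by rewrite !raddf0 add0r addr0 rmorphXn rmorphD /= linearZ /= !msubstXU.
- move=> y; exists 0, 0, ((Y 0 + y *: Y 1) ^+ j); split; rewrite ?rpred0 //.
  rewrite !raddf0 !add0r rmorphXn rmorphD /= [msubst _ (y *: _)]linearZ /= !msubstXU /pair2 /=.
  rewrite expop_X0 expop_X1; congr (_ ^+ _).
  by rewrite -!mul_mpolyC; ring.
Qed.

Variable w : P.
Hypothesis w2 : ge 2 w.
Local Notation Dw := (vder (vfield w)).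
Local Notation E := (expop N Dw (- tau)).

Lemma formal_solution : exists (k : P) (F G : mpoly 2 K),
  [/\ ge 2 (k - X 0), ge 2 F, ge 2 G &
   ge l.+1 (charop N Dw a beta tau k - msubst (pair2 k (Dw k)) F
            - msubst (pair2 (E k) (E (Dw k))) G)].
Proof.
pose resid k F G := charop N Dw a beta tau k - msubst (pair2 k (Dw k)) F
            - msubst (pair2 (E k) (E (Dw k))) G.
suff key m : (m < l)%N -> exists (k : P) (F G : mpoly 2 K),
  [/\ ge 2 (k - X 0), ge 2 F, ge 2 G & ge m.+2 (resid k F G)].
  by have := key l.-1; rewrite prednK //; apply.
have X1 i : ge 1 (X i) by have := @wgeXU 3 K mdeg i; rewrite /= mdeg1.
have pair2P b (p q p' q' : P) : ge b (p - p') -> ge b (q - q') ->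
    forall i, ge b (pair2 p q i - pair2 p' q' i).
  by move=> ? ? [[|[]] // lt_i2]; rewrite /pair2.
have pair2P1 b (p q : P) : ge b p -> ge b q -> forall i, ge b (pair2 p q i).
  by move=> ? ? [[|[]] // lt_i2]; rewrite /pair2.
elim: m => [|m IH] lt_ml.
  (* The linear part of the residual is (1 - a tau^2 / 2 + beta tau) u_3, which vanishes by
     [tau_root]. *)
  exists (X 0), 0, 0; split; rewrite ?subrr; try exact: wge0.
  rewrite /resid !rmorph0 !subr0.
  have -> : charop N Dw a beta tau (X 0) =
      charop N Dw a beta tau (X 0) - charop N D0 a beta tau (X 0) +
      charop N D0 a beta tau (X 0) by rewrite subrK.
  apply: wgeD; first exact: wge_charop_sub.
  rewrite /charop /= vderX0 vderX1 expop_X0 expop_X1 sqrrN.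
  have -> : X 2%:R + a *: (X 0 - (X 0 + - tau *: X 1 + (tau ^+ 2 / 2) *: X 2%:R))
      - (a * tau) *: X 1 + beta *: (X 1 - (X 1 + - tau *: X 2%:R)) =
      (1 - a * (tau ^+ 2 / 2) + beta * tau) *: X 2%:R.
    by rewrite -!mul_mpolyC; ring.
  rewrite (_ : 1 - a * (tau ^+ 2 / 2) + beta * tau =
      - (a * tau ^+ 2 - (2 * beta * tau + 2)) / 2%:R); last by field.
  by rewrite tau_root subrr oppr0 mul0r scale0r; exact: wge0.
have [k [F [G [kX F2 G2 res]]]] := IH (ltnW lt_ml); move=> {IH}.
have [//||h [F' [G' [hj F'j G'j eq_h]]]] := @homological_solve m.+2 (- pihomog mdeg m.+2 (resid k F G)).
  by rewrite rpredN pihomogP.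
exists (k + h), (F - F'), (G - G').
have h_ge : ge m.+2 h by exact: wge_dhomog hj _.
have h2 : ge 2 h by exact: wgeW h_ge.
have h1 : ge 1 h by exact: wgeW h_ge.
have F'2 : ge 2 F' by exact: (wge_dhomog F'j).
have G'2 : ge 2 G' by exact: (wge_dhomog G'j).
split; [by rewrite addrAC; exact: wgeD|exact: wgeB|exact: wgeB|].
have k1 : ge 1 k by rewrite -(subrK (X 0) k); apply: wgeD => //; exact: wgeW kX.
have kh1 : ge 1 (k + h) by exact: wgeD.
have khX : ge 2 (k + h - X 0) by rewrite addrAC; exact: wgeD.
set q0 := pair2 (X 0) (X 1) in eq_h.
set q1 := pair2 (expop _ _ _ (X 0)) _ in eq_h.
set p0 := pair2 (k + h) (Dw (k + h)); set p1 := pair2 (E (k + h)) (E (Dw (k + h))).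
pose r0 := pair2 k (Dw k); pose r1 := pair2 (E k) (E (Dw k)).
have D0X0 : D0 (X 0) = X 1 by rewrite vderX0.
have p01 i : ge 1 (p0 i) by apply: pair2P1 => //; exact: wge_vder_vfield.
have p11 i : ge 1 (p1 i).
  by apply: pair2P1; apply: wge_expop => //; exact: wge_vder_vfield.
have r01 i : ge 1 (r0 i) by apply: pair2P1 => //; exact: wge_vder_vfield.
have r11 i : ge 1 (r1 i).
  by apply: pair2P1; apply: wge_expop => //; exact: wge_vder_vfield.
have q01 i : ge 1 (q0 i) by exact: pair2P1.
have q11 i : ge 1 (q1 i).
  by apply: pair2P1; apply: (wge_expop wge02).
have pr0 i : ge m.+2 (p0 i - r0 i).
  apply: pair2P; first by rewrite addrC addKr.
  by rewrite -linearB /= addrC addKr; exact: wge_vder_vfield.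
have pr1 i : ge m.+2 (p1 i - r1 i).
  apply: pair2P.
    have -> : E (k + h) - E k = E h by rewrite linearD /= addrC addKr.
    exact: wge_expop.
  have -> : E (Dw (k + h)) - E (Dw k) = E (Dw h) by rewrite !linearD /= addrC addKr.
  by apply: wge_expop => //; exact: wge_vder_vfield.
have pq0 i : ge 2 (p0 i - q0 i).
  by apply: pair2P => //; rewrite -D0X0; exact: (@wge_iter_sub _ w2 1).
have pq1 i : ge 2 (p1 i - q1 i).
  apply: pair2P; apply: wge_expop_sub => //; first exact: wge_vder_vfield.
  by rewrite -D0X0; exact: (@wge_iter_sub _ w2 1).
(* The corrections cancel the leading part of the residual. Each remaining bracket gains a degree: F
   and G have order 2, and the arguments agree with their linear parts modulo order 2. *)
have -> : resid (k + h) (F - F') (G - G') =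
    (resid k F G - pihomog mdeg m.+2 (resid k F G))
  + (charop N Dw a beta tau h - charop N D0 a beta tau h)
  - (msubst p0 F - msubst r0 F) - (msubst p1 G - msubst r1 G)
  + (msubst p0 F' - msubst q0 F') + (msubst p1 G' - msubst q1 G').
  have alg (c ch c0 pF pF' pG pG' rF rG qF' qG' ph : P) : - ph = c0 + qF' + qG' ->
      (c + ch) - (pF - pF') - (pG - pG') = (c - rF - rG - ph) + (ch - c0)
        - (pF - rF) - (pG - rG) + (pF' - qF') + (pG' - qG').
    by move=> /(canRL (@opprK _)) ->; ring.
  have -> : resid (k + h) (F - F') (G - G') =
      charop N Dw a beta tau k + charop N Dw a beta tau h
      - (msubst p0 F - msubst p0 F') - (msubst p1 G - msubst p1 G').
    by rewrite /resid -/p0 -/p1 linearD !rmorphB.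
  exact: alg.
apply: wgeD; last by have := wge_msubst_sub (isT : 0 < 2)%N p11 q11 pq1 (wge_dhomog G'j (leqnn _)); rewrite addn2.
apply: wgeD; last by have := wge_msubst_sub (isT : 0 < 2)%N p01 q01 pq0 (wge_dhomog F'j (leqnn _)); rewrite addn2.
apply: wgeB; last exact: (@wge_msubst_sub _ _ _ 1 m.+2).
apply: wgeB; last exact: (@wge_msubst_sub _ _ _ 1 m.+2).
apply: wgeD; last exact: wge_charop_sub.
exact: wge_sub_pihomog.
Qed.

End FormalSolution.

(** * Factorization of a near-identity map by degree *)

Section Factorization.
Variables (n : nat) (K : comNzRingType) (I : Type).
Local Notation P := (mpoly n K).
Local Notation X i := (mpolyX K (mnm1 i)).
Local Notation ge := (wge mdeg).
Variables (phi : 'I_n -> P) (h : I -> P).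

Lemma msubst_id (p : P) : msubst (fun i => X i) p = p.
Proof.
elim/mpoly_alg_ind: p => [c|j|p1 p2 IH1 IH2|p1 p2 IH1 IH2].
- by rewrite msubstC.
- by rewrite msubstXU.
- by rewrite !rmorphD /= IH1 IH2.
- by rewrite !rmorphM /= IH1 IH2.
Qed.

(* The partial composite (id + U_2) o ... o (id + U_(k+1)), whose next factor
   is the leading homogeneous part of the defect to [phi], and likewise for [h]. *)
Fixpoint factors (k : nat) : ('I_n -> P) * (I -> P) :=
  if k is k'.+1 then
    let s := factors k' in
    let q i := X i + pihomog mdeg k.+1 (phi i - s.1 i) in
    (fun i => msubst q (s.1 i),
     fun i => msubst q (s.2 i) + pihomog mdeg k.+1 (h i - s.2 i))
  else (fun i => X i, fun=> 0).

Definition factor1 k i : P := pihomog mdeg k.+2 (phi i - (factors k).1 i).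
Definition factor2 k i : P := pihomog mdeg k.+2 (h i - (factors k).2 i).

Lemma factorsS1 k i :
  (factors k.+1).1 i = msubst (fun i => X i + factor1 k i) ((factors k).1 i).
Proof. by []. Qed.
Lemma factorsS2 k i :
  (factors k.+1).2 i = msubst (fun i => X i + factor1 k i) ((factors k).2 i) + factor2 k i.
Proof. by []. Qed.

Hypotheses (phi2 : forall i, ge 2 (phi i - X i)) (h2 : forall i, ge 2 (h i)).

Lemma wge_factors k :
  [/\ forall i, ge k.+2 (phi i - (factors k).1 i),
      forall i, ge k.+2 (h i - (factors k).2 i),
      forall i, ge 2 ((factors k).1 i - X i) & forall i, ge 2 ((factors k).2 i)].
Proof.
have X1 (i : 'I_n) : ge 1 (X i) by have := @wgeXU n K mdeg i; rewrite /= mdeg1.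
elim: k => [|k [phik hk phik2 hk2]].
  by split=> i //=; rewrite ?subr0 ?subrr //; exact: wge0.
have U2 i : ge k.+2 (factor1 k i) by apply: (wge_dhomog (pihomogP _ _ _)).
have V2 i : ge k.+2 (factor2 k i) by apply: (wge_dhomog (pihomogP _ _ _)).
pose q i := X i + factor1 k i.
have q1 i : ge 1 (q i) by apply: wgeD => //; exact: wgeW (U2 i).
have qX i : ge k.+2 (q i - X i) by rewrite /q addrC addKr.
have qsub p : ge 2 p -> ge k.+3 (msubst q p - p).
  move=> p2; rewrite -{2}(msubst_id p).
  by have := @wge_msubst_sub _ _ _ 1 k.+2 q _ p isT q1 X1 qX p2; rewrite add1n.
have e1 i : phi i - (factors k.+1).1 i =
    (phi i - (factors k).1 i - factor1 k i)
    - (msubst q ((factors k).1 i - X i) - ((factors k).1 i - X i)).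
  by rewrite factorsS1 -/q (rmorphB (msubst q)) /= msubstXU /q; ring.
have e2 i : h i - (factors k.+1).2 i =
    (h i - (factors k).2 i - factor2 k i) - (msubst q ((factors k).2 i) - (factors k).2 i).
  by rewrite factorsS2 /q; ring.
have d1 i : ge k.+3 (phi i - (factors k.+1).1 i).
  by rewrite e1; apply: wgeB; [exact: wge_sub_pihomog|exact: qsub].
have d2 i : ge k.+3 (h i - (factors k.+1).2 i).
  by rewrite e2; apply: wgeB; [exact: wge_sub_pihomog|exact: qsub].
split=> // i.
  have -> : (factors k.+1).1 i - X i = (phi i - X i) - (phi i - (factors k.+1).1 i) by ring.
  by apply: wgeB => //; exact: wgeW (d1 i).
have -> : (factors k.+1).2 i = h i - (h i - (factors k.+1).2 i) by ring.
by apply: wgeB => //; exact: wgeW (d2 i).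
Qed.

End Factorization.

(** * Taylor jets of germs of rational functions *)

Section Germs.
Variable R : realType.

(* The rational remainder keeps the relation stable under differentiation, so
   that Taylor coefficients below [n] can be read off [p]. *)
Definition germ (n : nat) (f : R -> R) (p : {poly R}) :=
  exists2 rq : {poly R} * {poly R}, rq.2.[0] != 0 &
    \forall t \near (0 : R), f t = p.[t] + t ^+ n * (rq.1.[t] / rq.2.[t]).

Lemma near0_horner (q : {poly R}) : q.[0] != 0 -> \forall t \near (0 : R), q.[t] != 0.
Proof.
move=> q0; have /= := @continuous_horner R q 0.
by move=> /(_ [set x | x != 0]); apply; apply: open_nbhs_nbhs; split; [exact: open_neq|].
Qed.

Lemma germ_eq n f g p : (\forall t \near (0 : R), f t = g t) -> germ n g p -> germ n f p.
Proof.
move=> fg [rq rq0 gE]; exists rq; first exact: rq0.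
by apply: filterS2 fg gE => t -> ->.
Qed.

Lemma germ_horner n p : germ n (fun t => p.[t]) p.
Proof.
exists (0, 1); first by rewrite /= hornerC oner_neq0.
by near=> t; rewrite horner0 mul0r mulr0 addr0.
Unshelve. all: by end_near. Qed.

Lemma germD n f g p q : germ n f p -> germ n g q -> germ n (fun t => f t + g t) (p + q).
Proof.
move=> [[r s] /= s0 fE] [[r' s'] /= s'0 gE].
exists (r * s' + r' * s, s * s'); first by rewrite /= hornerM mulf_neq0.
near=> t.
have st : s.[t] != 0 by near: t; exact: near0_horner.
have s't : s'.[t] != 0 by near: t; exact: near0_horner.
rewrite (near fE t)// (near gE t)// !(hornerD, hornerM).
by field; rewrite st s't.
Unshelve. all: by end_near. Qed.

Lemma germMl n f p (s : {poly R}) : germ n f p -> germ n (fun t => s.[t] * f t) (s * p).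
Proof.
move=> [[r q] /= q0 fE]; exists (s * r, q); first exact: q0.
apply: filterS fE => t -> /=; rewrite !hornerM mulrDr; congr (_ + _).
by rewrite mulrCA !mulrA.
Qed.

Lemma germ0 n : germ n (fun=> 0) 0.
Proof. by have := germ_horner n 0; under eq_fun do rewrite horner0. Qed.

Lemma germ_sum n (I : Type) (r : seq I) (C : pred I) (f : I -> R -> R) (p : I -> {poly R}) :
  (forall i, germ n (f i) (p i)) ->
  germ n (fun t => \sum_(i <- r | C i) f i t) (\sum_(i <- r | C i) p i).
Proof.
move=> fp; elim: r => [|i r IH].
  by under eq_fun do rewrite big_nil; rewrite big_nil; exact: germ0.
under eq_fun do rewrite big_cons; rewrite big_cons.
by case: (C i) => //; exact: germD.
Qed.

Lemma germ_at0 n f p : germ n.+1 f p -> f 0 = p.[0].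
Proof. by move=> [rq _ /nbhs_singleton ->]; rewrite expr0n mul0r addr0. Qed.

(** By the quotient rule the derivative of t^(n+1) r / q is t^n times a rational function with
    denominator q^2, still nonzero at 0. *)
Lemma germ_derive n f p : germ n.+1 f p ->
  (\forall t \near (0 : R), derivable f t 1) /\ germ n (derive1 f) p^`().
Proof.
move=> [[r q] /= q0 fE].
pose g (t : R) : R := p.[t] + ('X^(n.+1) * r).[t] * (q.[t])^-1.
(* Differentiating [f] at a point t near 0 requires the equality on a whole neighbourhood of t. *)
have fg : \forall t \near (0 : R), \forall s \near t, f s = g s.
  apply: near_join.
  by near=> t; rewrite (near fE t)// /g !hornerM hornerXn mulrA.
pose dg (t : R) : R := p^`().[t] + t ^+ n *
  ((n.+1%:R *: (r * q) + 'X * (r^`() * q - r * q^`())).[t] / (q * q).[t]).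
have gd t : q.[t] != 0 -> is_derive t 1 g (dg t).
  move=> qt.
  have dq : is_derive t 1 (horner q : R -> R) q^`().[t] by exact: is_derive_poly.
  have dV : is_derive t (1 : R) (fun y => (q.[y])^-1) (- q.[t] ^- 2 *: q^`().[t]).
    by apply: DeriveDef; [exact: derivableV|rewrite deriveV// derive_val].
  have dM := is_deriveM (is_derive_poly ('X^(n.+1) * r) t) dV.
  have dD := is_deriveD (is_derive_poly p t) dM.
  apply: (is_derive_eq dD).
  rewrite /dg !hornerE derivM derivXn !hornerE hornerMn hornerXn.
  rewrite /GRing.scale /= -mulr_natl exprS.
  by field.
split.
  near=> t; apply: (@near_eq_derivable _ _ _ g).
    near do apply/esym; near: t; exact: fg.
  by apply: (@ex_derive _ _ _ _ _ _ (dg t)); apply: gd; near: t; exact: near0_horner.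
exists (n.+1%:R *: (r * q) + 'X * (r^`() * q - r * q^`()), q * q).
  by rewrite /= hornerM mulf_neq0.
near=> t; rewrite derive1E (@near_eq_derive _ _ _ _ g); last by near: t; exact: fg.
rewrite -/(dg t); apply: (@derive_val _ _ _ _ _ _ (dg t)); apply: gd; near: t.
exact: near0_horner.
Unshelve. all: by end_near. Qed.

Section Matrix.
Variables (m k : nat).
Implicit Types (f : R -> 'M[R]_(m, k)) (p : 'M[{poly R}]_(m, k)).

Definition mgerm n f p := forall i j, germ n (fun t => f t i j) (p i j).

Lemma mgerm_derive n f p : mgerm n.+1 f p -> mgerm n (derive1 f) (map_mx deriv p).
Proof.
move=> fp i j.
have fd : \forall t \near (0 : R), derivable f t 1.
  have all_d : \forall t \near (0 : R), forall ij : 'I_m * 'I_k, derivable (fun t => f t ij.1 ij.2) t 1.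
    apply: (@filter_forall R ('I_m * 'I_k)%type (fun ij t => derivable (fun t => f t ij.1 ij.2) t 1) (nbhs (0 : R))) => ij.
    by have [] := germ_derive (fp ij.1 ij.2).
  by apply: filterS all_d => t dt; apply/derivable_mxP => i' j'; exact: (dt (i', j')).
rewrite mxE; have [_] := germ_derive (fp i j); apply: germ_eq.
by near=> t; rewrite !derive1E derive_mx ?mxE//; near: t.
Unshelve. all: by end_near. Qed.

(** Each derivative spends one order; after j < n of them a positive power of t is left and kills
    the remainder at 0. *)
Lemma mgerm_taylor n f p j : (j < n)%N -> mgerm n f p ->
  taylor_coef j f = \matrix_(a, b) (p a b)`_j.
Proof.
move=> lt_jn fp.
have : mgerm (n - j) (derive1n j f) (map_mx (derivn j) p).
  elim: j {lt_jn} (ltnW lt_jn) => [|j IH] le_jn.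
    rewrite subn0 derive1n0; suff -> : map_mx (derivn 0) p = p by [].
    by apply/matrixP => a b; rewrite mxE.
  rewrite derive1nS; have := IH (ltnW le_jn).
  rewrite -(subnSK le_jn) => /mgerm_derive.
  suff -> : map_mx deriv (map_mx (derivn j) p) = map_mx (derivn j.+1) p by [].
  by apply/matrixP => a b; rewrite !mxE.
rewrite -(subnSK lt_jn) => fj; apply/matrixP => a b.
rewrite /taylor_coef !mxE (germ_at0 (fj a b)) mxE horner_coef0 coef_derivn addn0 ffactnn.
rewrite -[X in _ * X]mulr_natl.
by rewrite mulKf// pnatr_eq0 -lt0n fact_gt0.
Qed.

End Matrix.

(** Cramer: f = c + t^n adj(M) e / det M near 0, where the determinant does not vanish. *)
Lemma germ_solve k n (M : 'M[{poly R}]_k) (c e : 'cV[{poly R}]_k) (f : R -> 'cV[R]_k) :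
  (\det M).[0] != 0 ->
  (\forall t \near (0 : R), map_mx (horner^~ t) M *m f t =
     map_mx (horner^~ t) (M *m c) + t ^+ n *: map_mx (horner^~ t) e) ->
  mgerm n f c.
Proof.
move=> M0 fE i j; exists ((\adj M *m e) i j, \det M); first exact: M0.
near=> t.
have evM a b (A : 'M[{poly R}]_(a, k)) (B : 'M[{poly R}]_(k, b)) :
    map_mx (horner^~ t) (A *m B) = map_mx (horner^~ t) A *m map_mx (horner^~ t) B.
  by apply/matrixP => x y; rewrite !mxE horner_sum; apply: eq_bigr => z _; rewrite !mxE hornerM.
have Mt : (\det M).[t] != 0 by near: t; exact: near0_horner.
have adjM : map_mx (horner^~ t) (\adj M) *m map_mx (horner^~ t) M = ((\det M).[t])%:M.
  rewrite -evM mul_adj_mx; apply/matrixP => x y; rewrite !mxE.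
  by case: (x == y); rewrite ?mulr1n ?mulr0n ?horner0.
have : (\det M).[t] *: f t = (\det M).[t] *: map_mx (horner^~ t) c
    + t ^+ n *: map_mx (horner^~ t) (\adj M *m e).
  rewrite -!mul_scalar_mx -adjM -mulmxA (near fE t)// mulmxDr evM !mulmxA adjM.
  by rewrite -scalemxAr -evM [in RHS]mul_scalar_mx [in RHS]mul_scalar_mx mul_scalar_mx.
move=> /matrixP /(_ i j); rewrite !mxE => E.
by apply: (mulfI Mt); rewrite E mulrDr; congr (_ + _); field.
Unshelve. all: by end_near. Qed.

End Germs.

(** * One-sided derivatives on an interval *)

Section OneSidedDerivative.
Variable R : realType.

(** Relational form of [derive_in]: it carries convergence along, which a bare [lim] does not. *)
Definition has_der (I : set R) (V : normedModType R) (f : R -> V) (x : R) (d : V) :=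
  (fun y => (y - x)^-1 *: (f y - f x)) @ within I x^' --> d.

Lemma within_cvg (U : nbhsType) (I : set R) (x : R) (f g : R -> U) (l : U) :
  (forall y, I y -> y != x -> f y = g y) ->
  g @ within I x^' --> l -> f @ within I x^' --> l.
Proof.
move=> fg; apply: cvg_trans; apply: near_eq_cvg; near=> y.
have Iy : I y by near: y; exact: withinT.
have yx : y != x by near: y; apply: (@cvg_within _ x^'); exact: withinT.
by rewrite fg.
Unshelve. all: by end_near. Qed.

(** The interval accumulates at x from the right if x < b and from the left if x = b. Properness
    gives uniqueness of one-sided limits. *)
Lemma within_dnbhs_proper (a b x : R) : a < b -> `[a, b]%classic x ->
  ProperFilter (within `[a, b]%classic x^').
Proof.
move=> ab; rewrite /= in_itv /= => /andP[ax xb]; apply: Build_ProperFilter.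
move=> /nbhs_ballP[e /= e0 He].
have [y [ye yx /andP[ay yb]]] : exists y, [/\ `|x - y| < e, y != x & a <= y <= b].
  have [xltb|bx] := ltP x b.
    have d0 : 0 < Num.min (e / 2) (b - x) by rewrite lt_min divr_gt0 //= subr_gt0.
    have d1 : Num.min (e / 2) (b - x) <= e / 2 by rewrite ge_min lexx.
    have d2 : Num.min (e / 2) (b - x) <= b - x by rewrite ge_min lexx orbT.
    move: (Num.min _ _) d0 d1 d2 => d d0 d1 d2.
    exists (x + d); split; first by rewrite opprD addrA subrr sub0r normrN gtr0_norm //; lra.
      by rewrite -subr_eq0 addrC addKr gt_eqF.
    by lra.
  have d0 : 0 < Num.min (e / 2) (x - a) by rewrite lt_min divr_gt0 //= subr_gt0; lra.
  have d1 : Num.min (e / 2) (x - a) <= e / 2 by rewrite ge_min lexx.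
  have d2 : Num.min (e / 2) (x - a) <= x - a by rewrite ge_min lexx orbT.
  move: (Num.min _ _) d0 d1 d2 => d d0 d1 d2.
  exists (x - d); split; first by rewrite opprB addrCA subrr addr0 gtr0_norm //; lra.
    by rewrite -subr_eq0 addrC addKr oppr_eq0 gt_eqF.
  by lra.
by apply: (He y ye yx); rewrite /= in_itv /= ay yb.
Qed.

Section Rules.
Variables (I : set R) (x : R).
Hypothesis Ix : I x.
Variable V : normedModType R.
Implicit Types (f g : R -> V) (c d e : V).

Lemma has_der_ext f g d : (forall y, I y -> f y = g y) -> has_der I g x d -> has_der I f x d.
Proof.
move=> fg gd; apply: (within_cvg _ gd) => y Iy _.
by rewrite (fg y Iy) (fg x Ix).
Qed.

Lemma has_derD f g d e : has_der I f x d -> has_der I g x e ->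
  has_der I (fun y => f y + g y) x (d + e).
Proof.
move=> fd ge; apply: (within_cvg _ (cvgD fd ge)) => y _ _.
by rewrite /= opprD addrACA scalerDr.
Qed.

Lemma has_derZ f d (r : R) : has_der I f x d ->
  has_der I (fun y => r *: f y) x (r *: d).
Proof.
move=> fd; apply: (within_cvg _ (cvgZ (cvg_cst r) fd)) => y _ _.
by rewrite /= -scalerBr !scalerA mulrC.
Qed.

Lemma has_der_cst c : has_der I (fun=> c) x 0.
Proof.
rewrite /has_der; under eq_fun do rewrite subrr scaler0; exact: cvg_cst.
Qed.

Lemma has_der_sum (T : Type) (r : seq T) (f : T -> R -> V) (d : T -> V) :
  (forall i, has_der I (f i) x (d i)) ->
  has_der I (fun y => \sum_(i <- r) f i y) x (\sum_(i <- r) d i).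
Proof.
move=> fd; elim: r => [|i r IH].
  by rewrite big_nil; under eq_fun do rewrite big_nil; exact: has_der_cst.
by rewrite big_cons; under eq_fun do rewrite big_cons; exact: has_derD.
Qed.

(** By the factor theorem p(y) - p(x) = (y - x) q(y) with q(x) = p'(x), so the difference quotient
    is a polynomial and continuity suffices. *)
Lemma has_der_horner (p : {poly R}) c :
  has_der I (fun y => p.[y] *: c) x (p^`().[x] *: c).
Proof.
have [q qE] : exists q, p = q * ('X - x%:P) + (p.[x])%:P.
  have /factor_theorem[q] : root (p - (p.[x])%:P) x by rewrite rootE !hornerE subrr.
  by move=> /(canRL (subrK _)) qE; exists q.
have -> : p^`().[x] = q.[x].
  by rewrite qE !(derivD, derivM, derivN, derivX, derivC) !hornerE subrr mulr0 add0r subr0 mulr1.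
rewrite /has_der; apply: (@within_cvg V I x _ (fun y => q.[y] *: c)).
  move=> y _ yx; rewrite -scalerBl scalerA; congr (_ *: _).
  by rewrite {1}qE !hornerE addrK mulrC mulfK // subr_eq0.
do 2 apply: cvg_within_filter.
by apply: cvgZr_tmp; exact: continuous_horner.
Qed.

End Rules.

Lemma has_der_mx (I : set R) (m n : nat) (f : R -> 'M[R]_(m, n)) x d i j :
  has_der I f x d -> has_der I (fun y => f y i j : R^o) x (d i j).
Proof.
move=> fd; have := cvg_comp _ _ fd (@coord_continuous _ _ _ i j d).
rewrite /has_der; apply: within_cvg => y _ _.
by rewrite /= !mxE.
Qed.

Section Interval.
Variables (a b : R).
Hypothesis ab : a < b.
Local Notation I := (`[a, b]%classic : set R).
Variable V : normedModType R.
Implicit Types (f g : R -> V).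

Lemma has_derE f x d : I x -> has_der I f x d -> derive_in I f x = d.
Proof.
move=> Ix fd; have FF := within_dnbhs_proper ab Ix.
exact: cvg_lim.
Qed.

Lemma derivable_has_der f x : derivable_in I f x -> has_der I f x (derive_in I f x).
Proof. by []. Qed.

End Interval.

Lemma has_der_continuous (I : set R) (f : R -> R^o) y d : has_der I f y d ->
  f @ within I (nbhs y) --> f y.
Proof.
move=> fd.
have fy : f @ within I y^' --> f y.
  have id0 : (fun z => z - y) @ within I y^' --> 0.
    rewrite -(subrr y); do 2 apply: cvg_within_filter.
    by apply: cvgB; [exact: cvg_id|exact: cvg_cst].
  have fz : (fun z => f y + (z - y) *: ((z - y)^-1 *: (f z - f y))) @ within I y^' --> f y.
    rewrite -[X in _ --> X]addr0 -(scale0r d).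
    by apply: cvgD; [exact: cvg_cst|exact: (cvgZ id0 fd)].
  apply: (within_cvg _ fz) => z _ zy /=.
  by rewrite scalerA divff ?scale1r ?subrKC // subr_eq0.
move=> P Pfy; have /= H := fy P Pfy.
have H' : nbhs y [set z | z != y -> I z -> P (f z)] by exact: H.
rewrite /nbhs /= /within; apply: filterS H' => z Hz Iz /=.
have [->|zy] := eqVneq z y; first exact: nbhs_singleton.
exact: Hz.
Qed.

Lemma has_der_interior (a b : R) (f : R -> R^o) y d : a < y < b ->
  has_der `[a, b]%classic f y d -> is_derive y 1 f d.
Proof.
move=> /andP[ay yb] fd.
have sh : (fun h => h + y) @ 0^' --> within `[a, b]%classic y^'.
  move=> P; rewrite /within /dnbhs => /nbhs_ballP[e /= e0 He].
  apply/nbhs_ballP; exists (Num.min e (Num.min (y - a) (b - y))).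
    by rewrite /= !lt_min e0 !subr_gt0 ay.
  move=> h /=; rewrite /ball /= sub0r normrN !lt_min => /and3P[he ha hb] h0 /=.
  apply: He => /=.
  - by rewrite /ball /= opprD addrCA subrr addr0 normrN.
  - by rewrite -subr_eq0 addrK.
  - rewrite in_itv /=; move: ha hb; rewrite !ltr_norml => /andP[? ?] /andP[? ?].
    by apply/andP; split; lra.
have : (fun h => h^-1 *: (f (h *: 1 + y) - f y)) @ 0^' --> d.
  have := cvg_comp _ _ sh fd; rewrite /comp.
  by under eq_fun do rewrite addrK; under [X in _ -> X @ _ --> _]eq_fun do rewrite scaler1.
move=> fd'; apply: DeriveDef; first by apply/cvg_ex; exists d.
exact: cvg_lim fd'.
Qed.

Lemma has_der0_cst (a b : R) (f : R -> R^o) : a < b ->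
  (forall x, `[a, b]%classic x -> has_der `[a, b]%classic f x 0) ->
  forall x, `[a, b]%classic x -> f x = f a.
Proof.
move=> ab fd x Ix; have ax : a <= x by move: Ix; rewrite /= in_itv /= => /andP[].
have xb : x <= b by move: Ix; rewrite /= in_itv /= => /andP[].
move: ax; rewrite le_eqVlt => /predU1P[<- //|ax].
have fI (y : R) : a < y < x -> is_derive y 1 f 0.
  move=> /andP[ay yx]; have yb := lt_le_trans yx xb.
  apply: (@has_der_interior a b); first by rewrite ay.
  by apply: fd; rewrite /= in_itv /= !ltW.
have fc : {within `[a, x], continuous f}.
  apply/subspace_continuousP => y; rewrite /= in_itv /= => /andP[ay yx].
  have Iy : `[a, b]%classic y by rewrite /= in_itv /= ay (le_trans yx).
  apply: cvg_trans (has_der_continuous (fd y Iy)).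
  apply: cvg_app; apply: within_subset => z; rewrite /= !in_itv /= => /andP[-> zx].
  exact: le_trans zx xb.
have fI' (y : R) : y \in `]a, x[ -> is_derive y 1 f 0 by rewrite in_itv /=; exact: fI.
have [c _] := @MVT R f (fun=> 0) a x ax fI' fc.
by rewrite mul0r => /eqP; rewrite subr_eq0 => /eqP.
Qed.

End OneSidedDerivative.

(** * The adjoint basis and the bilinear form *)

Lemma ord2P (Q : 'I_2 -> Prop) : Q 0 -> Q 1 -> forall i, Q i.
Proof.
move=> Q0 Q1 [[|[|]] // lt_i2].
  by rewrite (_ : Ordinal _ = 0) //; exact: val_inj.
by rewrite (_ : Ordinal _ = 1) //; exact: val_inj.
Qed.

Lemma ord3P (Q : 'I_3 -> Prop) : Q 0 -> Q 1 -> Q 2%:R -> forall i, Q i.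
Proof.
move=> Q0 Q1 Q2 [[|[|[|]]] // lt_i3].
- by rewrite (_ : Ordinal _ = 0) //; exact: val_inj.
- by rewrite (_ : Ordinal _ = 1) //; exact: val_inj.
- by rewrite (_ : Ordinal _ = 2%:R) //; exact: val_inj.
Qed.

Lemma sum_ord2 (V : nmodType) (F : 'I_2 -> V) : \sum_i F i = F 0 + F 1.
Proof. by rewrite !big_ord_recl big_ord0 addr0; congr (F _ + F _); exact: val_inj. Qed.

Lemma sum_ord3 (V : nmodType) (F : 'I_3 -> V) : \sum_i F i = F 0 + F 1 + F 2%:R.
Proof.
rewrite !big_ord_recl big_ord0 addr0 addrA.
by congr (F _ + F _ + F _); exact: val_inj.
Qed.

(** * Integrals of polynomials *)

Section Antiderivative.
Variable R : realType.

(** At index 0 the division by zero returns 0, so this is the antiderivative vanishing at 0. *)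
Definition prim (p : {poly R}) : {poly R} :=
  \poly_(i < (size p).+1) (p`_i.-1 / i%:R).

Lemma coef_prim p i : (prim p)`_i = p`_i.-1 / i%:R.
Proof.
rewrite coef_poly; case: ltnP => // le_pi.
case: i le_pi => [|i] le_pi; first by rewrite invr0 mulr0.
by rewrite nth_default ?mul0r.
Qed.

Lemma prim_linear : linear prim.
Proof. by move=> c p q; apply/polyP => i; rewrite !(coef_prim, coefD, coefZ) mulrDl mulrA. Qed.
HB.instance Definition _ :=
  GRing.isLinear.Build R {poly R} {poly R} _ prim prim_linear.

Lemma deriv_prim p : (prim p)^`() = p.
Proof.
apply/polyP => i; rewrite coef_deriv coef_prim /= -[_ *+ _]mulr_natr.
by rewrite divfK // pnatr_eq0.
Qed.

Lemma prim_deriv p x y : (prim p^`()).[y] - (prim p^`()).[x] = p.[y] - p.[x].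
Proof.
suff -> : prim p^`() = p - (p`_0)%:P by rewrite !hornerE opprB addrA subrK.
apply/polyP => i; rewrite coef_prim coefB coefC; case: i => [|i] /=.
  by rewrite invr0 mulr0 subrr.
by rewrite coef_deriv subr0 -[_ *+ _]mulr_natr mulfK // pnatr_eq0.
Qed.

Lemma Rintegral_horner (x y : R) (f : R -> R) (p : {poly R}) : x <= y ->
  (forall z, x <= z <= y -> f z = p.[z]) ->
  Rintegral lebesgue_measure `[x, y] f = (prim p).[y] - (prim p).[x].
Proof.
rewrite le_eqVlt => /predU1P[<- _|xy fp].
  by rewrite subrr set_itv1 Rintegral_set1.
rewrite /Rintegral.
have -> : (\int[lebesgue_measure]_(z in `[x, y]) (f z)%:E =
    \int[lebesgue_measure]_(z in `[x, y]) (p.[z])%:E)%E.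
  by apply: eq_integral => z; rewrite inE /= in_itv /= => /fp ->.
rewrite (@continuous_FTC2 R (horner p) (horner (prim p))) //.
- by apply: continuous_subspaceT; exact: continuous_horner.
- split; first by move=> z _; exact: derivable_horner.
  + by apply: cvg_at_right_filter; exact: continuous_horner.
  + by apply: cvg_at_left_filter; exact: continuous_horner.
- by move=> z _; rewrite -derivE deriv_prim.
Qed.

Lemma oint_horner (y : R) (f : R -> R) (p : {poly R}) : y <= 0 ->
  (forall z, y <= z <= 0 -> f z = p.[z]) ->
  oint 0 y f = (prim p).[y] - (prim p).[0].
Proof.
move=> y0 fp; rewrite /oint; have [y1|y1] := leP 0 y.
  have yE : y = 0 by apply/eqP; rewrite eq_le y0.
  rewrite yE (@Rintegral_horner _ _ _ p) ?subrr // => z /andP[z1 z2].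
  by apply: fp; rewrite yE z1.
by rewrite (@Rintegral_horner _ _ _ p) // opprB.
Qed.

End Antiderivative.

Section Bilinear.
Variables (R : realType) (a beta : R).
Hypothesis a_gt0 : 0 < a.
Local Notation tau := (tau0 a beta).

(** This is the vanishing of the s^2 coefficient of the characteristic function. *)
Lemma tau0_root : a * tau ^+ 2 = 2 * beta * tau + 2.
Proof.
have s2 : Num.sqrt (beta ^+ 2 + 2 * a) ^+ 2 = beta ^+ 2 + 2 * a.
  by rewrite sqr_sqrtr // addr_ge0 ?sqr_ge0 // mulr_ge0 // ltW.
rewrite /tau0; move: (Num.sqrt _) s2 => s s2.
have -> : a * ((beta + s) / a) ^+ 2 = (beta ^+ 2 + 2 * beta * s + s ^+ 2) / a.
  by field; rewrite gt_eqF.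
by rewrite s2; field; rewrite gt_eqF.
Qed.

Lemma tau0_gt0 : 0 < tau.
Proof.
rewrite divr_gt0 //.
have : Num.sqrt (beta ^+ 2) < Num.sqrt (beta ^+ 2 + 2 * a).
  by rewrite ltr_sqrt ?ltrDl ?mulr_gt0 // ltr_wpDl ?sqr_ge0 ?mulr_gt0.
rewrite sqrtr_sqr => lt_s; have := ler_norm (- beta); rewrite normrN.
by move: lt_s; lra.
Qed.

(** Since a tau = beta + sqrt (beta^2 + 2 a), equality with 3 beta would make the root 2 beta, and
    squaring gives 3 beta^2 = 2 a. *)
Lemma tau0_nondeg : 3 * beta ^+ 2 <> 2 * a -> tau ^+ 2 * (a * tau - 3 * beta) != 0.
Proof.
move=> nondeg; apply: mulf_neq0; first by rewrite expf_neq0 // gt_eqF // tau0_gt0.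
apply/eqP => tauE; apply: nondeg.
have s2 : Num.sqrt (beta ^+ 2 + 2 * a) ^+ 2 = beta ^+ 2 + 2 * a.
  by rewrite sqr_sqrtr // addr_ge0 ?sqr_ge0 // mulr_ge0 // ltW.
move: tauE; rewrite /tau0 mulrC divfK ?gt_eqF //.
move: (Num.sqrt _) s2 => s s2 sE.
have {sE} sE : s = 2 * beta by move: sE; lra.
by move: s2; rewrite sE; lra.
Qed.

Variable Psi : R -> 'M[R]_(3, 2).
Hypothesis PsiP : adjoint_basis a beta Psi.

Let I_adj0 : Iadj a beta 0.
Proof. by rewrite /Iadj /= in_itv /= lexx ltW ?tau0_gt0. Qed.

(* Solving [Psi' = - B Psi] from the value at 0. *)
Definition Psip : 'M[{poly R}]_(3, 2) :=
  \matrix_(i, c) [:: (Psi 0 0 c)%:P - (Psi 0 1 c) *: 'X + (Psi 0 2%:R c / 2) *: 'X^2;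
                     (Psi 0 1 c)%:P - (Psi 0 2%:R c) *: 'X; (Psi 0 2%:R c)%:P]`_i.

Lemma BmxE i (V : lmodType R) (F : 'I_3 -> V) :
  \sum_j Bmx i j *: F j = [:: F 1; F 2%:R; 0]`_i.
Proof.
by elim/ord3P: i; rewrite sum_ord3 !mxE /= !(scale0r, scale1r, add0r, addr0).
Qed.

Lemma Psip_deriv i c : (Psip i c)^`() = - \sum_j Bmx i j *: Psip j c.
Proof.
rewrite BmxE; elim/ord3P: i; rewrite !mxE /=.
- rewrite !(derivD, derivN, derivZ, derivC, derivX, derivXn) /= add0r opprB.
  by rewrite alg_polyC addrC expr1 -[in LHS](scaler_nat 2 'X) scalerA divfK ?pnatr_eq0.
- by rewrite !(derivD, derivN, derivZ, derivC, derivX) add0r alg_polyC.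
- by rewrite derivC oppr0.
Qed.

Lemma has_der_Psi s i c : Iadj a beta s ->
  has_der (Iadj a beta) (fun s => Psi s i c : R^o) s (- \sum_j Bmx i j *: Psi s j c).
Proof.
move=> Is; have [_ _ _ /(_ s Is)[dPsi dE] _] := PsiP.
have := @has_der_mx _ _ _ _ _ _ _ i c (derivable_has_der dPsi).
by rewrite dE !mxE.
Qed.

(** B is strictly upper triangular, so the rows are integrated from the bottom up: each difference
    with the polynomial has zero one-sided derivative. *)
Lemma PsiE s i c : Iadj a beta s -> Psi s i c = (Psip i c).[s].
Proof.
have tau_gt0 := tau0_gt0.
suff key j c' : (forall s, Iadj a beta s ->
    has_der (Iadj a beta) (fun s => Psi s j c' : R^o) s (Psip j c')^`().[s]) ->
    (Psip j c').[0] = Psi 0 j c' -> forall s, Iadj a beta s -> Psi s j c' = (Psip j c').[s].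
  have e0 j c' : (Psip j c').[0] = Psi 0 j c'.
    by elim/ord3P: j; rewrite mxE /= !hornerE /= ?expr0n /= ?mulr0 ?subr0 ?addr0.
  have P2 c' : forall s, Iadj a beta s -> Psi s 2%:R c' = (Psip 2%:R c').[s].
    apply: key => // x Ix; have := @has_der_Psi x 2%:R c' Ix.
    by rewrite Psip_deriv !BmxE /= !oppr0 horner0.
  have P1 c' : forall s, Iadj a beta s -> Psi s 1 c' = (Psip 1 c').[s].
    apply: key => // x Ix; have := @has_der_Psi x 1 c' Ix.
    by rewrite Psip_deriv !BmxE /= hornerN P2.
  have P0 c' : forall s, Iadj a beta s -> Psi s 0 c' = (Psip 0 c').[s].
    apply: key => // x Ix; have := @has_der_Psi x 0 c' Ix.
    by rewrite Psip_deriv !BmxE /= hornerN P1.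
  by elim/ord3P: i => Is; [exact: P0|exact: P1|exact: P2].
move=> dP P0 x Ix; apply/eqP; rewrite -subr_eq0.
rewrite (@has_der0_cst _ 0 tau (fun s => Psi s j c' - (Psip j c').[s])) ?P0 ?subrr //.
move=> y Iy.
have := has_derD (dP y Iy) (@has_der_horner _ (Iadj a beta) y R^o (- Psip j c') 1).
rewrite derivN hornerN /GRing.scale /= mulr1 subrr.
by apply: has_der_ext => // z _; rewrite hornerN mulr1.
Qed.

(** Rows of [Psi] lie in the domain of the formal adjoint; its boundary condition is rewritten with
    Psi' = - B Psi. *)
Lemma Psi_boundary i :
  \sum_(p <- eta_atoms a beta) (row i (Psi (- p.1)) *m p.2) = row i (Bmx *m Psi 0).
Proof.
have [egen indep _ der _] := PsiP.
have [n [s [s0 sdom sn]]] := egen i.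
(* A chain of length 0 would make the row vanish, against linear independence. *)
have [n0|n_gt0] := posnP n.
  suff : delta_mx 0 i = 0 :> 'rV[R]_3.
    by move=> /matrixP /(_ 0 i); rewrite !mxE !eqxx => /eqP; rewrite oner_eq0.
  by apply: indep => x Ix; rewrite -rowE -s0 //; have := sn x Ix; rewrite n0.
have [[[ds _] bc] _] := sdom _ n_gt0.
have rowder : derive_in (Iadj a beta) (s 0%N) 0 = - row i (Bmx *m Psi 0).
  apply/matrixP => z c; rewrite (ord1 z).
  have dsc := @has_der_mx _ _ _ _ _ _ _ 0 c (derivable_has_der (ds 0 I_adj0)).
  rewrite -(has_derE tau0_gt0 I_adj0 dsc) !mxE.
  rewrite (has_derE tau0_gt0 I_adj0 (d := - \sum_j Bmx i j *: Psi 0 j c)) //.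
  apply: has_der_ext (has_der_Psi I_adj0) => // y Iy.
  by rewrite s0 ?inE // mxE.
move: bc; rewrite rowder opprK => ->.
rewrite /eta_int !big_cons !big_nil /=.
by rewrite -!s0 ?oppr0 ?opprK // inE /Iadj /= in_itv /= lexx ltW ?tau0_gt0.
Qed.

End Bilinear.

(** * Histories polynomial in theta *)

Section PolynomialVectors.
Variable R : realType.
Implicit Type f : 'cV[{poly R}]_2.

Definition polyfun f : R -> 'cV[R]_2 := fun t => map_mx (horner^~ t) f.

Lemma has_der_polyfun (I : set R) x f : I x ->
  has_der I (polyfun f) x (polyfun (map_mx deriv f) x).
Proof.
move=> Ix.
have polyfunE g : polyfun g = fun t => \sum_c (g c 0).[t] *: delta_mx c (0 : 'I_1).
  apply/funext => t; apply/matrixP => i j; rewrite (ord1 j) summxE (bigD1 i) //=.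
  rewrite !mxE !eqxx mulr1 big1 ?addr0 // => c ci.
  by rewrite !mxE eq_sym (negPf ci) mulr0.
rewrite !polyfunE; apply: has_der_sum => c; rewrite mxE.
exact: has_der_horner.
Qed.

Lemma C1_in_polyfun (a b : R) f : a < b -> C1_in `[a, b]%classic (polyfun f).
Proof.
move=> ab; split=> [x Ix|]; first by apply/cvg_ex; exists (polyfun (map_mx deriv f) x); exact: has_der_polyfun.
apply: (@subspace_eq_continuous _ _ _ (polyfun (map_mx deriv f))) => [x|].
  move=> /set_mem Ix; rewrite /from_subspace; apply/esym.
  by apply: (has_derE ab Ix); exact: has_der_polyfun.
apply: continuous_subspaceT => x.
have : differentiable (polyfun (map_mx deriv f)) x; last exact: differentiable_continuous.
apply/derivable1_diffP; apply/derivable_mxP => i j.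
rewrite /polyfun; under eq_fun do rewrite mxE; exact: derivable_horner.
Qed.

End PolynomialVectors.

Section BilinearForm.
Variables (R : realType) (a beta : R).
Hypothesis a_gt0 : 0 < a.
Local Notation tau := (tau0 a beta).
Variable Psi : R -> 'M[R]_(3, 2).
Hypothesis PsiP : adjoint_basis a beta Psi.
Local Notation Pp := (Psip Psi).
Implicit Type f : 'cV[{poly R}]_2.

(** The integrand psi(zeta - t) A f(zeta) of the bilinear form, as a polynomial in zeta, for row i
    of [Psi] and the point mass [A] at [t]. *)
Definition kernel_poly i (t : R) (A : 'M[R]_2) f : {poly R} :=
  \sum_c \sum_d A c d *: ((Pp i c \Po ('X - t%:P)) * f d 0).

Definition bilin_poly i f : R :=
  \sum_c Psi 0 i c * (f c 0).[0]
  - \sum_(p <- eta_atoms a beta)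
      ((prim (kernel_poly i p.1 p.2 f)).[p.1] - (prim (kernel_poly i p.1 p.2 f)).[0]).

Lemma kernel_polyD i t A f g : kernel_poly i t A (f + g) = kernel_poly i t A f + kernel_poly i t A g.
Proof.
rewrite /kernel_poly -big_split /=; apply: eq_bigr => x _.
by rewrite -big_split /=; apply: eq_bigr => y _; rewrite [(f + g) y 0]mxE mulrDr scalerDr.
Qed.

Lemma kernel_polyZ i t A (c : R) f : kernel_poly i t A (c%:P *: f) = c *: kernel_poly i t A f.
Proof.
rewrite /kernel_poly scaler_sumr; apply: eq_bigr => x _.
rewrite scaler_sumr; apply: eq_bigr => y _.
by rewrite [(c%:P *: f) y 0]mxE mulrCA mul_polyC !scalerA mulrC.
Qed.

Lemma bilin_polyD i f g : bilin_poly i (f + g) = bilin_poly i f + bilin_poly i g.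
Proof.
rewrite /bilin_poly addrACA -opprD -!big_split /=; congr (_ - _).
  by apply: eq_bigr => c _; rewrite mxE hornerD mulrDr.
apply: eq_bigr => p _; rewrite kernel_polyD linearD /= !hornerD opprD addrACA //.
Qed.

Lemma bilin_polyZ i (c : R) f : bilin_poly i (c%:P *: f) = c * bilin_poly i f.
Proof.
rewrite /bilin_poly mulrBr !mulr_sumr; congr (_ - _).
  by apply: eq_bigr => x _; rewrite mxE hornerM hornerC mulrCA.
by apply: eq_bigr => p _; rewrite kernel_polyZ linearZ /= !hornerZ mulrBr.
Qed.

Lemma Psi0E i c : (Pp i c).[0] = Psi 0 i c.
Proof. by rewrite -(PsiE a_gt0 PsiP) // /Iadj /= in_itv /= lexx ltW ?tau0_gt0. Qed.

Lemma bilin_polyE i f : bilin a beta (fun s => row i (Psi s)) (polyfun f) = bilin_poly i f.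
Proof.
have tau_gt0 := tau0_gt0 beta a_gt0.
have oE (t : R) (A : 'M[R]_2) : - tau <= t <= 0 ->
    oint 0 t (fun z => (row i (Psi (z - t)) *m A *m polyfun f z) 0 0) =
    (prim (kernel_poly i t A f)).[t] - (prim (kernel_poly i t A f)).[0].
  move=> /andP[taut t0]; apply: oint_horner => // z /andP[tz z0].
  rewrite mxE /kernel_poly horner_sum; under eq_bigr do rewrite mxE mulr_suml.
  rewrite exchange_big /=; apply: eq_bigr => c _; rewrite horner_sum.
  apply: eq_bigr => d _; rewrite [row _ _ _ _]mxE [polyfun f z _ _]mxE.
  rewrite (PsiE a_gt0 PsiP); first by rewrite hornerZ hornerM horner_comp !hornerE /=; congr (_ * _); rewrite mulrC.
  by rewrite /Iadj /= in_itv /=; apply/andP; split; lra.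
rewrite /bilin /bilin_poly /eta_int; congr (_ - _).
  by rewrite mxE; apply: eq_bigr => c _; rewrite !mxE.
by rewrite !big_cons !big_nil /= !oE ?lexx ?andbT ?oppr_le0 ?ltW.
Qed.

Lemma kernel_poly_deriv i t A f :
  kernel_poly i t A (map_mx deriv f) =
  (kernel_poly i t A f)^`() + \sum_j Bmx i j *: kernel_poly j t A f.
Proof.
have dsum (I : finType) (F : I -> {poly R}) : (\sum_k F k)^`() = \sum_k (F k)^`() by exact: raddf_sum.
rewrite /kernel_poly dsum.
under [X in _ = _ + X]eq_bigr do rewrite scaler_sumr.
rewrite [X in _ = _ + X]exchange_big -big_split /=; apply: eq_bigr => c _.
rewrite dsum; under [X in _ = _ + X]eq_bigr do rewrite scaler_sumr.
rewrite [X in _ = _ + X]exchange_big -big_split /=; apply: eq_bigr => d _.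
rewrite derivZ derivM deriv_comp Psip_deriv derivB derivX derivC subr0 mulr1 [map_mx _ _ _ _]mxE.
have -> : (- \sum_j Bmx i j *: Pp j c) \Po ('X - t%:P) = - \sum_j Bmx i j *: (Pp j c \Po ('X - t%:P)).
  by rewrite raddfN raddf_sum; congr (- _); apply: eq_bigr => j _; exact: comp_polyZ.
have -> : \sum_j Bmx i j *: (A c d *: ((Pp j c \Po ('X - t%:P)) * f d 0)) =
    A c d *: ((\sum_j Bmx i j *: (Pp j c \Po ('X - t%:P))) * f d 0).
  rewrite mulr_suml scaler_sumr; apply: eq_bigr => j _.
  by rewrite -scalerAl !scalerA mulrC.
by rewrite mulNr scalerDr scalerN addrAC addNr add0r.
Qed.

(** Duality of the generator with B: (Psi, f' + X_0 (L f - f'(0))) = B (Psi, f). Integration by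
    parts moves the derivative onto Psi; the endpoint terms at theta add up to Psi(0) L f, and those
    at 0 to B Psi(0) f(0) by [Psi_boundary]. *)
Lemma bilin_poly_deriv i f :
  bilin_poly i (map_mx deriv f) = \sum_j Bmx i j * bilin_poly j f
  + \sum_c Psi 0 i c * ((f c 0)^`().[0] - Lop a beta (polyfun f) c 0).
Proof.
have kE j t A x : (kernel_poly j t A f).[x] = \sum_c \sum_d A c d * ((Pp j c).[x - t] * (f d 0).[x]).
  rewrite horner_sum; apply: eq_bigr => c _; rewrite horner_sum; apply: eq_bigr => d _.
  by rewrite hornerZ hornerM horner_comp !hornerE.
rewrite /bilin_poly.
have -> : \sum_(p <- eta_atoms a beta)
    ((prim (kernel_poly i p.1 p.2 (map_mx deriv f))).[p.1]
     - (prim (kernel_poly i p.1 p.2 (map_mx deriv f))).[0]) =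
  \sum_(p <- eta_atoms a beta) ((kernel_poly i p.1 p.2 f).[p.1] - (kernel_poly i p.1 p.2 f).[0])
  + \sum_j Bmx i j * \sum_(p <- eta_atoms a beta)
      ((prim (kernel_poly j p.1 p.2 f)).[p.1] - (prim (kernel_poly j p.1 p.2 f)).[0]).
  under [X in _ = _ + X]eq_bigr do rewrite mulr_sumr.
  rewrite exchange_big -big_split /=; apply: eq_bigr => p _.
  rewrite kernel_poly_deriv linearD (linear_sum (@prim R)) /= !hornerD opprD addrACA prim_deriv.
  congr (_ + _); rewrite !horner_sum -sumrB; apply: eq_bigr => j _.
  by rewrite linearZ /= !hornerZ mulrBr.
under [\sum_j Bmx i j * (_ - _)]eq_bigr do rewrite mulrBr.
rewrite [in RHS]sumrB opprD addrA [RHS]addrAC; congr (_ - _).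
have -> : \sum_(p <- eta_atoms a beta) ((kernel_poly i p.1 p.2 f).[p.1] - (kernel_poly i p.1 p.2 f).[0]) =
    \sum_c Psi 0 i c * Lop a beta (polyfun f) c 0 - \sum_j Bmx i j * \sum_c Psi 0 j c * (f c 0).[0].
  rewrite sumrB; congr (_ - _).
    under eq_bigr do rewrite kE.
    rewrite exchange_big /=; apply: eq_bigr => c _.
    rewrite /Lop /eta_int summxE mulr_sumr; apply: eq_bigr => p _.
    rewrite [(_ *m _) c 0]mxE mulr_sumr; apply: eq_bigr => d _.
    by rewrite subrr Psi0E [polyfun f _ _ _]mxE mulrCA.
  under eq_bigr do rewrite kE exchange_big /=.
  rewrite exchange_big /=.
  under [RHS]eq_bigr do rewrite mulr_sumr.
  rewrite [RHS]exchange_big /=; apply: eq_bigr => d _.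
  have := Psi_boundary a_gt0 PsiP i => /matrixP /(_ 0 d).
  rewrite summxE !mxE => bE.
  under [RHS]eq_bigr do rewrite mulrA.
  rewrite -mulr_suml -bE mulr_suml [LHS]big_seq [RHS]big_seq.
  apply: eq_bigr => p pat; rewrite [(_ *m _) 0 d]mxE mulr_suml; apply: eq_bigr => c _.
  rewrite [row _ _ _ _]mxE sub0r -(PsiE a_gt0 PsiP) ?mulrA; first by rewrite [_ * p.2 c d]mulrC.
  move: pat; rewrite !inE => /orP[/eqP->|/eqP->] /=; rewrite /Iadj /= in_itv /= ?oppr0 ?opprK lexx ?andbT ltW ?tau0_gt0 //.
rewrite opprB addrCA; congr (_ + _).
by rewrite -sumrB; apply: eq_bigr => c _; rewrite mxE mulrBr.
Qed.

End BilinearForm.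

(** * Elements of Q^1 *)

Section Basis.
Variables (R : realType) (a beta : R).
Hypothesis a_gt0 : 0 < a.
Local Notation tau := (tau0 a beta).
Variable Psi : R -> 'M[R]_(3, 2).
Hypothesis PsiP : adjoint_basis a beta Psi.
Implicit Type f : 'cV[{poly R}]_2.
Local Notation bil := (bilin_poly a beta Psi).

Definition monop n (c : 'I_2) : 'cV[{poly R}]_2 :=
  \col_d ((d == c)%:R *: (n`!%:R^-1 *: 'X^n)).

Definition phicol (j : 'I_3) : 'cV[{poly R}]_2 :=
  [:: monop 0 0; monop 1 0 + monop 0 1; monop 2 0 + monop 1 1]`_j.

Definition ell n c i : R := bil i (monop n c).

(* The component in [Q^1] of the monomial history [theta ^ n / n! e_c]. *)
Definition bpoly n c : 'cV[{poly R}]_2 :=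
  monop n c + \sum_j (- ell n c j)%:P *: phicol j.

Lemma horner_monop n c d t : (monop n c d 0).[t] = (d == c)%:R * (t ^+ n / n`!%:R).
Proof. by rewrite mxE !hornerZ hornerXn [_ / _]mulrC. Qed.

Lemma deriv_monopS n c : map_mx deriv (monop n.+1 c) = monop n c.
Proof.
apply/matrixP => d z; rewrite !mxE !derivZ derivXn; congr (_ *: _).
rewrite -[_ *+ n.+1]scaler_nat scalerA; congr (_ *: _).
by rewrite factS natrM invfM mulrAC mulVf ?mul1r // pnatr_eq0.
Qed.

Lemma deriv_monop0 c : map_mx deriv (monop 0 c) = 0.
Proof. by apply/matrixP => d z; rewrite !mxE expr0 !derivZ derivC !scaler0. Qed.

Lemma deriv_phicol j : map_mx deriv (phicol j) = \sum_k (Bmx k j)%:P *: phicol k.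
Proof.
have dD f g : map_mx deriv (f + g) = map_mx deriv f + map_mx deriv g.
  by apply/matrixP => x y; rewrite !mxE derivD.
rewrite sum_ord3; elim/ord3P: j; rewrite /phicol /= ?dD ?deriv_monopS ?deriv_monop0;
  by rewrite !mxE /= !(scale0r, scale1r, add0r, addr0).
Qed.

Lemma horner_addmx f g d t : ((f + g) d 0).[t] = (f d 0).[t] + (g d 0).[t].
Proof. by rewrite [(f + g) d 0]mxE hornerD. Qed.

Lemma horner_scalemx (c : R) f d t : ((c%:P *: f) d 0).[t] = c * (f d 0).[t].
Proof. by rewrite [(c%:P *: f) d 0]mxE hornerM hornerC. Qed.

Lemma PhiE t d j : Phi t d j = (phicol j d 0).[t].
Proof.
elim/ord3P: j; elim/ord2P: d; rewrite /phicol /= ?horner_addmx !horner_monop mxE /=;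
  rewrite ?expr0 ?expr1 ?divr1 ?mul0r ?mul1r ?add0r ?addr0 //.
Qed.

Lemma LopE f d : Lop a beta (polyfun f) d 0 = [:: (f 1 0).[0];
  - a * (f 0 0).[0] + (a * tau - beta) * (f 1 0).[0]
  + a * (f 0 0).[- tau] + beta * (f 1 0).[- tau]]`_d.
Proof.
rewrite /Lop /eta_int !big_cons big_nil addr0 /= !mxE !sum_ord2 !mxE.
by elim/ord2P: d => /=; rewrite ?(mul0r, mul1r, add0r, addr0) ?addrA.
Qed.

Lemma LopD f g d : Lop a beta (polyfun (f + g)) d 0 = Lop a beta (polyfun f) d 0 + Lop a beta (polyfun g) d 0.
Proof. by rewrite !LopE !horner_addmx; elim/ord2P: d => //=; ring. Qed.

Lemma LopZ (c : R) f d : Lop a beta (polyfun (c%:P *: f)) d 0 = c * Lop a beta (polyfun f) d 0.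
Proof.
by rewrite !LopE !horner_scalemx; elim/ord2P: d => //=; ring.
Qed.

(** P satisfies the boundary condition of the generator; for the third column this is the equation
    of [tau0]. *)
Lemma Lop_phicol j d : Lop a beta (polyfun (phicol j)) d 0 = (map_mx deriv (phicol j) d 0).[0].
Proof.
have tauE := tau0_root beta a_gt0.
rewrite LopE deriv_phicol sum_ord3.
rewrite !horner_addmx !horner_scalemx -!PhiE !mxE.
elim/ord3P: j; elim/ord2P: d => /=; rewrite ?expr0n /= ?mulr0 ?mul0r ?addr0 ?add0r ?mulr1 ?mul1r //.
- by rewrite addrC subrr.
- by rewrite mulrN; ring.
- by rewrite sqrrN mulrA tauE; field.
Qed.

Lemma bil_phicol i j : bil i (phicol j) = (i == j)%:R.
Proof.
have [_ _ _ _ /matrixP /(_ i j)] := PsiP.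
rewrite !mxE -(bilin_polyE a_gt0 PsiP) => <-; congr (bilin _ _ _ _).
apply/funext => t; apply/matrixP => d z.
by rewrite (ord1 z) [LHS]mxE -PhiE [RHS]mxE.
Qed.

Lemma bil_sum i (c : 'I_3 -> R) (g : 'I_3 -> 'cV[{poly R}]_2) :
  bil i (\sum_j (c j)%:P *: g j) = \sum_j c j * bil i (g j).
Proof. by rewrite !sum_ord3 !bilin_polyD !bilin_polyZ. Qed.

Lemma bil_bpoly i n c : bil i (bpoly n c) = 0.
Proof.
rewrite bilin_polyD bil_sum (bigD1 i) //= bil_phicol eqxx mulr1 big1 ?addr0 ?subrr // => j ji.
by rewrite bil_phicol eq_sym (negPf ji) mulr0.
Qed.

Lemma ell_phicol (j : 'I_3) : forall i,
  [:: ell 0 0 i; ell 1 0 i + ell 0 1 i; ell 2 0 i + ell 1 1 i]`_j = (i == j)%:R.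
Proof.
by move=> i; rewrite -bil_phicol; elim/ord3P: j; rewrite /phicol /= ?bilin_polyD.
Qed.

Lemma sum_delta_phicol (e : 'I_3 -> R) j : (forall i, e i = (i == j)%:R) ->
  \sum_i (- e i)%:P *: phicol i = - phicol j.
Proof.
move=> eE; rewrite (bigD1 j) //= eE eqxx big1 ?addr0 => [|i /negPf ij].
  by rewrite polyCN scaleNr scale1r.
by rewrite eE ij oppr0 scale0r.
Qed.

(** A combination of monomials forming a column of [Phi] has no component in Q^1. This and the next
    two relations make the linear part of the history drop out of v. *)
Lemma bpoly00 : bpoly 0 0 = 0.
Proof. by rewrite /bpoly (sum_delta_phicol (j := 0)) ?subrr // => i; exact: (ell_phicol 0). Qed.

Let bpolyD n c m d j : monop n c + monop m d = phicol j ->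
  (forall i, ell n c i + ell m d i = (i == j)%:R) -> bpoly n c + bpoly m d = 0.
Proof.
move=> mE eE; rewrite /bpoly addrACA mE -big_split /=.
under eq_bigr do rewrite -scalerDl -polyCD -opprD.
by rewrite (sum_delta_phicol eE) subrr.
Qed.

Lemma bpoly10 : bpoly 1 0 + bpoly 0 1 = 0.
Proof. by apply: (@bpolyD _ _ _ _ 1) => // i; exact: (ell_phicol 1). Qed.

Lemma bpoly20 : bpoly 2 0 + bpoly 1 1 = 0.
Proof. by apply: (@bpolyD _ _ _ _ 2%:R) => // i; exact: (ell_phicol 2%:R). Qed.

Lemma ell_rec n c i : ell n c i = \sum_j Bmx i j * ell n.+1 c j
  + \sum_d Psi 0 i d * ((n == 0%N)%:R * (d == c)%:R - Lop a beta (polyfun (monop n.+1 c)) d 0).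
Proof.
rewrite /ell -{1}deriv_monopS (bilin_poly_deriv a_gt0 PsiP); congr (_ + _).
apply: eq_bigr => d _; congr (_ * (_ - _)).
have -> : (monop n.+1 c d 0)^`() = monop n c d 0 by rewrite -(deriv_monopS n c) [RHS]mxE.
rewrite horner_monop mulrC expr0n; case: n => [|n] /=; first by rewrite divr1.
by rewrite mul0r mul0r.
Qed.

Lemma ell_rec0 c i :
  \sum_j Bmx i j * ell 0 c j = \sum_d Psi 0 i d * Lop a beta (polyfun (monop 0 c)) d 0.
Proof.
have := bilin_poly_deriv a_gt0 PsiP i (monop 0 c); rewrite deriv_monop0.
have -> : bil i 0 = 0 by have := bilin_polyZ a beta Psi i 0 0; rewrite scaler0 mul0r.
move=> /esym /(canRL (addrK _)); rewrite sub0r => ->; rewrite -sumrN.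
apply: eq_bigr => d _.
have -> : (monop 0 c d 0)^`() = 0.
  by have := deriv_monop0 c => /matrixP /(_ d 0); rewrite [LHS]mxE [RHS]mxE.
by rewrite horner0 sub0r mulrN opprK.
Qed.

End Basis.

(** * Invariance defects *)

Section Relations.
Variables (R : realType) (a beta : R) (Psi : R -> 'M[R]_(3, 2)).
Local Notation tau := (tau0 a beta).
Local Notation P := (mpoly 3 R).
Local Notation X i := (mpolyX R (mnm1 (i : 'I_3))).
Local Notation ge := (wge mdeg).
Variables (w : P) (F G : mpoly 2 R) (I : finType) (b : I -> 'cV[{poly R}]_2).
Local Notation Dw := (vder (vfield w)).

Definition history (phi : 'I_3 -> P) (h : I -> P) (t : R) (d : 'I_2) : P :=
  \sum_j (phicol R j d 0).[t] *: phi j + \sum_i (b i d 0).[t] *: h i.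

Definition nonlin phi h : P :=
  msubst (pair2 (history phi h 0 0) (history phi h 0 1)) F
  + msubst (pair2 (history phi h (- tau) 0) (history phi h (- tau) 1)) G.

(* Failure of the graph [u |-> (phi u, h u)] to be invariant with induced field
   [vfield w]: the [P]-component, the [Q^1]-component at [theta = t], and the
   boundary condition at [theta = 0] (the [X_0]-component). *)
Definition defect_u phi h i : P :=
  Dw (phi i) - \sum_j Bmx i j *: phi j - Psi 0 i 1 *: nonlin phi h.

Definition defect_v phi h t d : P :=
  \sum_i (b i d 0)^`().[t] *: h i
  - (\sum_j (phicol R j d 0).[t] * Psi 0 j 1) *: nonlin phi h
  - \sum_i (b i d 0).[t] *: Dw (h i).

Definition defect_0 (phi : 'I_3 -> P) h (d : 'I_2) : P :=
  \sum_i (Lop a beta (polyfun (b i)) d 0 - (b i d 0)^`().[0]) *: h i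
  + (d == 1)%:R *: nonlin phi h.

Lemma pair2P (Q : P -> Prop) p q i : Q p -> Q q -> Q (pair2 p q i).
Proof. by move=> Qp Qq; elim/ord2P: i. Qed.

Lemma sumrZB (T : finType) (c : T -> R) (f g : T -> P) :
  \sum_i c i *: (f i - g i) = \sum_i c i *: f i - \sum_i c i *: g i.
Proof. by rewrite -sumrB; apply: eq_bigr => i _; rewrite scalerBr. Qed.

Lemma sub3E (x x' y y' z z' : P) :
  x' - y' - z' = x - y - z - ((x - x') - (y - y') - (z - z')).
Proof. by ring. Qed.

Section Transfer.
Variables (l : nat) (phi phi' : 'I_3 -> P) (h h' : I -> P).
Hypotheses (w2 : ge 2 w) (F2 : ge 2 F) (G2 : ge 2 G).
Hypotheses (phi2 : forall i, ge 2 (phi i - X i)) (h2 : forall i, ge 2 (h i))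
  (phi'2 : forall i, ge 2 (phi' i - X i)) (h'2 : forall i, ge 2 (h' i)).
Hypotheses (dphi : forall i, ge l.+1 (phi i - phi' i))
  (dh : forall i, ge l.+1 (h i - h' i)).

Lemma wge1_near_id (p : P) i : ge 2 (p - X i) -> ge 1 p.
Proof.
move=> p2; rewrite -(subrK (X i) p); apply: wgeD; first exact: wgeW p2.
by have := @wgeXU 3 R mdeg i; rewrite /= mdeg1.
Qed.

Lemma history1 f k t d : (forall i, ge 2 (f i - X i)) -> (forall i, ge 2 (k i)) ->
  ge 1 (history f k t d).
Proof.
move=> f2 k2; apply: wgeD; apply: wge_sum => i _; apply: wgeZ.
  exact: wge1_near_id (f2 i).
exact: wgeW (k2 i).
Qed.

Lemma history_sub t d : ge l.+1 (history phi h t d - history phi' h' t d).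
Proof.
rewrite /history opprD addrACA -!sumrB; apply: wgeD; apply: wge_sum => i _;
  by rewrite -scalerBr; apply: wgeZ.
Qed.

Lemma nonlin_sub : ge l.+1 (nonlin phi h - nonlin phi' h').
Proof.
rewrite /nonlin opprD addrACA.
have sub (H : mpoly 2 R) t : ge 2 H ->
  ge l.+1 (msubst (pair2 (history phi h t 0) (history phi h t 1)) H
         - msubst (pair2 (history phi' h' t 0) (history phi' h' t 1)) H).
  move=> H2; apply: (@wgeW _ _ _ _ (1 + l.+1)); first exact: leq_addl.
  apply: wge_msubst_sub => // i.
  - by apply: (@pair2P (wge mdeg 1)); exact: history1.
  - by apply: (@pair2P (wge mdeg 1)); exact: history1.
  - by elim/ord2P: i; exact: history_sub.
by apply: wgeD; exact: sub.
Qed.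

(** Up to order l the defects depend only on the jets of [phi] and [h]. This serves to replace the
    projected history by the composite of the changes of variables. *)
Lemma defect_u_sub i : ge l.+1 (defect_u phi h i) -> ge l.+1 (defect_u phi' h' i).
Proof.
move=> du.
have -> : defect_u phi' h' i = defect_u phi h i - (Dw (phi i - phi' i)
    - \sum_j Bmx i j *: (phi j - phi' j) - Psi 0 i 1 *: (nonlin phi h - nonlin phi' h')).
  rewrite /defect_u sumrZB scalerBr (raddfB (vder (vfield w))); exact: sub3E.
apply: wgeB => //; apply: wgeB; first apply: wgeB.
- exact: wge_vder_vfield.
- by apply: wge_sum => j _; exact: wgeZ.
- by apply: wgeZ; exact: nonlin_sub.
Qed.

Lemma defect_v_sub t d : ge l.+1 (defect_v phi h t d) -> ge l.+1 (defect_v phi' h' t d).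
Proof.
move=> du.
have -> : defect_v phi' h' t d = defect_v phi h t d - (\sum_i (b i d 0)^`().[t] *: (h i - h' i)
    - (\sum_j (phicol R j d 0).[t] * Psi 0 j 1) *: (nonlin phi h - nonlin phi' h')
    - \sum_i (b i d 0).[t] *: Dw (h i - h' i)).
  under [\sum_i (b i d 0).[t] *: Dw (h i - h' i)]eq_bigr do rewrite (raddfB (vder (vfield w))).
  by rewrite /defect_v !sumrZB scalerBr; exact: sub3E.
apply: wgeB => //; apply: wgeB; first apply: wgeB.
- by apply: wge_sum => j _; exact: wgeZ.
- by apply: wgeZ; exact: nonlin_sub.
- by apply: wge_sum => j _; apply: wgeZ; exact: wge_vder_vfield.
Qed.

Lemma defect_0_sub d : ge l.+1 (defect_0 phi h d) -> ge l.+1 (defect_0 phi' h' d).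
Proof.
move=> du.
have -> : defect_0 phi' h' d = defect_0 phi h d -
    (\sum_i (Lop a beta (polyfun (b i)) d 0 - (b i d 0)^`().[0]) *: (h i - h' i)
     + (d == 1)%:R *: (nonlin phi h - nonlin phi' h')).
  by rewrite /defect_0 sumrZB scalerBr opprD !opprB addrACA !subrKC.
apply: wgeB => //; apply: wgeD.
- by apply: wge_sum => j _; exact: wgeZ.
- by apply: wgeZ; exact: nonlin_sub.
Qed.

End Transfer.
End Relations.

(** Grouped by x_m, the coefficients of x_0, x_1, x_2 are g0 0, g1 0 + g0 1 and g1 1 + g0 2: the
    three relations among the [bpoly], with x_m = D_B^m u_1. *)
Lemma sum_jordan3 (K : comNzRingType) (V : lmodType K) (g0 g1 : nat -> K)
    (x : nat -> V) n :
  (forall m, x m.+3 = 0) -> g0 0%N = 0 -> g1 0%N = - g0 1%N -> g1 1%N = - g0 2%N ->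
  \sum_(m < n.+3) (g0 m *: x m + g1 m *: x m.+1) = 0.
Proof.
move=> x3 e0 e1 e2.
rewrite -(big_mkord xpredT (fun m => g0 m *: x m + g1 m *: x m.+1)).
rewrite 3?big_nat_recl // big1 => [|m _]; last by rewrite !x3 !scaler0 addr0.
rewrite x3 e0 e1 e2 scale0r add0r scaler0 !addr0.
by rewrite !scaleNr -!addrA addKr addNr.
Qed.

(** Summation by parts shaped after [ell_rec]: the terms in [c] telescope, and the last term is the
    truncation error of the exponential. *)
Lemma sum_shift_rec (K : comNzRingType) k (e c L : nat -> K)
    (x : nat -> mpoly k K) (p : K) n :
  (0 < n)%N -> (forall m, e m = c m.+1 + ((m == 0%N)%:R * p - L m.+1)) -> c 0%N = L 0%N ->
  \sum_(m < n.+1) e m *: x m.+1 - \sum_(m < n.+1) c m *: x m =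
  p *: x 1%N - \sum_(m < n.+1) L m *: x m + e n *: x n.+1.
Proof.
case: n => // n _ eE c0; elim: n => [|n IH].
  rewrite !big_ord_recr !big_ord0 /= !add0r c0 (eE 0%N) mul1r -!mul_mpolyC !rmorphD !rmorphN /=.
  by ring.
rewrite big_ord_recr [\sum_(m < n.+3) c m *: x m]big_ord_recr
  [\sum_(m < n.+3) L m *: x m]big_ord_recr /= opprD addrACA IH (eE n.+1) mul0r add0r.
rewrite -!mul_mpolyC !rmorphD !rmorphN /=.
move: (\sum_(i < _) _) (mpolyC k (L n.+2)) (mpolyC k (c n.+2)) => S l c'.
by ring.
Qed.

(** * The invariant history and its projections *)

Section CenterManifold.
Variables (R : realType) (a beta : R) (Psi : R -> 'M[R]_(3, 2)).
Local Notation tau := (tau0 a beta).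
Local Notation P := (mpoly 3 R).
Local Notation Xv i := (mpolyX R (mnm1 (i : 'I_3))).
Local Notation ge := (wge mdeg).
Hypothesis a_gt0 : 0 < a.
Hypothesis PsiP : adjoint_basis a beta Psi.
Variables (l : nat) (w k : P) (F G : mpoly 2 R).
Hypotheses (l_gt0 : (0 < l)%N) (w2 : ge 2 w) (k2 : ge 2 (k - Xv 0)).
Local Notation Dw := (vder (vfield w)).
Local Notation D0 := (vder (vfield 0)).
Local Notation N := (5 * l).+1.
Local Notation ell := (ell a beta Psi).
Local Notation bpoly := (bpoly a beta Psi).
Local Notation E := (expop N Dw (- tau)).
Hypothesis res : ge l.+1 (charop N Dw a beta tau k - msubst (pair2 k (Dw k)) F
            - msubst (pair2 (E k) (E (Dw k))) G).
Implicit Type f : 'cV[{poly R}]_2.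

(* Coefficients of the invariant history [theta |-> exp (theta Dw) (k, Dw k)] on
   the monomial histories. *)
Definition cm_coef (n : nat) (c : 'I_2) : P := iter n Dw (pair2 k (Dw k) c).
Local Notation kc := cm_coef.
Local Notation I := ('I_N * 'I_2)%type.

(** The coordinates (Psi, history) of the projection to P. *)
Definition cm_phi (j : 'I_3) : P := \sum_(i : I) ell i.1 i.2 j *: kc i.1 i.2.
(** Near-identity changes need coefficients of order 2. Dropping the linear parts does not alter the
    Q^1 component, by [sum_lin_part]. *)
Definition cm_h (i : I) : P := kc i.1 i.2 - pihomog mdeg 1 (kc i.1 i.2).
Definition cm_basis (i : I) := bpoly i.1 i.2.

Lemma sum_pair (V : nmodType) (f : nat -> 'I_2 -> V) :
  \sum_(i : I) f i.1 i.2 = \sum_(n < N) (f n 0 + f n 1).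
Proof.
rewrite -(pair_bigA _ (fun (n : 'I_N) c => f n c)) /=.
by apply: eq_bigr => n _; rewrite sum_ord2.
Qed.

Lemma sum_pair2 (V : nmodType) (f : nat -> 'I_2 -> V) :
  \sum_(i : I) f i.1 i.2 = \sum_c \sum_(n < N) f n c.
Proof. by rewrite exchange_big -(pair_bigA _ (fun (n : 'I_N) c => f n c)). Qed.

Lemma cm_coefE n c : kc n c = iter (n + c) Dw k.
Proof. by elim/ord2P: c; rewrite /kc /pair2 /= ?addn0 // addn1 iterSr. Qed.

Lemma k1 : ge 1 k.
Proof. exact: wge1_near_id k2. Qed.

Lemma pihomog_wge (d : nat) (p : P) : ge d.+1 p -> pihomog mdeg d p = 0.
Proof.
move=> pd; apply/mpolyP => m; rewrite mcoeff_pihomog mcoeff0; case: eqP => // mE.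
by move/wgeP: pd; apply; rewrite /= in mE *; rewrite mE.
Qed.

Lemma cm_coef_lin n c : pihomog mdeg 1 (kc n c) = iter (n + c) D0 (Xv 0).
Proof.
have := @wge_iter_sub _ _ w2 (n + c) 1 k (Xv 0) k1 k2.
rewrite -cm_coefE => /pihomog_wge; rewrite raddfB /= => /eqP; rewrite subr_eq0 => /eqP ->.
by apply: pihomog_dE; elim: (n + c)%N => [|m IH]; [exact: homog_X|rewrite iterS; exact: homog_D].
Qed.

Lemma cm_h2 i : ge 2 (cm_h i).
Proof.
apply: wge_sub_pihomog; rewrite cm_coefE; apply: wge_iter_vfield => //; exact: k1.
Qed.

Section Functional.
Variable nu : 'cV[{poly R}]_2 -> R.
Hypotheses (nuD : forall f g, nu (f + g) = nu f + nu g)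
  (nuZ : forall c f, nu (c%:P *: f) = c * nu f).

Lemma nu0 : nu 0 = 0.
Proof. by have := nuZ 0 0; rewrite scaler0 mul0r. Qed.

Lemma sum_lin_part : \sum_(i : I) nu (cm_basis i) *: pihomog mdeg 1 (kc i.1 i.2) = 0.
Proof.
rewrite (sum_pair (fun n c => nu (bpoly n c) *: pihomog mdeg 1 (kc n c))).
have D0_3 m : iter m.+3 D0 (Xv 0) = 0 by have [_] := D0X R m.
have n00 : nu (bpoly 0 0) = 0 by rewrite bpoly00 ?nu0.
have n01 : nu (bpoly 0 1) = - nu (bpoly 1 0).
  by apply/eqP; rewrite -addr_eq0 -nuD addrC bpoly10 ?nu0.
have n11 : nu (bpoly 1 1) = - nu (bpoly 2 0).
  by apply/eqP; rewrite -addr_eq0 -nuD addrC bpoly20 ?nu0.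
have [N' NE] : exists N', N = N'.+3 by exists (5 * l - 2)%N; lia.
rewrite NE -[RHS](@sum_jordan3 _ _ (fun n => nu (bpoly n 0)) (fun n => nu (bpoly n 1))
  (fun m => iter m D0 (Xv 0)) N' D0_3 n00 n01 n11); apply: eq_bigr => n _.
by rewrite !cm_coef_lin addn0 addn1.
Qed.

(** This is v = history - Phi phi tested against a linear functional: evaluation, derivative at
    theta, or boundary condition. *)
Lemma sum_basis : \sum_(i : I) nu (cm_basis i) *: cm_h i =
  \sum_(i : I) nu (monop R i.1 i.2) *: kc i.1 i.2 - \sum_j nu (phicol R j) *: cm_phi j.
Proof.
rewrite /cm_h; under eq_bigr do rewrite scalerBr.
rewrite sumrB sum_lin_part subr0.
have -> : \sum_j nu (phicol R j) *: cm_phi j =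
    \sum_(i : I) \sum_j nu (phicol R j) *: (ell i.1 i.2 j *: kc i.1 i.2).
  by rewrite exchange_big; apply: eq_bigr => j _; rewrite scaler_sumr.
rewrite -sumrB; apply: eq_bigr => i _.
rewrite /cm_basis /bpoly nuD scalerDl; congr (_ + _).
have -> : nu (\sum_j (- ell i.1 i.2 j)%:P *: phicol R j) =
    - \sum_j ell i.1 i.2 j * nu (phicol R j).
  by rewrite (big_morph nu nuD nu0) -sumrN; apply: eq_bigr => j _; rewrite nuZ mulNr.
rewrite scaleNr scaler_suml; congr (- _); apply: eq_bigr => j _.
by rewrite scalerA mulrC.
Qed.

End Functional.

Definition cm_eval t d : P := \sum_(i : I) (monop R i.1 i.2 d 0).[t] *: kc i.1 i.2.
Definition cm_deriv t d : P := \sum_(i : I) (monop R i.1 i.2 d 0)^`().[t] *: kc i.1 i.2.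

Lemma cm_evalE t d : cm_eval t d = expop N Dw t (pair2 k (Dw k) d).
Proof.
rewrite /cm_eval (sum_pair (fun n c => (monop R n c d 0).[t] *: kc n c)).
apply: eq_bigr => n _; rewrite !horner_monop.
by elim/ord2P: d; rewrite /= !(mul0r, mul1r, scale0r, addr0, add0r).
Qed.

Lemma expop0 (p : P) : expop N Dw 0 p = p.
Proof.
rewrite /expop big_ord_recl /= expr0 divr1 scale1r big1 ?addr0 // => i _.
by rewrite expr0n mul0r scale0r.
Qed.

Lemma deriv_monopE n c d t :
  (monop R n c d 0)^`().[t] = if n is n'.+1 then (monop R n' c d 0).[t] else 0.
Proof.
case: n => [|n].
  by have /matrixP /(_ d 0) := deriv_monop0 R c; rewrite [LHS]mxE [RHS]mxE => ->; rewrite horner0.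
by have /matrixP /(_ d 0) := deriv_monopS R n c; rewrite [LHS]mxE => ->.
Qed.

Lemma cm_derivE t d : cm_deriv t d = \sum_(n < 5 * l) (t ^+ n / n`!%:R) *: kc n.+1 d.
Proof.
rewrite /cm_deriv (sum_pair (fun n c => (monop R n c d 0)^`().[t] *: kc n c)).
rewrite big_ord_recl !deriv_monopE !scale0r add0r add0r; apply: eq_bigr => n _.
rewrite lift0 !deriv_monopE !horner_monop.
by elim/ord2P: d; rewrite /= !(mul0r, mul1r, scale0r, addr0, add0r).
Qed.

(** For the truncated exponential d/dtheta and D differ by the last term alone, which contains D^(5
    l + 1). *)
Lemma cm_deriv_flow t d : ge l.+1 (cm_deriv t d - Dw (cm_eval t d)).
Proof.
have -> : Dw (cm_eval t d) = \sum_(n < N) (t ^+ n / n`!%:R) *: kc n.+1 d.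
  by rewrite cm_evalE /expop (raddf_sum Dw); apply: eq_bigr => n _; rewrite /= linearZ.
rewrite cm_derivE big_ord_recr opprD addrA subrr sub0r; apply: wgeN; apply: wgeZ.
exact: nilpotent_vfield.
Qed.

Lemma cm_deriv0 d : cm_deriv 0 d = kc 1 d.
Proof.
rewrite cm_derivE; have [N' ->] : exists N', (5 * l)%N = N'.+1 by exists (5 * l - 1)%N; lia.
rewrite big_ord_recl big1 => [|n _]; last by rewrite lift0 expr0n mul0r scale0r.
by rewrite expr0 divr1 scale1r addr0.
Qed.

Lemma history_cm t d : history cm_basis cm_phi cm_h t d = cm_eval t d.
Proof.
rewrite /history (@sum_basis (fun f => (f d 0).[t])) ?subrKC //.
  by move=> f g; rewrite horner_addmx.
by move=> c f; rewrite horner_scalemx.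
Qed.

Local Notation NL := (msubst (pair2 k (Dw k)) F + msubst (pair2 (E k) (E (Dw k))) G).

Lemma nonlin_cm : nonlin a beta F G cm_basis cm_phi cm_h = NL.
Proof. by rewrite /nonlin !history_cm !cm_evalE /= !expop0. Qed.

Definition cm_resid d : P := kc 1 d - \sum_(i : I) Lop a beta (polyfun (monop R i.1 i.2)) d 0 *: kc i.1 i.2.

(** The equation x' = y holds identically because the history starts from (k, D k); the other one
    leaves Lambda(D) k. *)
Lemma cm_residE d : cm_resid d = (d == 1)%:R *: charop N Dw a beta tau k.
Proof.
have ev t c : \sum_(i : I) (monop R i.1 i.2 c 0).[t] *: kc i.1 i.2 = expop N Dw t (pair2 k (Dw k) c).
  exact: cm_evalE.
rewrite /cm_resid; elim/ord2P: d.
  under eq_bigr do rewrite LopE /=.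
  by rewrite ev expop0 /= scale0r subrr.
under eq_bigr do rewrite LopE /= !scalerDl -!scalerA.
rewrite !big_split /= -!scaler_sumr !ev !expop0 /= scale1r /charop -!mul_mpolyC.
have alg (e1 e2 d2 d1 : P) : d2 - (mpolyC 3 (- a) * k + mpolyC 3 (a * tau - beta) * d1 +
    mpolyC 3 a * e1 + mpolyC 3 beta * e2) =
  d2 + mpolyC 3 a * (k - e1) - mpolyC 3 (a * tau) * d1 + mpolyC 3 beta * (d1 - e2).
  by ring.
exact: alg.
Qed.

Lemma cm_resid_wge d : ge l.+1 (cm_resid d - (d == 1)%:R *: NL).
Proof. by rewrite cm_residE -scalerBr opprD addrA; apply: wgeZ. Qed.

Lemma defect_0_cm d : ge l.+1 (defect_0 a beta F G cm_basis cm_phi cm_h d).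
Proof.
rewrite /defect_0 nonlin_cm.
rewrite (@sum_basis (fun f => Lop a beta (polyfun f) d 0 - (f d 0)^`().[0])).
- rewrite [X in _ - X]big1 ?subr0 => [|j _]; last first.
    rewrite Lop_phicol // [(map_mx _ _) d 0]mxE subrr scale0r //.
  under eq_bigr do rewrite scalerBl.
  rewrite sumrB -/(cm_deriv 0 d) cm_deriv0 -opprB -/(cm_resid d).
  rewrite addrC -opprB; apply: wgeN; exact: cm_resid_wge.
- move=> f g; rewrite LopD [(f + g) d 0]mxE derivD hornerD opprD addrACA //.
- by move=> c f; rewrite LopZ [(c%:P *: f) d 0]mxE mul_polyC derivZ hornerZ mulrBr.
Qed.

(** The recursion for [ell] turns D phi - B phi into Psi(0) times the linear residual of the delay
    equation, plus terms in D^(5 l + 1). *)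
Lemma defect_u_cm i : ge l.+1 (defect_u a beta Psi w F G cm_basis cm_phi cm_h i).
Proof.
have kcS n c : Dw (kc n c) = kc n.+1 c by [].
have phiE : Dw (cm_phi i) - \sum_j Bmx i j *: cm_phi j =
    \sum_d Psi 0 i d *: cm_resid d + (ell (5 * l) 0 i *: kc N 0 + ell (5 * l) 1 i *: kc N 1).
  pose L n c := \sum_d Psi 0 i d * Lop a beta (polyfun (monop R n c)) d 0.
  pose B n c := \sum_j Bmx i j * ell n c j.
  have -> : Dw (cm_phi i) = \sum_c \sum_(n < N) ell n c i *: kc n.+1 c.
    rewrite /cm_phi (sum_pair2 (fun n c => ell n c i *: kc n c)) (raddf_sum Dw).
    apply: eq_bigr => c _; rewrite (raddf_sum Dw); apply: eq_bigr => n _.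
    by rewrite /= linearZ.
  have -> : \sum_j Bmx i j *: cm_phi j = \sum_c \sum_(n < N) B n c *: kc n c.
    rewrite -(sum_pair2 (fun n c => B n c *: kc n c)).
    under eq_bigr do rewrite scaler_sumr.
    rewrite exchange_big; apply: eq_bigr => x _; rewrite scaler_suml.
    by apply: eq_bigr => j _; rewrite scalerA.
  have -> : \sum_d Psi 0 i d *: cm_resid d =
      \sum_c (Psi 0 i c *: kc 1 c - \sum_(n < N) L n c *: kc n c).
    rewrite /cm_resid; under eq_bigr do rewrite scalerBr.
    rewrite !sumrB; congr (_ - _); under eq_bigr do rewrite scaler_sumr.
    transitivity (\sum_(i : I) L i.1 i.2 *: kc i.1 i.2); last first.
      by rewrite (sum_pair2 (fun n c => L n c *: kc n c)).
    rewrite exchange_big; apply: eq_bigr => x _; rewrite scaler_suml.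
    by apply: eq_bigr => j _; rewrite scalerA.
  rewrite -sumrB -(sum_ord2 (fun c => ell (5 * l) c i *: kc N c)) -big_split.
  apply: eq_bigr => c _.
  apply: (@sum_shift_rec _ _ (fun n => ell n c i) (fun n => B n c) (fun n => L n c)
    (fun n => kc n c)) => [|n|]; first by lia.
    rewrite -/(B n.+1 c); rewrite (ell_rec a_gt0 PsiP); congr (_ + _).
    under eq_bigr do rewrite mulrBr.
    rewrite sumrB; congr (_ - _); rewrite (bigD1 c) //= eqxx mulr1 mulrC big1 ?addr0 //.
    by move=> d /negPf->; rewrite !mulr0.
  exact: (ell_rec0 a_gt0 PsiP).
rewrite /defect_u nonlin_cm phiE.
have -> : Psi 0 i 1 *: NL = \sum_d Psi 0 i d *: ((d == 1)%:R *: NL).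
  by rewrite sum_ord2 /= scale0r scaler0 add0r scale1r.
rewrite addrAC -sumrB; apply: wgeD.
  by apply: wge_sum => d _; rewrite -scalerBr; apply: wgeZ; exact: cm_resid_wge.
by apply: wgeD; apply: wgeZ; exact: nilpotent_vfield.
Qed.

(** With v = history - Phi phi and Phi' = Phi B, the defect is (d/dtheta - D) of the history plus
    Phi times the defect in u. *)
Lemma defect_v_cm t d : ge l.+1 (defect_v a beta Psi w F G cm_basis cm_phi cm_h t d).
Proof.
pose NLc := nonlin a beta F G cm_basis cm_phi cm_h.
have e1 : \sum_i (cm_basis i d 0)^`().[t] *: cm_h i =
    cm_deriv t d - \sum_j (phicol R j d 0).[t] *: \sum_m Bmx j m *: cm_phi m.
  rewrite (@sum_basis (fun f => (f d 0)^`().[t])).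
  - congr (_ - _); under [RHS]eq_bigr do rewrite scaler_sumr.
    rewrite exchange_big; apply: eq_bigr => j _.
    have /matrixP /(_ d 0) := deriv_phicol R j; rewrite [LHS]mxE => ->.
    rewrite sum_ord3 !horner_addmx !horner_scalemx sum_ord3 !scalerDl !scalerA.
    by congr (_ *: _ + _ *: _ + _ *: _); rewrite mulrC.
  - by move=> f g; rewrite [(f + g) d 0]mxE derivD hornerD.
  - by move=> c f; rewrite [(c%:P *: f) d 0]mxE mul_polyC derivZ hornerZ.
have e2 : \sum_i (cm_basis i d 0).[t] *: Dw (cm_h i) =
    Dw (cm_eval t d) - \sum_j (phicol R j d 0).[t] *: Dw (cm_phi j).
  transitivity (Dw (\sum_i (cm_basis i d 0).[t] *: cm_h i)).
    by rewrite (raddf_sum Dw); apply: eq_bigr => i _; rewrite /= linearZ.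
  rewrite (@sum_basis (fun f => (f d 0).[t])).
  - rewrite (raddfB Dw) -/(cm_eval t d); congr (_ - _).
    by rewrite (raddf_sum Dw); apply: eq_bigr => j _; rewrite /= linearZ.
  - by move=> f g; rewrite horner_addmx.
  - by move=> c f; rewrite horner_scalemx.
have vE : defect_v a beta Psi w F G cm_basis cm_phi cm_h t d =
    (cm_deriv t d - Dw (cm_eval t d)) +
    \sum_j (phicol R j d 0).[t] *: defect_u a beta Psi w F G cm_basis cm_phi cm_h j.
  rewrite /defect_v e1 e2 -/NLc.
  have -> : \sum_j (phicol R j d 0).[t] *: defect_u a beta Psi w F G cm_basis cm_phi cm_h j =
      \sum_j (phicol R j d 0).[t] *: Dw (cm_phi j)
      - \sum_j (phicol R j d 0).[t] *: \sum_m Bmx j m *: cm_phi m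
      - (\sum_j (phicol R j d 0).[t] * Psi 0 j 1) *: NLc.
    rewrite scaler_suml -!sumrB; apply: eq_bigr => j _.
    by rewrite /defect_u !scalerBr scalerA.
  have alg (x y p q r : P) : x - p - r - (y - q) = (x - y) + (q - p - r) by ring.
  exact: alg.
rewrite vE; apply: wgeD; first exact: cm_deriv_flow.
by apply: wge_sum => j _; apply: wgeZ; exact: defect_u_cm.
Qed.

(** The linear part of the history is Phi(theta) u, and (Psi, Phi) = I. *)
Lemma cm_phi2 j : ge 2 (cm_phi j - Xv j).
Proof.
have phi1 : ge 1 (cm_phi j).
  apply: wge_sum => i _; apply: wgeZ; rewrite cm_coefE.
  by apply: wge_iter_vfield => //; exact: k1.
suff <- : pihomog mdeg 1 (cm_phi j) = Xv j by exact: wge_sub_pihomog.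
have linE n c : pihomog mdeg 1 (kc n c) = iter (n + c) D0 (Xv 0) by exact: cm_coef_lin.
rewrite /cm_phi raddf_sum /=.
under eq_bigr do rewrite linearZ /= linE.
rewrite (sum_pair (fun n c => ell n c j *: iter (n + c) D0 (Xv 0))).
have [N' ->] : exists N', N = N'.+3 by exists (5 * l - 2)%N; lia.
have D0_3 m : iter m.+3 D0 (Xv 0) = 0 by have [_] := D0X R m.
under eq_bigr do rewrite addn0 addn1.
rewrite -(big_mkord xpredT (fun m => ell m 0 j *: iter m D0 (Xv 0) + ell m 1 j *: iter m.+1 D0 (Xv 0))).
rewrite 3?big_nat_recl // big1 => [|m _]; last by rewrite !D0_3 !scaler0 addr0.
rewrite D0_3 scaler0 !addr0.
have D0_1 : iter 1 D0 (Xv 0) = Xv 1 by rewrite /iter vderX0.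
have D0_2 : iter 2 D0 (Xv 0) = Xv 2%:R by rewrite /iter vderX0 vderX1.
rewrite D0_1 D0_2 -[iter 0 _ _]/(Xv 0).
have /= e0 := ell_phicol a_gt0 PsiP 0 j.
have /= e1 := ell_phicol a_gt0 PsiP 1 j.
have /= e2 := ell_phicol a_gt0 PsiP 2%:R j.
have alg (x y z : P) (c0 c1 d0 d1 e : R) : c0 *: x + c1 *: y + (d0 *: y + d1 *: z + e *: z)
    = c0 *: x + (d0 + c1) *: y + (e + d1) *: z.
  by rewrite !scalerDl -!mul_mpolyC; ring.
rewrite alg e0 e1 e2; clear.
by elim/ord3P: j; rewrite /= !(scale0r, scale1r, addr0, add0r).
Qed.

End CenterManifold.

(** * Polynomial maps *)

Section Curve.
Variables (n : nat) (R : fieldType).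
Local Notation ge := (wge mdeg).

Definition curve (c : 'I_n -> {poly R}) : mpoly n R -> {poly R} := mmap polyC c.
HB.instance Definition _ c := GRing.RMorphism.copy (curve c) (mmap polyC c).

Lemma curveC c x : curve c (mpolyC n x) = x%:P.
Proof. exact: mmapC. Qed.
Lemma curveX c i : curve c (mpolyX R (mnm1 i)) = c i.
Proof. by rewrite /curve mmapX mmap1U. Qed.
Lemma curveZ c x p : curve c (x *: p) = x *: curve c p.
Proof. by rewrite -mul_mpolyC rmorphM /= curveC mul_polyC. Qed.

Lemma horner_curve c p t : (curve c p).[t] = meval (fun i => (c i).[t]) p.
Proof.
elim/mpoly_alg_ind: p => [x|j|p1 p2 IH1 IH2|p1 p2 IH1 IH2].
- by rewrite curveC mevalC hornerC.
- by rewrite curveX mevalXU.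
- by rewrite !rmorphD /= hornerD IH1 IH2.
- by rewrite !rmorphM /= hornerM IH1 IH2.
Qed.

Lemma dvdp_curve N c p : (forall i, 'X %| c i) -> ge N p -> 'X^N %| curve c p.
Proof.
move=> Xc pN; rewrite /curve /mmap big_seq; apply: (big_ind (fun q => 'X^N %| q)).
- exact: dvdp0.
- by move=> x y; exact: dvdp_add.
move=> m /pN /= le_Nm; apply: dvdp_mull; apply: (dvdp_trans (dvdp_exp2l _ le_Nm)).
rewrite mdegE /mmap1; elim/big_rec2: _ => [|i d p' _ p'd].
  by rewrite expr0 dvd1p.
by rewrite exprD; apply: dvdp_mul => //; exact: dvdp_exp2r.
Qed.

End Curve.

Section PolynomialMaps.
Variable R : realType.
Local Notation P := (mpoly 3 R).
Local Notation Xv i := (mpolyX R (mnm1 (i : 'I_3))).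

Definition peval (p : P) (u : 'cV[R]_3) : R := meval (fun i => u i 0) p.
(** The coefficient of t^j is the value at [u] of the degree-j part, which is how homogeneous terms
    are read off. *)
Definition along (u : 'cV[R]_3) : P -> {poly R} := curve (fun i => (u i 0) *: 'X).
HB.instance Definition _ u := GRing.RMorphism.copy (along u) (curve (fun i => (u i 0) *: 'X)).

Lemma horner_along u p t : (along u p).[t] = peval p (t *: u).
Proof.
by rewrite horner_curve /peval; apply: meval_eq => i; rewrite hornerZ hornerX mxE mulrC.
Qed.

Lemma is_derive_coord (u v : 'cV[R]_3) i :
  is_derive u v (fun x : 'cV[R]_3 => x i 0 : R^o) (v i 0).
Proof.
have e : (fun h : R => h^-1 *: (((h *: v + u) i 0 : R^o) - u i 0)) @ 0^' --> (v i 0 : R^o).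
  apply: cvg_near_cst; near=> h.
  by rewrite !mxE addrK /GRing.scale /= mulKf //; near: h; exact: nbhs_dnbhs_neq.
apply: DeriveDef; first by apply/cvg_ex; exists (v i 0); exact: e.
exact: cvg_lim e.
Unshelve. all: by end_near. Qed.

Lemma is_derive_peval p (u v : 'cV[R]_3) :
  is_derive u v (peval p : 'cV[R]_3 -> R^o) (\sum_i peval (mderiv i p) u * v i 0).
Proof.
elim/mpoly_alg_ind: p => [c|j|p q IHp IHq|p q IHp IHq].
- have -> : peval (mpolyC 3 c) = fun=> c by apply/funext => x; exact: mevalC.
  rewrite big1 => [|i _]; first exact: is_derive_cst.
  by rewrite mderivC /peval meval0 mul0r.
- have -> : peval (Xv j) = fun x => x j 0 by apply/funext => x; exact: mevalXU.
  rewrite (bigD1 j) //= mderivXU eqxx /peval meval1 mul1r big1 ?addr0 => [|i /negPf ij].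
    exact: is_derive_coord.
  by rewrite mderivXU ij meval0 mul0r.
- have -> : peval (p + q) = (peval p : 'cV[R]_3 -> R^o) + peval q by apply/funext => x; exact: mevalD.
  apply: (is_derive_eq (is_deriveD IHp IHq)).
  by rewrite -big_split; apply: eq_bigr => i _; rewrite /peval raddfD mevalD mulrDl.
- have -> : peval (p * q) = (peval p : 'cV[R]_3 -> R^o) * peval q by apply/funext => x; exact: mevalM.
  apply: (is_derive_eq (is_deriveM IHp IHq)).
  rewrite /GRing.scale /= !mulr_sumr -big_split; apply: eq_bigr => i _.
  by rewrite /peval mderivM mevalD !mevalM /=; ring.
Qed.

Definition polymap (q : 'I_3 -> P) (u : 'cV[R]_3) : 'cV[R]_3 := \col_i peval (q i) u.
Definition pjac (q : 'I_3 -> P) : 'M[P]_3 := \matrix_(i, j) mderiv j (q i).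

Lemma jacobian_polymap q u : jacobian_mx (polymap q) u = map_mx (peval^~ u) (pjac q).
Proof.
apply/matrixP => i j; rewrite !mxE.
have -> : (fun x => polymap q x i 0) = peval (q i) by apply/funext => x; rewrite mxE.
have d := is_derive_peval (q i) u (delta_mx j 0); rewrite (@derive_val _ _ _ _ _ _ _ d).
rewrite (bigD1 j) //= mxE !eqxx mulr1 big1 ?addr0 // => k /negPf kj.
by rewrite mxE kj mulr0.
Qed.

Section VectorCoefficients.
Variables (I : finType) (b : I -> 'cV[{poly R}]_2).

Definition hmap (h : I -> P) (u : 'cV[R]_3) : R -> 'cV[R]_2 :=
  fun theta => \sum_i peval (h i) u *: polyfun (b i) theta.

Lemma hmapE h u t d : hmap h u t d 0 = peval (\sum_i (b i d 0).[t] *: h i) u.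
Proof.
rewrite /hmap summxE /peval raddf_sum; apply: eq_bigr => i _.
by rewrite !mxE /= mevalZ mulrC.
Qed.

Definition drift (h : I -> P) (u g : 'cV[R]_3) : R -> 'cV[R]_2 :=
  fun t => \sum_i (\sum_j peval (mderiv j (h i)) u * g j 0) *: polyfun (b i) t.

Lemma driftE h u g t d :
  drift h u g t d 0 = \sum_j peval (mderiv j (\sum_i (b i d 0).[t] *: h i)) u * g j 0.
Proof.
rewrite /drift summxE; under [LHS]eq_bigr do rewrite !mxE mulr_suml.
rewrite exchange_big /=; apply: eq_bigr => j _.
rewrite raddf_sum /peval raddf_sum mulr_suml; apply: eq_bigr => k _.
by rewrite /= mderivZ mevalZ; ring.
Qed.

Lemma derive_hmap h (u v : 'cV[R]_3) t :
  'D_v (fun x => hmap h x t) u = drift h u v t.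
Proof.
have d c i : is_derive u v (fun x => hmap h x t c i : R^o)
    (\sum_j peval (mderiv j (\sum_i (b i c 0).[t] *: h i)) u * v j 0).
  rewrite (ord1 i); have -> : (fun x => hmap h x t c 0) = peval (\sum_i (b i c 0).[t] *: h i).
    by apply/funext => x; rewrite hmapE.
  exact: is_derive_peval.
rewrite derive_mx; last by apply/derivable_mxP => c i; exact: (@ex_derive _ _ _ _ _ _ _ (d c i)).
by apply/matrixP => c i; rewrite mxE (@derive_val _ _ _ _ _ _ _ (d c i)) (ord1 i) driftE.
Qed.

End VectorCoefficients.

Lemma peval_homogeneous (p : P) j : p \is @ishomog1 _ _ j mdeg ->
  exists c : nat -> nat -> R, forall u, peval p u = \sum_(x < j.+1) \sum_(y < (j - x).+1)
    (u 0 0 ^+ x * u 1 0 ^+ y * u 2%:R 0 ^+ (j - x - y)) * c x y.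
Proof.
move=> /dhomogP hp.
suff [c cE] : exists c : nat -> nat -> R, forall u : 'cV[R]_3,
    \sum_(m <- msupp p) mcoeff m p * \prod_i u i 0 ^+ m i = \sum_(x < j.+1) \sum_(y < (j - x).+1)
    (u 0 0 ^+ x * u 1 0 ^+ y * u 2%:R 0 ^+ (j - x - y)) * c x y.
  by exists c => u; rewrite -cE -mevalE.
move: hp; elim: (msupp p) => [|m s IH] hs.
  exists (fun _ _ => 0) => u; rewrite big_nil big1 // => x _.
  by rewrite big1 // => y _; rewrite mulr0.
have [|c cE] := IH; first by move=> m' m's; apply: hs; rewrite inE m's orbT.
have mj : (m 0%R + m 1%R + m 2%:R)%N = j.
  have <- := hs m (mem_head _ _); rewrite /= mdegE.
  by rewrite !big_ord_recl big_ord0 addn0 addnA; congr (_ + _ + _)%N; congr (m _); apply/val_inj.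
exists (fun x y => c x y + if (x == m 0%R) && (y == m 1%R) then mcoeff m p else 0) => u.
rewrite big_cons cE addrC.
under [RHS]eq_bigr do under eq_bigr do rewrite mulrDr.
under [RHS]eq_bigr do rewrite big_split; rewrite big_split /=; congr (_ + _).
have m0j : (m 0%R < j.+1)%N by lia.
rewrite (bigD1 (Ordinal m0j)) //= [X in _ + X]big1 ?addr0 => [|x xm]; last first.
  have -> : (x == m 0%R :> nat) = false by apply/negbTE.
  by rewrite big1 // => y _; rewrite mulr0.
have m1j : (m 1%R < (j - m 0%R).+1)%N by lia.
rewrite (bigD1 (Ordinal m1j)) //= !eqxx [X in _ + X]big1 ?addr0 => [|y ym]; last first.
  have -> : (y == m 1%R :> nat) = false by apply/negbTE.
  by rewrite /= mulr0.
have -> : (j - m 0%R - m 1%R)%N = m 2%:R by lia.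
rewrite mulrC; congr (_ * _).
have e1 : lift ord0 ord0 = 1%R :> 'I_3 by exact/val_inj.
have e2 : lift ord0 (lift ord0 ord0) = 2%:R :> 'I_3 by exact/val_inj.
by rewrite !big_ord_recl big_ord0 mulr1 mulrA e1 e2.
Qed.

End PolynomialMaps.
Arguments peval {R} p u.

(** * Composition of the changes of variables *)

Section Pullback.
Variables (R : realType) (I : finType) (b : I -> 'cV[{poly R}]_2).
Variable s0 : @system R.
Local Notation P := (mpoly 3 R).
Local Notation Xv i := (mpolyX R (mnm1 (i : 'I_3))).
Local Notation ge := (wge mdeg).
Local Notation J phi u := (map_mx (peval^~ u) (pjac phi)).

(** Stated at a single [u] together with invertibility: [invmx] is an inverse only at units, and the
    steps compose only where all Jacobians are invertible. *)
Definition pulled_back (phi : 'I_3 -> P) (h : I -> P) (f : @system R) u :=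
  J phi u \in unitmx /\
  forall v, f.1 u v = invmx (J phi u) *m s0.1 (polymap phi u) (v + hmap b h u) /\
    f.2 u v = s0.2 (polymap phi u) (v + hmap b h u) - (drift b h u (f.1 u v), 0).

Lemma pulled_back_id u : pulled_back (fun i => Xv i) (fun=> 0) s0 u.
Proof.
have JE : J (fun i => Xv i) u = 1%:M.
  apply/matrixP => i j; rewrite !mxE mderivXU [RHS]mulrb eq_sym.
  by case: eqP => _; rewrite /peval ?meval1 ?meval0.
have phiE : polymap (fun i => Xv i) u = u.
  by apply/matrixP => i j; rewrite mxE /peval mevalXU (ord1 j).
have hE : hmap b (fun=> 0) u = 0.
  by apply/funext => t; apply: big1 => i _; rewrite /peval meval0 scale0r.
rewrite /pulled_back JE unitmx1 phiE hE; split=> // v.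
rewrite addr0 invmx1 mul1mx; split=> //.
have -> : drift b (fun=> 0) u (s0.1 u v) = 0.
  apply/funext => t; apply: big1 => i _; rewrite big1 ?scale0r // => j _.
  by rewrite raddf0 /peval meval0 mul0r.
by rewrite subr0.
Qed.

Section Step.
Variables (U : 'I_3 -> P) (V : I -> P).
Let q i := Xv i + U i.

Lemma peval_msubst p u : peval (msubst q p) u = peval p (polymap q u).
Proof. by rewrite /peval meval_msubst; apply: meval_eq => i; rewrite mxE. Qed.

Lemma pjac_msubst phi u : J (fun i => msubst q (phi i)) u = J phi (polymap q u) *m J q u.
Proof.
apply/matrixP => i j; rewrite !mxE mderiv_msubst /peval raddf_sum; apply: eq_bigr => k _.
by rewrite /= mevalM !mxE -[meval _ (msubst _ _)]/(peval _ u) peval_msubst.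
Qed.

(** Chain rule: inverse Jacobians multiply, and the drift of the new graph is the old drift at q(u)
    plus that of [V]. *)
Lemma pulled_back_step phi h f u :
  pulled_back phi h f (polymap q u) -> J q u \in unitmx ->
  pulled_back (fun i => msubst q (phi i)) (fun i => msubst q (h i) + V i)
    (change_variables (polymap U) (hmap b V) f) u.
Proof.
move=> [Jphi fE] Jq.
have qE : u + polymap U u = polymap q u.
  by apply/matrixP => i j; rewrite !mxE /peval mevalD mevalXU (ord1 j).
have JqE : 1%:M + jacobian_mx (polymap U) u = J q u.
  rewrite jacobian_polymap; apply/matrixP => i j; rewrite !mxE /peval mderivD mevalD mderivXU eq_sym.
  by case: eqP => _; rewrite ?meval1 ?meval0.
have phiE : polymap (fun i => msubst q (phi i)) u = polymap phi (polymap q u).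
  by apply/matrixP => i j; rewrite !mxE peval_msubst.
have hE v : v + hmap b V u + hmap b h (polymap q u) = v + hmap b (fun i => msubst q (h i) + V i) u.
  rewrite -addrA; congr (_ + _); apply/funext => t.
  rewrite [LHS]addrC -[LHS]big_split; apply: eq_bigr => i _.
  by rewrite /= -scalerDl /peval mevalD -[meval _ (msubst _ _)]/(peval _ u) peval_msubst.
rewrite /pulled_back pjac_msubst unitmx_mul Jphi Jq; split=> // v.
rewrite /change_variables /= qE JqE.
have [-> f2E] := fE (v + hmap b V u).
split.
  rewrite mulmxA phiE -hE; congr (_ *m _).
  by exact: (esym (@invrM 'M[R]_3 _ _ Jphi Jq)).
rewrite /= f2E phiE -hE.
have [f1E _] := fE (v + hmap b V u).
rewrite -f1E; move: (f.1 _ _) => g.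
rewrite -addrA -opprD; congr (_ - _); rewrite -[LHS]/(_ , _) addr0; congr (_, _).
apply/funext => t; rewrite [LHS]/GRing.add /= derive_hmap -big_split; apply: eq_bigr => i _.
rewrite /= -scalerDl; congr (_ *: _).
(* The old velocity is J q applied to the new one, which exhibits the chain rule for h o q. *)
have gE : g = J q u *m (invmx (J q u) *m g) by rewrite mulmxA mulmxV // mul1mx.
rewrite {1}gE; move: (invmx _ *m g) => g'.
under [RHS]eq_bigr do rewrite mderivD /peval mevalD mulrDl.
rewrite big_split; congr (_ + _).
under eq_bigr do rewrite mxE mulr_sumr.
rewrite exchange_big; apply: eq_bigr => j _ /=.
rewrite -/(peval _ u) mderiv_msubst /peval raddf_sum mulr_suml; apply: eq_bigr => k _.
by rewrite /= mevalM !mxE -[meval _ (msubst _ _)]/(peval _ u) peval_msubst; ring.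
Qed.

Lemma det_pjac u : \det (J q u) = peval (\det (pjac q)) u.
Proof. by rewrite [RHS]/peval -det_map_mx. Qed.

End Step.

Lemma wge_mderiv N (p : P) i : ge N.+1 p -> ge N (mderiv i p).
Proof.
move=> /wgeP pN; apply/wgeP => m lt_mN; rewrite mcoeff_deriv pN ?mul0rn //.
by rewrite mfD /= mdeg1 addn1.
Qed.

Lemma peval_at0 (p : P) : ge 1 p -> peval p 0 = 0.
Proof.
move=> p1; have -> : peval p 0 = (along 0 p).[0] by rewrite horner_along scaler0.
have /dvdpP[r ->] : 'X^1 %| along 0 p.
  by apply: dvdp_curve => // i; rewrite mxE scale0r dvdp0.
by rewrite hornerM hornerXn expr1 mulr0.
Qed.

Section Composite.
Variables (phi : 'I_3 -> P) (h : I -> P).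

Definition shift1 j := polymap (factor1 phi h (j - 2)).
Definition shift2 j := hmap b (factor2 phi h (j - 2)).
Definition reduced k := foldl (fun g j => change_variables (shift1 j) (shift2 j) g) s0 (iota 2 k).

(* [d] collects the determinants of the Jacobians of the successive changes of
   variables. *)
Lemma pulled_back_reduced k : exists2 d : P, peval d 0 != 0 &
  forall u, peval d u != 0 ->
    pulled_back (factors phi h k).1 (factors phi h k).2 (reduced k) u.
Proof.
elim: k => [|k [d d0 IH]].
  by exists 1 => [|u _]; [rewrite /peval meval1 oner_neq0|exact: pulled_back_id].
pose q i := Xv i + factor1 phi h k i.
have U2 i : ge k.+2 (factor1 phi h k i) by apply: (wge_dhomog (pihomogP _ _ _)).
have q0 : polymap q 0 = 0.
  apply/matrixP => i j; rewrite !mxE peval_at0 //; apply: wgeD; last exact: wgeW (U2 i).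
  by have := @wgeXU 3 R mdeg i; rewrite /= mdeg1.
exists (\det (pjac q) * msubst q d) => [|u].
  rewrite /peval mevalM mulf_neq0 // -/(peval _ _); last by rewrite peval_msubst q0.
  rewrite -det_pjac; suff -> : J q 0 = 1%:M by rewrite det1 oner_neq0.
  apply/matrixP => i j; rewrite !mxE /q mderivD mderivXU eq_sym /peval mevalD -!/(peval _ _).
  rewrite [X in _ + X]peval_at0 ?addr0; first by case: eqP => _; rewrite /peval ?meval1 ?meval0.
  by apply: wge_mderiv; exact: wgeW (U2 i).
rewrite /peval mevalM mulf_eq0 negb_or -!/(peval _ _) peval_msubst => /andP[Jq dq].
rewrite /reduced -[iota 2 k.+1]/(iota 2 (1 + k)) (addnC 1%N) iotaD foldl_cat -/(reduced k) /=.
rewrite /shift1 /shift2 add2n subn2 /=.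
apply: pulled_back_step; first exact: IH.
by rewrite unitmxE unitfE det_pjac.
Qed.

End Composite.
End Pullback.

(** * The reduced system *)

Lemma coef_dvdXn (K : fieldType) n j (p : {poly K}) : 'X^n %| p -> (j < n)%N -> p`_j = 0.
Proof. by move=> /dvdpP[r ->] lt_jn; rewrite coefMXn lt_jn. Qed.

Lemma curve_msubst (K : fieldType) m n (c : 'I_n -> {poly K}) (q : 'I_m -> mpoly n K) p :
  curve c (msubst q p) = curve (fun i => curve c (q i)) p.
Proof.
elim/mpoly_alg_ind: p => [x|j|p1 p2 IH1 IH2|p1 p2 IH1 IH2].
- by rewrite msubstC !curveC.
- by rewrite msubstXU curveX.
- by rewrite !rmorphD /= IH1 IH2.
- by rewrite !rmorphM /= IH1 IH2.
Qed.

Definition pairfun (K : nmodType) (x y : K) (i : 'I_2) : K := [:: x; y]`_i.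

Lemma sum_jac (R : realType) (phi : 'I_3 -> mpoly 3 R) u (v : 'I_3 -> mpoly 3 R) i :
  (map_mx (along u) (pjac phi) *m \col_j along u (v j)) i 0 = along u (vder v (phi i)).
Proof.
rewrite mxE /vder raddf_sum; apply: eq_bigr => j _.
by rewrite !mxE /= rmorphM /= mulrC.
Qed.

Lemma mulmx_delta1 (K : comNzRingType) m (A : 'M[K]_(m, 2)) (x : K) i :
  (A *m (x *: delta_mx 1 0 : 'cV_2)) i 0 = A i 1 * x.
Proof. by rewrite mxE sum_ord2 !mxE /= mulr0 mulr1 mulr0 add0r. Qed.

Section NormalForm.
Variables (R : realType) (a beta : R) (Psi : R -> 'M[R]_(3, 2)).
Local Notation tau := (tau0 a beta).
Local Notation P := (mpoly 3 R).
Local Notation Xv i := (mpolyX R (mnm1 (i : 'I_3))).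
Local Notation ge := (wge mdeg).
Variables (w : P) (F G : mpoly 2 R) (I : finType) (b : I -> 'cV[{poly R}]_2).
Local Notation Dw := (vder (vfield w)).
Variables (phi : 'I_3 -> P) (h : I -> P).
Hypotheses (F2 : ge 2 F) (G2 : ge 2 G).
Hypotheses (phi2 : forall i, ge 2 (phi i - Xv i)) (h2 : forall i, ge 2 (h i)).
Hypotheses (a_gt0 : 0 < a) (PsiP : adjoint_basis a beta Psi).

Definition fun2 (F : mpoly 2 R) (x y : R) : R := meval (pairfun x y) F.
Local Notation s0 := (decomposed_system a beta Psi (fun2 F) (fun2 G)).
Variables (f : @system R) (d : P).
Hypotheses (d0 : peval d 0 != 0)
  (fP : forall u, peval d u != 0 -> pulled_back b s0 phi h f u).

(** An arbitrary [v] enters the nonlinearity only through its values at 0 and - tau, so along (t u,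
    t v) the nonlinearity is a polynomial in t. *)
Definition history_along u (v : R -> 'cV[R]_2) s c : {poly R} :=
  along u (history b phi h s c) + v s c 0 *: 'X.

Definition nonlin_along u v : {poly R} :=
  curve (pairfun (history_along u v 0 0) (history_along u v 0 1)) F
  + curve (pairfun (history_along u v (- tau) 0) (history_along u v (- tau) 1)) G.

Lemma nonlin_along0 u : nonlin_along u 0 = along u (nonlin a beta F G b phi h).
Proof.
have arg0 s c : history_along u 0 s c = along u (history b phi h s c) by rewrite /history_along mxE scale0r addr0.
have eqc (c c' : 'I_2 -> {poly R}) p : c =1 c' -> curve c p = curve c' p.
  by move=> cc'; rewrite /curve /mmap; apply: eq_bigr => m _; congr (_ * _); exact: mmap1_eq.
rewrite /nonlin rmorphD /=; congr (_ + _); rewrite [RHS]curve_msubst; apply: eqc => i;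
  by rewrite /pairfun /pair2 !arg0; elim/ord2P: i.
Qed.

Lemma dvdX_history_along u v s c : 'X %| history_along u v s c.
Proof.
rewrite dvdp_addl; last by rewrite -mul_polyC dvdp_mull.
rewrite -['X]expr1; apply: dvdp_curve; first by move=> i; rewrite -mul_polyC dvdp_mull.
exact: history1.
Qed.

Lemma dvdXX_nonlin_along u v : 'X^2 %| nonlin_along u v.
Proof.
by apply: dvdp_add; apply: dvdp_curve => // i; rewrite /pairfun; elim/ord2P: i; exact: dvdX_history_along.
Qed.

Lemma horner_history_along u v s c t : (history_along u v s c).[t] =
  (Phi s *m polymap phi (t *: u) + (t *: v + hmap b h (t *: u)) s) c 0.
Proof.
rewrite /history_along hornerD hornerZ hornerX horner_along mxE [(_ *m _) c 0]mxE.
rewrite /history /peval mevalD -!/(peval _ _) -addrA; congr (_ + _).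
  rewrite /peval raddf_sum; apply: eq_bigr => j _.
  by rewrite /= mevalZ PhiE mxE.
by rewrite -[(_ + _) s]/(_ + _) [RHS]mxE -hmapE mxE addrC mulrC.
Qed.

Lemma Nop_nonlin_along u v t :
  Nop a beta (fun2 F) (fun2 G)
    (fun s => Phi s *m polymap phi (t *: u) + (t *: v + hmap b h (t *: u)) s) =
  (nonlin_along u v).[t] *: delta_mx 1 0.
Proof.
rewrite /Nop /fun2 -!horner_history_along; congr (_ *: _).
rewrite [RHS]hornerD; congr (_ + _); rewrite [RHS]horner_curve;
  by apply: meval_eq => i; rewrite /pairfun; elim/ord2P: i.
Qed.

Lemma near_d u : \forall t \near (0 : R), peval d (t *: u) != 0.
Proof.
have d0' : (along u d).[0] != 0 by rewrite horner_along scale0r.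
by apply: filterS (near0_horner d0') => t; rewrite horner_along.
Qed.

Lemma map_pjac_along u t :
  map_mx (horner^~ t) (map_mx (along u) (pjac phi)) = map_mx (peval^~ (t *: u)) (pjac phi).
Proof. by apply/matrixP => i j; rewrite !mxE horner_along. Qed.

Lemma bilin_mx_zero : bilin_mx a beta Psi (0 : R -> 'cV[R]_2) = 0.
Proof.
apply/matrixP => i z; rewrite !mxE; have := bilin_polyZ a beta Psi i 0 0.
rewrite mul0r scaler0 -(bilin_polyE a_gt0 PsiP) => <-.
congr (bilin _ _ _ _); apply/funext => t; apply/matrixP => x y.
by rewrite (ord1 y) (ord1 z) !mxE horner0.
Qed.

Section Germs.
Variables (u : 'cV[R]_3) (v : R -> 'cV[R]_2) (n : nat).
Local Notation nl := (nonlin_along u v).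
Hypothesis defect : forall i, 'X^n %| along u (Dw (phi i) - \sum_j Bmx i j *: phi j) - Psi 0 i 1 *: nl.

(** Pulling back gives J phi f_1 = B phi + Psi(0) N, which by [defect] is D phi = J phi (u_2, u_3,
    w) up to t^n; [germ_solve] cancels J phi. *)
Lemma mgerm_u : mgerm n (fun t => f.1 (t *: u) (t *: v)) (\col_j along u (vfield w j)).
Proof.
have /fin_all_exists[e eE] i : exists e, along u (Dw (phi i) - \sum_j Bmx i j *: phi j)
    - Psi 0 i 1 *: nl = e * 'X^n by exact/dvdpP.
apply: (@germ_solve _ _ _ (map_mx (along u) (pjac phi)) _ (\col_i - e i)).
  rewrite (det_map_mx (along u)) horner_along scale0r.
  have [+ _] := fP d0; rewrite unitmxE unitfE.
  by rewrite (det_map_mx (meval (fun i => (0 : 'cV[R]_3) i 0))).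
near=> t.
have dt : peval d (t *: u) != 0 by near: t; exact: near_d.
have [Jt /(_ (t *: v))[-> _]] := fP dt.
rewrite map_pjac_along mulmxA mulmxV // mul1mx /decomposed_system /= Nop_nonlin_along.
apply/matrixP => i j; rewrite (ord1 j).
have -> : (map_mx (horner^~ t) (map_mx (along u) (pjac phi) *m \col_j along u (vfield w j)) +
    t ^+ n *: map_mx (horner^~ t) (\col_i - e i)) i 0
    = (along u (Dw (phi i))).[t] - t ^+ n * (e i).[t].
  rewrite -sum_jac [LHS]mxE [X in X + _]mxE [X in _ + X]mxE [X in _ * X]mxE.
  by rewrite [(\col_k _) i 0]mxE hornerN mulrN.
have := congr1 (horner^~ t) (eE i).
rewrite hornerM hornerXn mulrC => <-.
have hE (x y z : {poly R}) c : (x - y - c *: z).[t] = x.[t] - y.[t] - c * z.[t].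
  by rewrite !hornerD !hornerN hornerZ.
rewrite [along u (_ - _)]rmorphB hE.
have -> : (Bmx *m polymap phi (t *: u) + Psi 0 *m (nl.[t] *: delta_mx 1 0)) i 0
   = (along u (\sum_j Bmx i j *: phi j)).[t] + Psi 0 i 1 * nl.[t].
  rewrite mxE horner_along /peval raddf_sum [X in X + _]mxE; congr (_ + _).
    by apply: eq_bigr => k _; rewrite /= mevalZ [polymap _ _ _ _]mxE.
  exact: mulmx_delta1.
by ring.
Unshelve. all: by end_near. Qed.

Hypothesis v1 : C1_in (Idelay a beta) v.

Lemma derive_in_state t s : Idelay a beta s ->
  derive_in (Idelay a beta) (t *: v + hmap b h (t *: u)) s =
  t *: derive_in (Idelay a beta) v s
  + \sum_i peval (h i) (t *: u) *: polyfun (map_mx deriv (b i)) s.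
Proof.
move=> Is; have ab : - tau < 0 by rewrite oppr_lt0 tau0_gt0.
apply: (has_derE ab Is).
have [/(_ s Is) vs _] := v1.
apply: has_derD; first by apply: has_derZ; exact: derivable_has_der.
by apply: has_der_sum => i; apply: has_derZ; exact: has_der_polyfun.
Qed.

(** All terms are polynomial in t except the drift, where f_1 is replaced by its jet from
    [mgerm_u]. *)
Lemma mgerm_v s : Idelay a beta s ->
  mgerm n (fun t => (f.2 (t *: u) (t *: v)).1 s)
    (\col_c (derive_in (Idelay a beta) v s c 0 *: 'X
      + along u (\sum_i (b i c 0)^`().[s] *: h i)
      - (\sum_j (phicol R j c 0).[s] * Psi 0 j 1) *: nl
      - along u (Dw (\sum_i (b i c 0).[s] *: h i)))).
Proof.
move=> Is c j0; rewrite (ord1 j0) mxE => {j0}.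
pose p : {poly R} := derive_in (Idelay a beta) v s c 0 *: 'X
      + along u (\sum_i (b i c 0)^`().[s] *: h i)
      - (\sum_j (phicol R j c 0).[s] * Psi 0 j 1) *: nl.
pose g (j : 'I_3) := mderiv j (\sum_i (b i c 0).[s] *: h i).
have -> : along u (Dw (\sum_i (b i c 0).[s] *: h i)) =
    \sum_j along u (g j) * along u (vfield w j).
  by rewrite raddf_sum; apply: eq_bigr => j _; rewrite /= rmorphM mulrC.
rewrite -/p -sumrN; under [in X in _ + X]eq_bigr do rewrite -mulNr.
apply: (@germ_eq _ _ _ (fun t => p.[t] + \sum_j (- along u (g j)).[t] * f.1 (t *: u) (t *: v) j 0)).
  near=> t.
  have dt : peval d (t *: u) != 0 by near: t; exact: near_d.
  have [_ /(_ (t *: v))[_ ->]] := fP dt.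
  set v' := t *: v + _; pose N : 'cV[R]_2 := nl.[t] *: delta_mx 1 0.
  have -> : s0.2 (polymap phi (t *: u)) v' = A_Q1 a beta v' + (X0 N - proj_P a beta Psi (X0 N)).
    by rewrite /decomposed_system /= Nop_nonlin_along.
  rewrite /A_Q1 /X0 /proj_P /= bilin_mx_zero add0r.
  have -> (x z r : R -> 'cV[R]_2) : (x - z - r) s c 0 = x s c 0 - z s c 0 - r s c 0.
    by rewrite -[(x - _ - _) s]/(x s - z s - r s) !mxE.
  rewrite add0r derive_in_state // driftE.
  have -> : \sum_j (- along u (g j)).[t] * f.1 (t *: u) (t *: v) j 0 =
      - \sum_j peval (g j) (t *: u) * f.1 (t *: u) (t *: v) j 0.
    by rewrite -sumrN; apply: eq_bigr => j _; rewrite hornerN horner_along mulNr.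
  congr (_ - _).
  have hE (k m : R) (x y : {poly R}) : (k *: 'X + x - m *: y).[t] = k * t + x.[t] - m * y.[t].
    by rewrite !hornerD hornerN !hornerZ hornerX.
  rewrite /p hE; congr (_ - _).
    rewrite [LHS]mxE [X in X + _]mxE mulrC; congr (_ + _).
    rewrite summxE horner_along /peval raddf_sum; apply: eq_bigr => i _.
    by rewrite /= mevalZ [RHS]mulrC !mxE.
  rewrite mxE mulr_suml; apply: eq_bigr => j _.
  rewrite PhiE -mulrA; congr (_ * _).
  exact: mulmx_delta1.
apply: germD; first exact: germ_horner.
apply: germ_sum => j; apply: germMl.
by have := mgerm_u j 0; rewrite mxE.
Unshelve. all: by end_near. Qed.

Lemma Lop_state t : Lop a beta (t *: v + hmap b h (t *: u)) =
  t *: Lop a beta v + \sum_i peval (h i) (t *: u) *: Lop a beta (polyfun (b i)).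
Proof.
have LopM : exists A A' : 'M[R]_2, forall x, Lop a beta x = A *m x 0 + A' *m x (- tau).
  by eexists; eexists => x; rewrite /Lop /eta_int !big_cons big_nil addr0.
have [A [A' LopM']] := LopM; rewrite !LopM'.
have lin (B : 'M[R]_2) s : B *m (t *: v + hmap b h (t *: u)) s =
    t *: (B *m v s) + \sum_i peval (h i) (t *: u) *: (B *m polyfun (b i) s).
  rewrite -[(_ + _) s]/(t *: v s + _) mulmxDr -scalemxAr mulmx_sumr; congr (_ + _).
  by apply: eq_bigr => i _; rewrite -scalemxAr.
rewrite !lin addrACA -scalerDr -big_split; congr (_ + _).
by apply: eq_bigr => i _; rewrite LopM' scalerDr.
Qed.

(** The drift and the projection to P have no X_0 component, so this one is exactly polynomial in t
    near 0. *)
Lemma mgerm_0 : mgerm n (fun t => (f.2 (t *: u) (t *: v)).2)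
    (\col_c ((Lop a beta v - derive_in (Idelay a beta) v 0) c 0 *: 'X
      + along u (\sum_i (Lop a beta (polyfun (b i)) c 0 - (b i c 0)^`().[0]) *: h i)
      + (c == 1)%:R *: nl)).
Proof.
move=> c j0; rewrite (ord1 j0) mxE => {j0}.
set p := (X in germ _ _ X).
apply: (@germ_eq _ _ _ (fun t => p.[t])); last exact: germ_horner.
near=> t.
have dt : peval d (t *: u) != 0 by near: t; exact: near_d.
have [_ /(_ (t *: v))[_ ->]] := fP dt.
set v' := t *: v + _; pose N : 'cV[R]_2 := nl.[t] *: delta_mx 1 0.
have -> : s0.2 (polymap phi (t *: u)) v' = A_Q1 a beta v' + (X0 N - proj_P a beta Psi (X0 N)).
  by rewrite /decomposed_system /= Nop_nonlin_along.
rewrite /A_Q1 /X0 /proj_P /= !subr0 Lop_state derive_in_state.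
  have -> : (t *: Lop a beta v + \sum_i peval (h i) (t *: u) *: Lop a beta (polyfun (b i)) -
     (t *: derive_in (Idelay a beta) v 0 +
      \sum_i peval (h i) (t *: u) *: polyfun (map_mx deriv (b i)) 0) + N) =
     t *: (Lop a beta v - derive_in (Idelay a beta) v 0)
     + \sum_i peval (h i) (t *: u) *: (Lop a beta (polyfun (b i)) - polyfun (map_mx deriv (b i)) 0) + N.
    under [in RHS]eq_bigr do rewrite scalerBr.
    by rewrite opprD addrACA -scalerBr sumrB.
  have hE (k m : R) (x y : {poly R}) : (k *: 'X + x + m *: y).[t] = t * k + x.[t] + y.[t] * m.
    by rewrite !hornerD !hornerZ hornerX mulrC [y.[t] * m]mulrC.
  rewrite /p hE [LHS]mxE [X in X + _]mxE; congr (_ + _); last by rewrite !mxE andbT.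
  rewrite [X in X + _]mxE; congr (_ + _).
  rewrite summxE horner_along /peval raddf_sum; apply: eq_bigr => i _.
  by rewrite /= mevalZ [RHS]mulrC [LHS]mxE; congr (_ * _); rewrite mxE [X in _ + X]mxE; congr (_ - _); rewrite !mxE.
by rewrite /Idelay /= in_itv /= lexx oppr_le0 ltW ?tau0_gt0.
Unshelve. all: by end_near. Qed.

End Germs.

Lemma dvdp_along N (p : P) u : ge N p -> 'X^N %| along u p.
Proof. by apply: dvdp_curve => i; rewrite -mul_polyC dvdp_mull. Qed.

Lemma alongZ u c (p : P) : along u (c *: p) = c *: along u p.
Proof. exact: curveZ. Qed.

Variable l : nat.
Hypotheses (w2 : ge 2 w)
  (du : forall i, ge l.+1 (defect_u a beta Psi w F G b phi h i))
  (dv : forall t c, ge l.+1 (defect_v a beta Psi w F G b phi h t c))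
  (dv0 : forall c, ge l.+1 (defect_0 a beta F G b phi h c)).

Lemma vfieldE i : vfield w i = \sum_j Bmx i j *: Xv j + (i == 2%:R)%:R *: w.
Proof.
rewrite sum_ord3 /vfield !mxE.
by elim/ord3P: i; rewrite /= ?scale0r ?scale1r ?addr0 ?add0r.
Qed.

Lemma along_vfield u i :
  along u (vfield w i) = (Bmx *m u) i 0 *: 'X + (i == 2%:R)%:R *: along u w.
Proof.
rewrite vfieldE rmorphD /= alongZ; congr (_ + _).
rewrite raddf_sum mxE scaler_suml; apply: eq_bigr => j _.
by rewrite /= alongZ [along u _]curveX scalerA.
Qed.

(** Orders alone give this: phi - id, w and the nonlinearity all have order 2. It yields the terms
    of degree 0 and 1 for every [v]. *)
Lemma defect_low u v i :
  'X^2 %| along u (Dw (phi i) - \sum_j Bmx i j *: phi j) - Psi 0 i 1 *: nonlin_along u v.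
Proof.
apply: dvdp_sub; last by rewrite -mul_polyC dvdp_mull // dvdXX_nonlin_along.
apply: dvdp_along.
have -> : Dw (phi i) - \sum_j Bmx i j *: phi j =
    Dw (phi i - Xv i) - \sum_j Bmx i j *: (phi j - Xv j) + (i == 2%:R)%:R *: w.
  have -> : Dw (phi i - Xv i) = Dw (phi i) - vfield w i by rewrite raddfB /= vderX.
  rewrite sumrZB [vfield w i]vfieldE.
  have alg (x y z t : P) : x - y = x - (z + t) - (y - z) + t by ring.
  exact: alg.
apply: wgeD; last exact: wgeZ.
apply: wgeB; first exact: wge_vder_vfield.
by apply: wge_sum => j _; exact: wgeZ.
Qed.

(** At v = 0 the curve stays on the invariant graph, so the order improves to l + 1. *)
Lemma defect_high u i :
  'X^(l.+1) %| along u (Dw (phi i) - \sum_j Bmx i j *: phi j) - Psi 0 i 1 *: nonlin_along u 0.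
Proof.
rewrite nonlin_along0 -alongZ.
have := dvdp_along u (@du i); rewrite /defect_u [along u (_ - _ *: _)]rmorphB; exact.
Qed.

Lemma C1_zero : C1_in (Idelay a beta) (0 : R -> 'cV[R]_2).
Proof.
have -> : (0 : R -> 'cV[R]_2) = polyfun 0.
  by apply/funext => t; apply/matrixP => i j; rewrite !mxE horner0.
by apply: C1_in_polyfun; rewrite oppr_lt0 tau0_gt0.
Qed.

Lemma derive_in_zero s : Idelay a beta s ->
  derive_in (Idelay a beta) (0 : R -> 'cV[R]_2) s = 0.
Proof.
move=> Is; have ab : - tau < 0 by rewrite oppr_lt0 tau0_gt0.
by apply: (has_derE ab Is); exact: has_der_cst.
Qed.

Lemma term1_normal_form j u : (2 <= j <= l)%N ->
  term1 f j u 0 = (along u w)`_j *: delta_mx 2%:R 0.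
Proof.
move=> /andP[j2 jl]; rewrite /term1 (@mgerm_taylor _ _ _ l.+1 _ _ j _ (mgerm_u (defect_high u))) //.
apply/matrixP => i k; rewrite (ord1 k) !mxE along_vfield coefD !coefZ coefX.
have -> : (j == 1%N) = false by apply/negbTE; lia.
by rewrite mulr0 add0r mulrC eqxx andbT.
Qed.

Lemma term1_low j u v : (j < 2)%N -> term1 f j u v = j%:R *: (Bmx *m u).
Proof.
move=> j2; rewrite /term1 (mgerm_taylor j2 (mgerm_u (defect_low u v))).
apply/matrixP => i k; rewrite (ord1 k) [LHS]mxE [(\col_m _) i 0]mxE [RHS]mxE along_vfield coefD !coefZ coefX.
rewrite (coef_dvdXn (dvdp_along u w2)) // mulr0 addr0 mulrC.
by case: j j2 => [|[]].
Qed.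

(** On v = 0 the coefficients of f_2 are those of [defect_v] and [defect_0], which start at degree l
    + 1. *)
Lemma term2_normal_form j u : (j <= l)%N -> BC_eq a beta (term2 f j u 0) 0.
Proof.
move=> jl; split=> [s /set_mem Is|]; rewrite /term2 /=.
  rewrite (@mgerm_taylor _ _ _ l.+1 _ _ j _ (mgerm_v (defect_high u) C1_zero Is)) //.
  apply/matrixP => c k; rewrite !mxE derive_in_zero // mxE scale0r add0r nonlin_along0.
  have DwE : Dw (\sum_i (b i c 0).[s] *: h i) = \sum_i (b i c 0).[s] *: Dw (h i).
    by rewrite raddf_sum; apply: eq_bigr => i _; rewrite /= linearZ.
  have := dvdp_along u (@dv s c); rewrite /defect_v -DwE !rmorphB /= alongZ => /coef_dvdXn; exact.
rewrite (@mgerm_taylor _ _ _ l.+1 _ _ j _ (mgerm_0 u l.+1 C1_zero)) //.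
apply/matrixP => c k; rewrite !mxE.
rewrite derive_in_zero; last by rewrite /Idelay /= in_itv /= lexx oppr_le0 ltW ?tau0_gt0.
have -> : Lop a beta 0 = 0 by rewrite /Lop /eta_int !big_cons big_nil !mulmx0 !addr0.
rewrite mxE subr0.
rewrite scale0r add0r nonlin_along0 -alongZ -rmorphD.
by apply: (coef_dvdXn (dvdp_along u (@dv0 c))).
Qed.

Lemma wge_comb N (c : I -> R) (p : I -> P) : (forall i, ge N (p i)) -> ge N (\sum_i c i *: p i).
Proof. by move=> pN; apply: wge_sum => i _; exact: wgeZ. Qed.

Lemma term2_low j u v : (j < 2)%N -> C1_in (Idelay a beta) v ->
  BC_eq a beta (term2 f j u v)
    (fun s => j%:R *: derive_in (Idelay a beta) v s,
     j%:R *: (Lop a beta v - derive_in (Idelay a beta) v 0)).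
Proof.
move=> j2 v1; have coefE (k : R) p : 'X^2 %| p -> (k *: 'X + p)`_j = j%:R * k.
  move=> /coef_dvdXn p2; rewrite coefD coefZ coefX p2 // addr0 mulrC.
  by case: j j2 {p2} => [|[]].
split=> [s /set_mem Is|]; rewrite /term2 /=.
  rewrite (mgerm_taylor j2 (mgerm_v (defect_low u v) v1 Is)).
  apply/matrixP => c k; rewrite (ord1 k) [LHS]mxE [RHS]mxE [(\col_m _) c 0]mxE -!addrA coefE //.
  apply: dvdp_add; first by apply: dvdp_along; exact: wge_comb.
  apply: dvdp_sub; first by rewrite dvdpNr -mul_polyC dvdp_mull // dvdXX_nonlin_along.
  by apply: dvdp_along; apply: wge_vder_vfield => //; exact: wge_comb.
rewrite (mgerm_taylor j2 (mgerm_0 u 2 v1)).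
apply/matrixP => c k; rewrite (ord1 k) [LHS]mxE [RHS]mxE [(\col_m _) c 0]mxE -!addrA coefE //.
apply: dvdp_add; first by apply: dvdp_along; exact: wge_comb.
by rewrite -mul_polyC dvdp_mull // dvdXX_nonlin_along.
Qed.

Lemma normal_form :
  (forall j, (2 <= j <= l)%N -> W_space j (fun u => (along u w)`_j *: delta_mx 2%:R 0)) ->
  in_normal_form a beta Psi l f.
Proof.
move=> wW; split=> [u v [v1 _]|u v [v1 _]|j jl].
- split; first by rewrite term1_low // scale0r.
  have [e1 e2] := term2_low u (ltn0Sn 1) v1.
  by split=> [s Is|]; rewrite ?e1 ?e2 //= scale0r.
- split; first by rewrite term1_low // scale1r.
  have [e1 e2] := term2_low u (ltnSn 1) v1.
  by split=> [s Is|]; rewrite ?e1 ?e2 //= scale1r.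
split=> [u|]; first by apply: term2_normal_form; case/andP: jl.
have -> : (fun u => term1 f j u 0) = fun u => (along u w)`_j *: delta_mx 2%:R 0.
  by apply/funext => u; exact: term1_normal_form.
exact: wW.
Qed.

End NormalForm.

(** * Polynomial data and final assembly *)

Section Assembly.
Variable R : realType.
Local Notation P := (mpoly 3 R).
Local Notation Xv i := (mpolyX R (mnm1 (i : 'I_3))).
Local Notation ge := (wge mdeg).

Lemma along_monomial u (a b : 'I_3) m n :
  along u (Xv a ^+ m * Xv b ^+ n) = (u a 0 ^+ m * u b 0 ^+ n) *: 'X^(m + n).
Proof.
rewrite rmorphM !rmorphXn /= [along u (Xv a)]curveX [along u (Xv b)]curveX.
by rewrite !exprZn -scalerAl -scalerAr scalerA -exprD.
Qed.

Lemma ge_monomial (a b : 'I_3) m n : ge (m + n) (Xv a ^+ m * Xv b ^+ n).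
Proof.
have X1 (i : 'I_3) k : ge k (Xv i ^+ k).
  by have /(@wgeXn _ _ mdeg _ _ k) := @wgeXU 3 R mdeg i; rewrite /= mdeg1 mul1n.
by apply: wgeM.
Qed.

Lemma W_space_poly j (w : 'cV[R]_3 -> 'cV[R]_3) : (2 <= j)%N -> W_space j w ->
  exists2 p : P, ge j p &
    forall u, exists2 c, along u p = c *: 'X^j & w u = c *: delta_mx 2%:R 0.
Proof.
move=> j2 [c [d wE]].
(* The subtractions are truncated; [W_extra j] is at most j - 1, so the exponents do add up to j. *)
have ext i : (i < (W_extra j).+1)%N -> (j - 1 - i + i.+1)%N = j.
  by rewrite /W_extra ltnS; case: ifP => _; lia.
exists (\sum_(0 <= i < j.+1) c i *: (Xv 0 ^+ (j - i) * Xv 1 ^+ i) +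
  \sum_(0 <= i < (W_extra j).+1) d i *: (Xv 0 ^+ (j - 1 - i) * Xv 2%:R ^+ i.+1)).
  apply: wgeD; rewrite big_nat; apply: wge_sum => i /= ij; apply: wgeZ.
    by have := @ge_monomial 0 1 (j - i) i; rewrite subnK.
  by have := @ge_monomial 0 2%:R (j - 1 - i) i.+1; rewrite ext.
move=> u; rewrite wE; eexists; last by [].
rewrite rmorphD /= scalerDl !raddf_sum !scaler_suml; congr (_ + _);
  apply: eq_big_nat => i /= ij; rewrite alongZ along_monomial scalerA.
  by rewrite subnK.
by rewrite ext.
Qed.

Lemma W_space_sum l (w : nat -> 'cV[R]_3 -> 'cV[R]_3) :
  (forall j, (2 <= j <= l)%N -> W_space j (w j)) ->
  exists2 p : P, ge 2 p & forall j u, (2 <= j <= l)%N ->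
    w j u = (along u p)`_j *: delta_mx 2%:R 0.
Proof.
move=> wW.
have /choice[p pP] j : exists p : P, (2 <= j <= l)%N -> ge j p /\
    forall u, exists2 c, along u p = c *: 'X^j & w j u = c *: delta_mx 2%:R 0.
  have [jl|] := boolP (2 <= j <= l)%N; last by exists 0.
  have [|p jp pw] := W_space_poly _ (wW j jl); first by case/andP: jl.
  by exists p.
exists (\sum_(2 <= j < l.+1) p j).
  rewrite big_nat; apply: wge_sum => j /= jl; have [|jp _] := pP j; first by lia.
  by apply: (wgeW _ jp); lia.
move=> j u jl; rewrite raddf_sum coef_sum.
rewrite (bigD1_seq j) ?iota_uniq ?mem_index_iota //=.
have [_ /(_ u)[c -> ->]] := pP j jl.
rewrite coefZ coefXn eqxx mulr1 big_nat_cond big1 ?addr0 // => i /andP[il ij].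
have [|_ /(_ u)[c' -> _]] := pP i; first by lia.
by rewrite coefZ coefXn eq_sym (negPf ij) mulr0.
Qed.

Lemma polynomial2_fun2 (F : mpoly 2 R) : polynomial2 (fun2 F).
Proof.
(* In [p.[x%:P].[y]] the outer variable stands for x and the inner one for y. *)
exists (mmap (polyC \o polyC) (pairfun 'X ('X)%:P) F) => x y.
elim/mpoly_alg_ind: F => [c|j|p q IHp IHq|p q IHp IHq]; rewrite /fun2.
- by rewrite mevalC mmapC !hornerC.
- rewrite mevalXU mmapX mmap1U /pairfun; elim/ord2P: j => /=.
    by rewrite hornerX hornerC.
  by rewrite hornerC hornerX.
- by rewrite mevalD mmapD !hornerD -IHp -IHq.
- by rewrite mevalM rmorphM !hornerM -IHp -IHq.
Qed.

Lemma fun2_vanishes (F : mpoly 2 R) : ge 2 F -> vanishes_to_first_order (fun2 F).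
Proof.
move=> F2.
have axis (c : 'I_2 -> {poly R}) (g : R -> R) : (forall i, 'X %| c i) ->
    (forall t, g t = meval (fun i => (c i).[t]) F) -> g 0 = 0 /\ derive1 g 0 = 0.
  move=> Xc gE; have -> : g = fun t => (curve c F).[t].
    by apply/funext => t; rewrite horner_curve.
  have cF := dvdp_curve Xc F2.
  split; first by rewrite horner_coef0 (coef_dvdXn cF).
  have d0 : is_derive (0 : R) 1 (horner (curve c F) : R -> R) (curve c F)^`().[0] by exact: is_derive_poly.
  by rewrite derive1E (@derive_val _ _ _ _ _ _ _ d0) horner_coef0 coef_deriv (coef_dvdXn cF).
have [f0 fx] : fun2 F 0 0 = 0 /\ derive1 (fun x => fun2 F x 0) 0 = 0.
  apply: (axis (pairfun 'X 0) (fun x => fun2 F x 0)) => [i|t].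
    by elim/ord2P: i; rewrite ?dvdp0.
  by apply: meval_eq => i; elim/ord2P: i; rewrite /pairfun /= ?hornerX ?horner0.
have [_ fy] : fun2 F 0 0 = 0 /\ derive1 (fun y => fun2 F 0 y) 0 = 0.
  apply: (axis (pairfun 0 'X) (fun y => fun2 F 0 y)) => [i|t].
    by elim/ord2P: i; rewrite ?dvdp0.
  by apply: meval_eq => i; elim/ord2P: i; rewrite /pairfun /= ?hornerX ?horner0.
by split.
Qed.

Lemma homogeneous_polymap j (q : 'I_3 -> P) :
  (forall i, q i \is @ishomog1 _ _ j mdeg) -> homogeneous_map setT j (polymap q).
Proof.
move=> qj; have /choice[c cE] i := peval_homogeneous (qj i).
exists (fun x y => \col_i c i x y) => [//|u].
apply/matrixP => i k; rewrite !mxE cE summxE; apply: eq_bigr => x _.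
by rewrite summxE; apply: eq_bigr => y _; rewrite !mxE.
Qed.

Section DelayPart.
Variables (a beta : R) (Psi : R -> 'M[R]_(3, 2)) (I : finType) (b : I -> 'cV[{poly R}]_2).
Hypotheses (a_gt0 : 0 < a) (PsiP : adjoint_basis a beta Psi)
  (bQ1 : forall i j, bilin_poly a beta Psi j (b i) = 0).

Lemma Q1_comb (c : I -> R) : Q1 a beta Psi (fun t => \sum_i c i *: polyfun (b i) t).
Proof.
have -> : (fun t => \sum_i c i *: polyfun (b i) t) = polyfun (\sum_i (c i)%:P *: b i).
  apply/funext => t; apply/matrixP => i k; rewrite (ord1 k) !mxE !summxE horner_sum.
  by apply: eq_bigr => j _; rewrite !mxE hornerM hornerC.
split; first by apply: C1_in_polyfun; rewrite oppr_lt0 tau0_gt0.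
apply/matrixP => i z; rewrite !mxE.
transitivity (bilin_poly a beta Psi i (\sum_i (c i)%:P *: b i)).
  rewrite -(bilin_polyE a_gt0 PsiP); congr (bilin _ _ _ _); apply/funext => t; apply/matrixP => x y.
  by rewrite (ord1 y) (ord1 z) [LHS]mxE.
apply: (big_ind (fun g => bilin_poly a beta Psi i g = 0)).
- by rewrite -(scale0r 0) -[0 in LHS]/(0%:P) bilin_polyZ mul0r.
- by move=> x y x0 y0; rewrite bilin_polyD x0 y0 addr0.
- by move=> j _; rewrite bilin_polyZ bQ1 mulr0.
Qed.

Lemma homogeneous_hmap j (h : I -> P) :
  (forall i, h i \is @ishomog1 _ _ j mdeg) -> homogeneous_map (Q1 a beta Psi) j (hmap b h).
Proof.
move=> hj; have /choice[c cE] i := peval_homogeneous (hj i).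
exists (fun x y t => \sum_i c i x y *: polyfun (b i) t) => [x y|u]; first exact: Q1_comb.
apply/funext => t; rewrite fct_sumE /hmap.
under eq_bigr do rewrite cE scaler_suml.
rewrite exchange_big; apply: eq_bigr => x _; rewrite fct_sumE.
under eq_bigr do rewrite scaler_suml.
rewrite exchange_big; apply: eq_bigr => y _.
rewrite -[RHS]/(_ *: \sum_i _) scaler_sumr.
by apply: eq_bigr => i _; rewrite scalerA.
Qed.

End DelayPart.
End Assembly.

Theorem theorem4p2 (R : realType) (a beta : R)
    (a_gt0 : 0 < a) (nondeg : 3 * beta ^+ 2 <> 2 * a)
    (Psi : R -> 'M[R]_(3, 2)) (PsiP : adjoint_basis a beta Psi)
    (l : nat) (l_ge2 : (2 <= l)%N)
    (w : nat -> 'cV[R]_3 -> 'cV[R]_3)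
    (wP : forall j, (2 <= j <= l)%N -> W_space j (w j)) :
  exists F G : R -> R -> R,
    [/\ polynomial2 F, polynomial2 G,
        vanishes_to_first_order F, vanishes_to_first_order G
      & FM_reduction a beta Psi F G l
          (fun u => Bmx *m u + \sum_(2 <= j < l.+1) w j u)].
Proof.
have [wp wp2 wpE] := W_space_sum wP.
have l_gt0 : (0 < l)%N by exact: ltnW.
have [k [F [G [k2 F2 G2 res]]]] :=
  @formal_solution R a beta (tau0 a beta) l (tau0_root beta a_gt0) (tau0_nondeg a_gt0 nondeg)
    l_gt0 wp wp2.
exists (fun2 F), (fun2 G); split; try exact: polynomial2_fun2; try exact: fun2_vanishes.
pose phi := cm_phi a beta Psi l wp k.
pose h : 'I_(5 * l).+1 * 'I_2 -> mpoly 3 R := cm_h wp k.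
pose b : 'I_(5 * l).+1 * 'I_2 -> 'cV[{poly R}]_2 := @cm_basis R a beta Psi l.
have phi2 : forall i, wge mdeg 2 (phi i - mpolyX R (mnm1 i)) := cm_phi2 a_gt0 PsiP l_gt0 wp2 k2.
have h2 : forall i, wge mdeg 2 (h i) := cm_h2 wp2 k2.
(* The changes of variables realize only this factorization of (phi, h). It agrees with (phi, h)
   modulo degree l + 1, so the defect bounds carry over. *)
have [dphi dh phi'2 h'2] := wge_factors phi2 h2 l.-1.
rewrite prednK // in dphi dh.
pose phi' := (factors phi h l.-1).1; pose h' := (factors phi h l.-1).2.
have du : forall i, wge mdeg l.+1 (defect_u a beta Psi wp F G b phi' h' i).
  move=> i; apply: (defect_u_sub wp2 F2 G2 phi2 h2 phi'2 h'2 dphi dh).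
  exact: (defect_u_cm a_gt0 PsiP l_gt0 wp2 k2 res).
have dv : forall t c, wge mdeg l.+1 (defect_v a beta Psi wp F G b phi' h' t c).
  move=> t c; apply: (defect_v_sub wp2 F2 G2 phi2 h2 phi'2 h'2 dphi dh).
  exact: (defect_v_cm a_gt0 PsiP l_gt0 wp2 k2 res).
have d0 : forall c, wge mdeg l.+1 (defect_0 a beta F G b phi' h' c).
  move=> c; apply: (defect_0_sub F2 G2 phi2 h2 phi'2 h'2 dphi dh).
  exact: (defect_0_cm a_gt0 PsiP l_gt0 wp2 k2 res).
have [d dn0 fP] :=
  pulled_back_reduced b (decomposed_system a beta Psi (fun2 F) (fun2 G)) phi h l.-1.
exists (shift1 phi h), (shift2 b phi h); split=> [j /andP[j2 _]|].
  have homog_pi (p : mpoly 3 R) : pihomog mdeg (j - 2).+2 p \is @ishomog1 _ _ j mdeg.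
    rewrite -{2}(subnK j2) addn2; exact: pihomogP.
  split; first by apply: homogeneous_polymap => i; exact: homog_pi.
  by apply: (homogeneous_hmap a_gt0 PsiP) => i; [move=> m; exact: (bil_bpoly a_gt0 PsiP)|exact: homog_pi].
have nf := term1_normal_form a_gt0 dn0 fP du.
split; first apply: (normal_form F2 G2 phi'2 h'2 a_gt0 PsiP dn0 fP wp2 du dv d0) => j jl.
  have -> : (fun u => (along u wp)`_j *: delta_mx 2%:R 0) = w j.
    by apply/funext => u; rewrite -wpE.
  exact: wP.
move=> u; congr (_ + _); apply: eq_big_nat => j /= jl.
by rewrite wpE ?nf.
Qed.
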